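(* Let $\alpha>0$, $\varphi>0$ and $w(t)=\frac1{2\pi}|\Gamma(\alpha/2+it)|^2e^{\pi t}$. The inverse Vilenkin transform $\mathfrak V_\alpha^{-1}$ sends the difference operator $$\mathcal L f(t)=i(\alpha/2+it)\,f(t-i)+2\cosh\varphi\;t\,f(t)-i(\alpha/2-it)\,f(t+i)$$ to the operator $$\mathcal N f(s)=2s\sinh\varphi\,f(s).$$
   Context: The Vilenkin transform is the operator $$\mathfrak V_\alpha g(t)=(1-e^{-2\varphi})^{\alpha/2}e^{-\varphi it}\int_{-\infty}^\infty g(s)\;{}_2F_1\!\left[\begin{matrix}\alpha/2-is,\ \alpha/2+it\\\alpha\end{matrix};1-e^{-2\varphi}\right]w(s)\,ds,$$ regarded as a unitary operator $L^2(\mathbb R,w(s)\,ds)\to L^2(\mathbb R,w(s)\,ds)$, with the inversion formula $$\mathfrak V_\alpha^{-1} f(s)=(1-e^{-2\varphi})^{\alpha/2}\int_{-\infty}^\infty f(t)\;{}_2F_1\!\left[\begin{matrix}\alpha/2+is,\ \alpha/2-it\\\alpha\end{matrix};1-e^{-2\varphi}\right]e^{\varphi it}\,w(t)\,dt.$$ Here ${}_2F_1$ is the Gauss hypergeometric function, and integral operators are understood in the sense of the kernel theorem. The operators $\mathcal L$ and $\mathcal N$ act in $L^2(\mathbb R,w(s)\,ds)$. The operator $\mathcal L$ is considered on the space $\mathcal H[w]$ of functions $f$ holomorphic in the closed strip $|\operatorname{Im}s|\le1$ (i.e. in a strip $|\operatorname{Im}s|<1+\delta$, $\delta>0$) such that,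 for some $\varepsilon>0$, $f(s)=O(\Psi(s)^{-1/2}|s|^{-3/2-\varepsilon})$ as $s\to\infty$ in the strip, where $\Psi(s)=|s|^{\alpha-1}\exp(\pi\operatorname{Re}s-\pi|\operatorname{Re}s|)$ describes the asymptotics of $w$ up to a constant factor. *)

(* Defs.v *)
From mathcomp Require Export all_boot all_order all_algebra.
From mathcomp Require Export complex.
From mathcomp Require Export all_classical all_reals all_analysis.
Export Order.TTheory GRing.Theory Num.Theory.
Export numFieldNormedType.Exports.

Set Implicit Arguments.
Unset Strict Implicit.
Unset Printing Implicit Defensive.

Local Open Scope classical_set_scope.
Local Open Scope ring_scope.
Local Open Scope complex_scope.

Section Vilenkin.
Variable R : realType.
Implicit Types (s t alpha phi : R) (a b c z : R[i]).

Local Notation mu := (@lebesgue_measure R).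

Definition cabs z : R := ComplexField.Normc.normc z.

Definition ci : R[i] := 0 +i* 1.

Definition cexp z : R[i] :=
  (expR (complex.Re z))%:C * (cos (complex.Im z) +i* sin (complex.Im z)).

Definition cintegrable (D : set R) (g : R -> R[i]) : Prop :=
  mu.-integrable D (fun x => (complex.Re (g x))%:E) /\
  mu.-integrable D (fun x => (complex.Im (g x))%:E).

Definition cintegral (D : set R) (g : R -> R[i]) : R[i] :=
  (\int[mu]_(x in D) complex.Re (g x)) +i* (\int[mu]_(x in D) complex.Im (g x)).

(* Euler's integral: this is the Gamma function for 0 < Re z only, which is
   where the weight evaluates it. *)
Definition cGamma z : R[i] :=
  cintegral `]0, +oo[ (fun x => cexp ((z - 1) * (ln x)%:C) * (expR (- x))%:C).

Definition pochhammer a (n : nat) : R[i] := \prod_(k < n) (a + k%:R).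

(* The sum of the Gauss series, i.e. the hypergeometric function on the unit
   disc (meaningless when c is a nonpositive integer). *)
Definition gauss2F1 a b c z : R[i] :=
  limn (series (fun n : nat =>
    pochhammer a n * pochhammer b n / (pochhammer c n * n`!%:R) * z ^+ n
      : R[i]^o)).

Definition coshR (x : R) : R := (expR x + expR (- x)) / 2.
Definition sinhR (x : R) : R := (expR x - expR (- x)) / 2.

Definition weight alpha t : R :=
  (2 * pi)^-1 * cabs (cGamma ((alpha / 2) +i* t)) ^+ 2 * expR (pi * t).

Definition in_L2w alpha (g : R -> R[i]) : Prop :=
  [/\ measurable_fun setT (fun t => complex.Re (g t)),
      measurable_fun setT (fun t => complex.Im (g t)) &
      mu.-integrable setT (fun t => (cabs (g t) ^+ 2 * weight alpha t)%:E)].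

Definition inv_vilenkin_integrand alpha phi (g : R -> R[i]) s : R -> R[i] :=
  fun t =>
    g t * gauss2F1 ((alpha / 2) +i* s) ((alpha / 2) -i* t) alpha%:C
            (1 - expR (- 2 * phi))%:C
      * cexp (0 +i* (phi * t)) * (weight alpha t)%:C.

Definition inv_vilenkin alpha phi (g : R -> R[i]) : R -> R[i] :=
  fun s => ((1 - expR (- 2 * phi)) `^ (alpha / 2))%:C
    * cintegral setT (inv_vilenkin_integrand alpha phi g s).

Definition Psi alpha z : R :=
  cabs z `^ (alpha - 1) * expR (pi * complex.Re z - pi * `|complex.Re z|).

(* Functions on the strip are represented by total functions on R[i]; their
   values outside a neighbourhood of the closed strip are irrelevant. *)
Definition in_Hw alpha (f : R[i] -> R[i]) : Prop :=
  (exists2 delta : R, 0 < delta &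
     forall z, `|complex.Im z| < 1 + delta ->
       derivable (f : R[i]^o -> R[i]^o) z 1) /\
  (exists2 eps : R, 0 < eps &
     exists C M : R, forall z, `|complex.Im z| <= 1 -> M <= cabs z ->
       cabs (f z) <= C * (Psi alpha z `^ (- (1 / 2))
                          * cabs z `^ (- (3 / 2) - eps))).

Definition on_line (f : R[i] -> R[i]) : R -> R[i] := fun t => f t%:C.

Definition opL alpha phi (f : R[i] -> R[i]) : R -> R[i] := fun t =>
  ci * ((alpha / 2) +i* t) * f (t%:C - ci)
  + (2 * coshR phi * t)%:C * f t%:C
  - ci * ((alpha / 2) -i* t) * f (t%:C + ci).

Definition opN phi (g : R -> R[i]) : R -> R[i] := fun s =>
  (2 * s * sinhR phi)%:C * g s.

End Vilenkin.

(* Main.v *)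
(** With [c = 2 phi], [a = alpha/2], [p = a - i s], [r = a + i s], the integral
      S p r z = int_R e^(z y) (1 + e^y)^(-p) (1 + e^(y - c))^(-r) dy
    is B(z, alpha - z) times the hypergeometric function of the kernel
    (for [p + r = alpha]: expand [((1 + e^(y - c)) / (1 + e^y))^(-r)] in the binomial
    series), and for [p = alpha], [r = 0], [z = a - i t] it is
    |Gamma(a + i t)|^2 / Gamma(alpha).  Hence weight times hypergeometric factor is a
    constant times [e^(pi t) S p r (a - i t)], an expression holomorphic in [t].
    It is a combination of three translates [Y(t), Y(t + i), Y(t + 2 i)] of
    [Y(t) = S (p + 1) (r + 1) (a - i t)], and so is its product with [a - i t],
    by integration by parts.  Moving the line of integration in [S] to within
    [O(1/t)] of the branch points on [Im y = - pi] gives the decay e^(-pi t) needed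
    for shifting the contour of [int e^((pi + i phi) t) Y(t + i j) f(t) dt] by [i],
    which turns the terms with [f(t - i)] and [f(t + i)] into terms with [f(t)];
    the coefficients then match. *)

Require Import Defs.
From mathcomp Require Import ring lra measurable_realfun.

Set Implicit Arguments.
Unset Strict Implicit.
Unset Printing Implicit Defensive.

Local Open Scope classical_set_scope.
Local Open Scope ring_scope.
Local Open Scope complex_scope.

(** * Complex exponential, derivative and logarithm *)

Section Modulus.
Variable R : realType.
Implicit Types (x y : R) (z w h : R[i]).

(** Only absolutely convergent integrals are used. As a function of t the weight continues with
    poles at distance a from the real line, so for small a the contour cannot be moved by i through
    the integrand as it stands. Raising p and r by one widens the strip where [S] converges from |Im
    t| < a to - a < Im t < a + 2. This contains t, t + i and t + 2 i for every a > 0, and neither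
    Gamma nor the hypergeometric function has to be continued analytically. The powers of t balance:
    Y(t) is O(t^a e^(- pi t)) for t > 0, a function in H[w] is O(|t|^(- a - 1 - eps)) up to the
    matching exponential, and the product owes its integrability to eps alone. The estimate of [S]
    on the displaced line is set up for a bound k >= 2 on the exponents; for smaller exponents
    integration by parts raises them beforehand, and each step gains a factor 1/|z|. *)

Lemma complexP z w :
  complex.Re z = complex.Re w -> complex.Im z = complex.Im w -> z = w.
Proof. by case: z w => [a b] [c d] /= -> ->. Qed.

Lemma ReM z w : complex.Re (z * w)
  = complex.Re z * complex.Re w - complex.Im z * complex.Im w.
Proof. by case: z w => [a b] [c d]. Qed.

Lemma ImM z w : complex.Im (z * w)
  = complex.Re z * complex.Im w + complex.Im z * complex.Re w.
Proof. by case: z w => [a b] [c d]. Qed.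

Lemma ReD z w : complex.Re (z + w) = complex.Re z + complex.Re w.
Proof. by case: z w => [a b] [c d]. Qed.

Lemma ImD z w : complex.Im (z + w) = complex.Im z + complex.Im w.
Proof. by case: z w => [a b] [c d]. Qed.

Lemma ReN z : complex.Re (- z) = - complex.Re z.
Proof. by case: z. Qed.

Lemma ImN z : complex.Im (- z) = - complex.Im z.
Proof. by case: z. Qed.

Lemma ReMl x z : complex.Re (x%:C * z) = x * complex.Re z.
Proof. by rewrite ReM /= mul0r subr0. Qed.

Lemma ImMl x z : complex.Im (x%:C * z) = x * complex.Im z.
Proof. by rewrite ImM /= mul0r addr0. Qed.

Definition ReImE := (ReM, ImM, ReD, ImD, ReN, ImN).

Lemma sqr_cabs z : cabs z ^+ 2 = complex.Re z ^+ 2 + complex.Im z ^+ 2.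
Proof. by case: z => a b; rewrite /cabs /= sqr_sqrtr// addr_ge0// sqr_ge0. Qed.

Lemma cabs_ge0 z : 0 <= cabs z.
Proof. by case: z => a b; rewrite /cabs sqrtr_ge0. Qed.

Lemma cabs_le z x : 0 <= x ->
  complex.Re z ^+ 2 + complex.Im z ^+ 2 <= x ^+ 2 -> cabs z <= x.
Proof. by move=> x0; rewrite -sqr_cabs ler_sqr// nnegrE cabs_ge0. Qed.

Lemma cabs_normE z : `|z| = (cabs z)%:C.
Proof. by rewrite normc_def; case: z. Qed.

Lemma cabsM z w : cabs (z * w) = cabs z * cabs w.
Proof. exact: ComplexField.Normc.normcM. Qed.

Lemma cabsD z w : cabs (z + w) <= cabs z + cabs w.
Proof. exact: le_normcD. Qed.

Lemma cabsN z : cabs (- z) = cabs z.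
Proof. exact: normcN. Qed.

Lemma cabsB z w : cabs (z - w) <= cabs z + cabs w.
Proof. by rewrite -(cabsN w) cabsD. Qed.

Lemma cabsV z : cabs z^-1 = (cabs z)^-1.
Proof. exact: ComplexField.Normc.normcV. Qed.

Lemma cabs0 : cabs (0 : R[i]) = 0.
Proof. exact: ComplexField.Normc.normc0. Qed.

Lemma cabs_eq0 z : (cabs z == 0) = (z == 0).
Proof.
apply/eqP/eqP => [/ComplexField.Normc.eq0_normc//|->]; exact: cabs0.
Qed.

Lemma cabs_gt0 z : (0 < cabs z) = (z != 0).
Proof. by rewrite lt_def cabs_ge0 andbT cabs_eq0. Qed.

Lemma cabs_real x : cabs x%:C = `|x|.
Proof. by rewrite /cabs /= expr0n /= addr0 sqrtr_sqr. Qed.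

Lemma cabs_ge_Re z : `|complex.Re z| <= cabs z.
Proof.
rewrite -ler_sqr ?nnegrE ?cabs_ge0// sqr_cabs real_normK ?num_real//.
by rewrite lerDl sqr_ge0.
Qed.

Lemma cabs_ge_Im z : `|complex.Im z| <= cabs z.
Proof.
rewrite -ler_sqr ?nnegrE ?cabs_ge0// sqr_cabs real_normK ?num_real//.
by rewrite lerDr sqr_ge0.
Qed.

Lemma cabs_le_ReIm z : cabs z <= `|complex.Re z| + `|complex.Im z|.
Proof.
apply: cabs_le; first by rewrite addr_ge0.
have := normr_ge0 (complex.Re z); have := normr_ge0 (complex.Im z).
rewrite -(real_normK (num_real (complex.Re z))).
by rewrite -(real_normK (num_real (complex.Im z))); nra.
Qed.

Lemma cexpD z w : cexp (z + w) = cexp z * cexp w.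
Proof.
by case: z w => [a b] [c d]; apply: complexP; rewrite /cexp /= expRD cosD sinD; ring.
Qed.

Lemma cexp0 : cexp (0 : R[i]) = 1.
Proof. by apply: complexP; rewrite /cexp /= expR0 cos0 sin0; ring. Qed.

Lemma Re_cexp z : complex.Re (cexp z) = expR (complex.Re z) * cos (complex.Im z).
Proof. by rewrite /cexp !ReImE /=; ring. Qed.

Lemma Im_cexp z : complex.Im (cexp z) = expR (complex.Re z) * sin (complex.Im z).
Proof. by rewrite /cexp !ReImE /=; ring. Qed.

Opaque cexp.

Lemma cabs_cexp z : cabs (cexp z) = expR (complex.Re z).
Proof.
apply/eqP; rewrite -(@eqrXn2 _ 2)// ?cabs_ge0 ?expR_ge0// sqr_cabs Re_cexp Im_cexp.
by rewrite !exprMn -mulrDr cos2Dsin2 mulr1.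
Qed.

Lemma cexp_neq0 z : cexp z != 0.
Proof. by rewrite -cabs_gt0 cabs_cexp expR_gt0. Qed.

Lemma cexpN z : cexp (- z) = (cexp z)^-1.
Proof.
apply: (mulfI (cexp_neq0 z)); rewrite divff ?cexp_neq0//.
by rewrite -cexpD subrr cexp0.
Qed.

Lemma cexp_real x : cexp x%:C = (expR x)%:C.
Proof. by apply: complexP; rewrite ?Re_cexp ?Im_cexp /= ?cos0 ?sin0; ring. Qed.

Lemma is_derive_continuous (f : R -> R) x d :
  is_derive x 1 f d -> {for x, continuous f}.
Proof. by move=> [df _]; exact/differentiable_continuous/derivable1_diffP. Qed.

(** A complex curve has no mean value equality. Applied to the real and the imaginary part
    separately, it yields two intermediate points, hence the factor 2. *)
Lemma curve_increment (k dk : R -> R[i]) B :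
  (forall x, is_derive x 1 (fun u => complex.Re (k u)) (complex.Re (dk x))) ->
  (forall x, is_derive x 1 (fun u => complex.Im (k u)) (complex.Im (dk x))) ->
  forall b, 0 <= b -> (forall x, 0 <= x <= b -> cabs (dk x) <= B) ->
  cabs (k b - k 0) <= 2 * B * b.
Proof.
move=> dRe dIm b b0 kB.
have [c cb Ec] := MVT_segment b0 (fun x _ => dRe x)
  (continuous_subspaceT (fun x => is_derive_continuous (dRe x))).
have [d db Ed] := MVT_segment b0 (fun x _ => dIm x)
  (continuous_subspaceT (fun x => is_derive_continuous (dIm x))).
rewrite (le_trans (cabs_le_ReIm _))// !ReImE Ec Ed subr0.
have {}cb : cabs (dk c) <= B by apply: kB; rewrite in_itv /= in cb.
have {}db : cabs (dk d) <= B by apply: kB; rewrite in_itv /= in db.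
rewrite !normrM (ger0_norm b0) -mulrDl ler_wpM2r//.
have := cabs_ge_Re (dk c); have := cabs_ge_Im (dk d); lra.
Qed.

Lemma is_derive_cexp_line h x :
  is_derive x 1 (fun u => complex.Re (cexp (u%:C * h))) (complex.Re (h * cexp (x%:C * h))) /\
  is_derive x 1 (fun u => complex.Im (cexp (u%:C * h))) (complex.Im (h * cexp (x%:C * h))).
Proof.
case: h => a b.
split.
- rewrite (_ : (fun u => _) = (fun u => expR (u * a) * cos (u * b))); last first.
    by apply/funext => u; rewrite Re_cexp !ReImE /=; congr (expR _ * cos _); ring.
  apply: is_derive_eq; rewrite ?(ReM (a +i* b)) ?(ImM (a +i* b)) Re_cexp Im_cexp !ReImE /=.
  rewrite !mul0r subr0 addr0 /GRing.scale /=; ring.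
- rewrite (_ : (fun u => _) = (fun u => expR (u * a) * sin (u * b))); last first.
    by apply/funext => u; rewrite Im_cexp !ReImE /=; congr (expR _ * sin _); ring.
  apply: is_derive_eq; rewrite ?(ReM (a +i* b)) ?(ImM (a +i* b)) Re_cexp Im_cexp !ReImE /=.
  rewrite !mul0r subr0 addr0 /GRing.scale /=; ring.
Qed.

Lemma cexp_increment1 h : cabs (cexp h - 1) <= 2 * cabs h * expR (cabs h).
Proof.
have -> : cexp h - 1 = cexp (1%:C * h) - cexp (0%:C * h).
  by rewrite mul1r mul0r cexp0.
have := @curve_increment (fun u => cexp (u%:C * h)) (fun u => h * cexp (u%:C * h))
  (cabs h * expR (cabs h)) (fun x => (is_derive_cexp_line h x).1)
  (fun x => (is_derive_cexp_line h x).2) 1 ler01.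
rewrite mulr1 mulrA; apply => x /andP[x0 x1].
rewrite cabsM cabs_cexp ler_wpM2l ?cabs_ge0// ler_expR ReM /= mul0r subr0.
have := cabs_ge_Re h; have := ler_norm (complex.Re h); have := cabs_ge0 h; nra.
Qed.

(** The derivative of cexp (u h) - u h in u is h (cexp (u h) - 1), to which the first-order estimate
    applies. Used for the derivative of the exponential and for differentiation under the integral
    sign. *)
Lemma cexp_increment2 h :
  cabs (cexp h - 1 - h) <= 4 * cabs h ^+ 2 * expR (cabs h).
Proof.
have -> : cexp h - 1 - h = (cexp (1%:C * h) - 1%:C * h) - (cexp (0%:C * h) - 0%:C * h).
  by rewrite !mul1r !mul0r cexp0; ring.
have dl (a x : R) : is_derive x 1 (fun u : R => u * a) a.
  by apply: is_derive_eq; rewrite /GRing.scale /=; ring.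
have := @curve_increment (fun u => cexp (u%:C * h) - u%:C * h)
  (fun u => h * (cexp (u%:C * h) - 1)) (2 * cabs h ^+ 2 * expR (cabs h)) _ _ 1 ler01.
have -> : 2 * (2 * cabs h ^+ 2 * expR (cabs h)) * 1 = 4 * cabs h ^+ 2 * expR (cabs h).
  by ring.
apply.
- move=> x; rewrite mulrBr mulr1 ReD ReN.
  rewrite (_ : (fun u => _) =
     (fun u => complex.Re (cexp (u%:C * h))) - (fun u => u * complex.Re h)).
    by apply: is_deriveB; exact: (is_derive_cexp_line h x).1.
  by apply/funext => u; rewrite ReD ReN (ReMl u).
- move=> x; rewrite mulrBr mulr1 ImD ImN.
  rewrite (_ : (fun u => _) =
     (fun u => complex.Im (cexp (u%:C * h))) - (fun u => u * complex.Im h)).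
    by apply: is_deriveB; exact: (is_derive_cexp_line h x).2.
  by apply/funext => u; rewrite ImD ImN (ImMl u).
- move=> x /andP[x0 x1]; rewrite cabsM.
  rewrite [leRHS](_ : _ = cabs h * (2 * cabs h * expR (cabs h))); last by ring.
  rewrite ler_wpM2l ?cabs_ge0//.
  apply: le_trans (cexp_increment1 _) _.
  have le1 : cabs (x%:C * h) <= cabs h.
    by rewrite cabsM cabs_real ger0_norm// ler_piMl// cabs_ge0.
  by rewrite ler_pM ?mulr_ge0 ?cabs_ge0 ?expR_ge0// ?ler_expR// ler_pM2l.
Qed.

End Modulus.

(** * Complex differentiability in terms of real moduli *)

Section ComplexDerivative.
Variable R : realType.
Implicit Types (x y t : R) (z w h d : R[i]) (f g : R[i] -> R[i]).

(** First-order expansion with real radii and errors. The norm of [R[i]] is [R[i]]-valued, so the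
    generic derivative would carry complex epsilons through every estimate; [derivable_cderiv] is
    the bridge from it. *)
Definition cderiv f z d : Prop := forall e : R, 0 < e ->
  exists2 r : R, 0 < r & forall w, cabs (w - z) < r ->
    cabs (f w - f z - d * (w - z)) <= e * cabs (w - z).

Lemma cderiv_lipschitz f z d : cderiv f z d ->
  exists2 r : R, 0 < r & forall w, cabs (w - z) < r ->
    cabs (f w - f z) <= (cabs d + 1) * cabs (w - z).
Proof.
move=> /(_ 1 ltr01)[r r0 H]; exists r => // w /H {}H.
have -> : f w - f z = (f w - f z - d * (w - z)) + d * (w - z) by ring.
by rewrite (le_trans (cabsD _ _))// cabsM; lra.
Qed.

Lemma cderiv_cts f z d : cderiv f z d -> forall e : R, 0 < e ->
  exists2 r : R, 0 < r & forall w, cabs (w - z) < r -> cabs (f w - f z) < e.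
Proof.
move=> /cderiv_lipschitz[r r0 H] e e0.
have K0 : 0 < cabs d + 1 by rewrite ltr_wpDl ?cabs_ge0.
exists (Num.min r (e / (cabs d + 1))); first by rewrite lt_min r0 divr_gt0.
move=> w; rewrite lt_min => /andP[wr we].
by rewrite (le_lt_trans (H _ wr))// mulrC -ltr_pdivlMr.
Qed.

Lemma cderiv_cst c z : cderiv (fun=> c) z 0.
Proof.
move=> e e0; exists 1 => // w _.
by rewrite mul0r !subrr cabs0 mulr_ge0 ?cabs_ge0// ltW.
Qed.

Lemma cderiv_id z : cderiv id z 1.
Proof.
move=> e e0; exists 1 => // w _.
by rewrite mul1r subrr cabs0 mulr_ge0 ?cabs_ge0// ltW.
Qed.

Lemma cderivD f g z d d' :
  cderiv f z d -> cderiv g z d' -> cderiv (fun w => f w + g w) z (d + d').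
Proof.
move=> df dg e e0.
have e2 : 0 < e / 2 by rewrite divr_gt0.
have [r r0 Hf] := df _ e2; have [s s0 Hg] := dg _ e2.
exists (Num.min r s); first by rewrite lt_min r0.
move=> w; rewrite lt_min => /andP[/Hf {}Hf /Hg {}Hg].
have -> : f w + g w - (f z + g z) - (d + d') * (w - z) =
  (f w - f z - d * (w - z)) + (g w - g z - d' * (w - z)) by ring.
by rewrite (le_trans (cabsD _ _))//; lra.
Qed.

Lemma cderivM f g z d d' : cderiv f z d -> cderiv g z d' ->
  cderiv (fun w => f w * g w) z (d * g z + f z * d').
Proof.
move=> df dg e e0.
(* The coefficients of the three error terms of the product rule, so that each term may be measured
   in units of e / K. *)
set K := cabs (g z) + 1 + cabs (f z) + cabs d.
have K0 : 0 < K.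
  by rewrite /K; have := cabs_ge0 (g z); have := cabs_ge0 (f z);
     have := cabs_ge0 d; lra.
have eK : 0 < e / K by rewrite divr_gt0.
have [r1 r10 Hf] := df _ eK; have [r2 r20 Hg] := dg _ eK.
have [r3 r30 Cg] := cderiv_cts dg eK.
have [r4 r40 Bg] := cderiv_cts dg ltr01.
exists (Num.min (Num.min r1 r2) (Num.min r3 r4)).
  by rewrite !lt_min r10 r20 r30.
move=> w; rewrite !lt_min => /andP[/andP[/Hf {}Hf /Hg {}Hg] /andP[/Cg {}Cg /Bg {}Bg]].
have -> : f w * g w - f z * g z - (d * g z + f z * d') * (w - z) =
  (f w - f z - d * (w - z)) * g w + f z * (g w - g z - d' * (w - z))
  + d * (w - z) * (g w - g z) by ring.
have gw : cabs (g w) <= cabs (g z) + 1.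
  have -> : g w = g z + (g w - g z) by ring.
  by rewrite (le_trans (cabsD _ _))// lerD2l ltW.
rewrite (le_trans (cabsD _ _))// (le_trans (lerD (cabsD _ _) (lexx _)))// !cabsM.
have -> : e * cabs (w - z) = e / K * cabs (w - z) * (cabs (g z) + 1)
   + cabs (f z) * (e / K * cabs (w - z)) + cabs d * cabs (w - z) * (e / K).
  by rewrite /K; field; rewrite -/K gt_eqF.
by rewrite !lerD// ?ler_pM ?cabs_ge0 ?mulr_ge0 ?cabs_ge0// ?(ltW eK)// ltW.
Qed.

Lemma cderiv_comp f g z d d' : cderiv g z d' -> cderiv f (g z) d ->
  cderiv (fun w => f (g w)) z (d * d').
Proof.
move=> dg df e e0.
set K := (cabs d' + 1) + cabs d.
have K0 : 0 < K by rewrite /K; have := cabs_ge0 d'; have := cabs_ge0 d; lra.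
have eK : 0 < e / K by rewrite divr_gt0.
have [r1 r10 Hf] := df _ eK; have [r2 r20 Hg] := dg _ eK.
have [r3 r30 Cg] := cderiv_cts dg r10.
have [r4 r40 Lg] := cderiv_lipschitz dg.
exists (Num.min r2 (Num.min r3 r4)); first by rewrite !lt_min r20 r30.
move=> w; rewrite !lt_min => /andP[/Hg {}Hg /andP[/Cg {}Cg /Lg {}Lg]].
have {}Hf := Hf _ Cg.
have -> : f (g w) - f (g z) - d * d' * (w - z) =
  (f (g w) - f (g z) - d * (g w - g z)) + d * (g w - g z - d' * (w - z)) by ring.
rewrite (le_trans (cabsD _ _))// cabsM.
have -> : e * cabs (w - z) = e / K * ((cabs d' + 1) * cabs (w - z))
   + cabs d * (e / K * cabs (w - z)).
  by rewrite /K; field; rewrite -/K gt_eqF.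
rewrite lerD//; last by rewrite ler_wpM2l ?cabs_ge0.
by rewrite (le_trans Hf)// ler_wpM2l// ltW.
Qed.

Lemma cderiv_eq f g z d d' : f =1 g -> d = d' -> cderiv f z d -> cderiv g z d'.
Proof. by move=> /funext -> ->. Qed.

Lemma cderivN f z d : cderiv f z d -> cderiv (fun w => - f w) z (- d).
Proof.
move=> df; apply: (cderiv_eq _ _ (cderivM (cderiv_cst (-1) z) df)) => [w|]; ring.
Qed.

Lemma cderivB f g z d d' :
  cderiv f z d -> cderiv g z d' -> cderiv (fun w => f w - g w) z (d - d').
Proof. by move=> df dg; exact: cderivD (cderivN dg). Qed.

Lemma cderivZ c f z d : cderiv f z d -> cderiv (fun w => c * f w) z (c * d).
Proof.
move=> df; apply: (cderiv_eq _ _ (cderivM (cderiv_cst c z) df)) => [w|]//; ring.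
Qed.

Lemma cderiv_cexp z : cderiv (@cexp R) z (cexp z).
Proof.
move=> e e0.
set K := cabs (cexp z) * (4 * expR 1) + 1.
have K0 : 0 < K by rewrite ltr_wpDl// !mulr_ge0 ?cabs_ge0 ?expR_ge0.
exists (Num.min 1 (e / K)); first by rewrite lt_min divr_gt0// ltr01.
move=> w; rewrite lt_min => /andP[w1 /ltW wK].
have -> : cexp w - cexp z - cexp z * (w - z)
    = cexp z * (cexp (w - z) - 1 - (w - z)).
  have -> : cexp w = cexp z * cexp (w - z) by rewrite -cexpD addrC subrK.
  ring.
rewrite cabsM; apply: (@le_trans _ _ (K * cabs (w - z) * cabs (w - z))); last first.
  by rewrite ler_wpM2r ?cabs_ge0// mulrC -ler_pdivlMr.
rewrite (le_trans (ler_wpM2l (cabs_ge0 _) (cexp_increment2 _)))//.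
have : 4 * cabs (w - z) ^+ 2 * expR (cabs (w - z)) <= 4 * cabs (w - z) ^+ 2 * expR 1.
  by apply: ler_wpM2l; [rewrite mulr_ge0 ?sqr_ge0|rewrite ler_expR ltW].
move=> /(ler_wpM2l (cabs_ge0 (cexp z))) /le_trans; apply.
rewrite /K; have := sqr_ge0 (cabs (w - z)); lra.
Qed.

Lemma derivable_cderiv f z :
  derivable (f : R[i]^o -> R[i]^o) (z : R[i]^o) 1 -> exists d, cderiv f z d.
Proof.
move=> /cvg_ex[/= d /cvgrPdist_le /= H]; exists d => e e0.
have e0' : 0 < e%:C by rewrite ltcR.
have := H _ e0'; rewrite near_withinE nearE => -[/= r r0 Hr].
(* The radius of the ball is an element of [R[i]]; being positive, it is real. *)
have rC : r = (complex.Re r)%:C by move: r0; rewrite ltcE /= => /andP[/eqP]; case: r {Hr} => a b /= ->.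
exists (complex.Re r); first by move: r0; rewrite rC ltcR.
move=> w wr; have [->|wz] := eqVneq w z.
  by rewrite !subrr mulr0 subrr cabs0 mulr0.
have wz0 : w - z != 0 by rewrite subr_eq0.
have {}Hr : `|d - (w - z)^-1 * (f w - f z)| <= e%:C.
  have := Hr (w - z).
  rewrite /ball_ /= sub0r normrN /GRing.scale /= mulr1 subrK; apply => //.
  by rewrite cabs_normE rC ltcR.
move: Hr; rewrite cabs_normE lecR => Hr.
have -> : f w - f z - d * (w - z) = - (d - (w - z)^-1 * (f w - f z)) * (w - z).
  by field.
by rewrite cabsM cabsN ler_wpM2r// cabs_ge0.
Qed.

(** Satisfied by lines parametrised at unit speed, and all that is needed to restrict a holomorphic
    function to them. *)
Definition contraction (u : R -> R[i]) := forall s t, cabs (u s - u t) <= `|s - t|.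

Lemma contraction_horizontal w : contraction (fun x => x%:C + w).
Proof.
move=> s t; rewrite (_ : _ - _ = (s - t)%:C) ?cabs_real//.
by rewrite rmorphB /=; ring.
Qed.

Lemma contraction_vertical w : contraction (fun x => w + ci R * x%:C).
Proof.
move=> s t; rewrite (_ : _ - _ = ci R * (s - t)%:C); last by rewrite rmorphB /=; ring.
by rewrite cabsM cabs_real /cabs /= expr0n /= expr1n add0r sqrtr1 mul1r.
Qed.

Definition ccontinuous (k : R -> R[i]) t :=
  {for t, continuous (fun x => complex.Re (k x))} /\
  {for t, continuous (fun x => complex.Im (k x))}.

Lemma ccontinuousP (k : R -> R[i]) t :
  (forall e : R, 0 < e -> exists2 r : R, 0 < r &
    forall s, `|s - t| < r -> cabs (k s - k t) < e) -> ccontinuous k t.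
Proof.
move=> H; split; apply/cvgrPdist_lt => e /H[r r0 {}H]; near=> s;
  have /H : `|s - t| < r by rewrite distrC; near: s; apply/nbhs_ballP; exists r => //=.
- apply: le_lt_trans; rewrite distrC.
  by have := cabs_ge_Re (k s - k t); rewrite ReD ReN.
- apply: le_lt_trans; rewrite distrC.
  by have := cabs_ge_Im (k s - k t); rewrite ImD ImN.
Unshelve. all: by end_near. Qed.

Lemma cderiv_ccontinuous f d (u : R -> R[i]) t :
  contraction u -> cderiv f (u t) d -> ccontinuous (fun x => f (u x)) t.
Proof.
move=> cu df; apply: ccontinuousP => e /(cderiv_cts df)[r r0 H].
by exists r => // s st; apply: H; exact: le_lt_trans (cu _ _) st.
Qed.

Lemma cderiv_is_derive f w d x : cderiv f (x%:C + w) d ->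
  is_derive x 1 (fun t => complex.Re (f (t%:C + w))) (complex.Re d) /\
  is_derive x 1 (fun t => complex.Im (f (t%:C + w))) (complex.Im d).
Proof.
move=> df.
(* [pr] stands for either coordinate; only real linearity and the bound by the modulus are used. *)
have key (pr : R[i] -> R) : (forall z z', pr (z - z') = pr z - pr z') ->
    (forall (s : R) z, pr (s%:C * z) = s * pr z) -> (forall z, `|pr z| <= cabs z) ->
    is_derive x 1 (fun t => pr (f (t%:C + w))) (pr d).
  move=> prB prZ pr_le.
  have H : (fun h : R => h^-1 *: (pr (f ((h *: (1:R) + x)%:C + w)) - pr (f (x%:C + w))))
      @ 0^' --> pr d.
    apply/cvgrPdist_le => e /df[r r0 H]; near=> h.
    have h0 : h != 0 by near: h; exact: nbhs_dnbhs_neq.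
    have hr : `|h| < r.
      near: h; apply: dnbhs0_lt => //.
    rewrite distrC /GRing.scale /= mulr1.
    have E : (h + x)%:C + w - (x%:C + w) = h%:C by rewrite rmorphD /=; ring.
    have := H ((h + x)%:C + w); rewrite E cabs_real => /(_ hr) {}H.
    have Eh : h^-1 * (pr (f ((h + x)%:C + w)) - pr (f (x%:C + w))) - pr d
       = h^-1 * pr (f ((h + x)%:C + w) - f (x%:C + w) - d * h%:C).
      by rewrite (mulrC d) !prB prZ; field.
    rewrite Eh normrM normfV mulrC ler_pdivrMr ?normr_gt0//.
    exact: le_trans (pr_le _) H.
  split; first by apply/cvg_ex; exists (pr d).
  exact/cvg_lim.
by split; apply: key => *; rewrite ?ReD ?ReN ?ImD ?ImN ?ReMl ?ImMl ?cabs_ge_Re ?cabs_ge_Im.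
Unshelve. all: by end_near. Qed.

End ComplexDerivative.

(** * The principal logarithm on the slit plane *)

Section Logarithm.
Variable R : realType.
Implicit Types (x y t : R) (z w h d : R[i]).

(** Neighbourhoods with real radii, as a filter, so that the limit calculus for real-valued
    functions becomes available. *)
Definition cnbhs z : set_system R[i] := fun P =>
  exists2 r : R, 0 < r & forall w, cabs (w - z) < r -> P w.

Global Instance cnbhs_filter z : ProperFilter (cnbhs z).
Proof.
apply: Build_ProperFilter_ex.
  by move=> P [r r0 Pr]; exists z; apply: Pr; rewrite subrr cabs0.
split; first by exists 1.
- move=> P Q [r r0 Pr] [s s0 Qs]; exists (Num.min r s); first by rewrite lt_min r0.
  by move=> w; rewrite lt_min => /andP[/Pr ? /Qs].
- by move=> P Q PQ [r r0 Pr]; exists r => // w /Pr /PQ.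
Qed.

Lemma lipschitz_cvg (k : R[i] -> R) z :
  (forall w, `|k w - k z| <= cabs (w - z)) ->
  k w @[w --> cnbhs z] --> k z.
Proof.
move=> kl; apply/cvgrPdist_lt => e e0; exists e => // w we.
by rewrite distrC (le_lt_trans (kl _)).
Qed.

Lemma cvg_Re z : complex.Re w @[w --> cnbhs z] --> complex.Re z.
Proof. by apply: lipschitz_cvg => w; rewrite -ReN -ReD cabs_ge_Re. Qed.

Lemma cvg_Im z : complex.Im w @[w --> cnbhs z] --> complex.Im z.
Proof. by apply: lipschitz_cvg => w; rewrite -ImN -ImD cabs_ge_Im. Qed.

Lemma cvg_cabs z : cabs w @[w --> cnbhs z] --> cabs z.
Proof.
apply: lipschitz_cvg => w.
have := cabsD z (w - z); rewrite subrKC => H1.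
have := cabsB w (w - z); rewrite subKr => H2.
by rewrite ler_norml; apply/andP; split; lra.
Qed.

(** The complement of the closed negative half-axis, on which |z| + Re z vanishes. *)
Definition slit z := 0 < cabs z + complex.Re z.

Lemma slit_cabs_gt0 z : slit z -> 0 < cabs z.
Proof. by rewrite /slit; have := ler_norm (complex.Re z); have := cabs_ge_Re z; lra. Qed.

Lemma slit_near z : slit z -> exists2 r : R, 0 < r & forall w, cabs (w - z) < r -> slit w.
Proof.
move=> sz; exact: (cvgr_gt _ (cvgD (cvg_cabs (z:=z)) (cvg_Re (z:=z)))).
Qed.

(** The principal branch by the half-angle formula, a single expression for the argument on the
    whole slit plane. *)
Definition clog z : R[i] :=
  ln (cabs z) +i* (2 * atan (complex.Im z / (cabs z + complex.Re z))).

Lemma Im_clog z : `|complex.Im (clog z)| <= pi.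
Proof.
rewrite /= normrM gtr0_norm// mulrC -ler_pdivlMr//.
by rewrite ler_norml !ltW ?atan_gtNpi2 ?atan_ltpi2.
Qed.

Lemma clog_real x : 0 < x -> clog x%:C = (ln x)%:C.
Proof.
by move=> x0; rewrite /clog cabs_real gtr0_norm// mul0r atan0 mulr0.
Qed.

Lemma cos_2atan x : cos (2 * atan x) = (1 - x ^+ 2) / (1 + x ^+ 2).
Proof.
have c2 : cos (atan x) ^+ 2 = (1 + x ^+ 2)^-1.
  by rewrite cos_atan exprVn sqr_sqrtr// addr_ge0 ?sqr_ge0.
have : (1 + x ^+ 2) * cos (atan x) ^+ 2 = 1.
  by rewrite c2 mulfV// gt_eqF// ltr_pwDl ?sqr_ge0.
by rewrite mulr_natl cos_mulr2n -c2; lra.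
Qed.

Lemma clogK z : slit z -> cexp (clog z) = z.
Proof.
move=> sz; have m0 := slit_cabs_gt0 sz.
(* The tangent of half the argument: cosine and sine of the argument are rational in it. *)
set u := complex.Im z / (cabs z + complex.Re z).
have u1 : 1 + u ^+ 2 = 2 * cabs z / (cabs z + complex.Re z).
  rewrite /u; field: (sqr_cabs z); rewrite gt_eqF//.
have c2 : cos (atan u) ^+ 2 = (1 + u ^+ 2)^-1.
  by rewrite cos_atan exprVn sqr_sqrtr// addr_ge0 ?sqr_ge0.
have s1 : sin (atan u) = u * cos (atan u).
  rewrite -{2}(atanK u) /tan -mulrA mulVf ?mulr1//.
  by rewrite gt_eqF// cos_gt0_pihalf// atan_gtNpi2 atan_ltpi2.
have s2 : sin (2 * atan u) = 2 * u * (1 + u ^+ 2)^-1.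
  by rewrite mulr_natl sin_mulr2n s1 -c2; ring.
have me := lnK m0.
apply: complexP; rewrite ?Re_cexp ?Im_cexp /= -/u lnK//.
- rewrite cos_2atan u1 /u; field: (sqr_cabs z).
  by rewrite !gt_eqF.
- rewrite s2 u1 /u; field.
  by rewrite !gt_eqF.
Qed.

Lemma clog_cts z : slit z -> forall e : R, 0 < e ->
  exists2 r : R, 0 < r & forall w, cabs (w - z) < r -> cabs (clog w - clog z) < e.
Proof.
move=> sz e e0; have e2 : 0 < e / 2 by rewrite divr_gt0.
have c1 : ln (cabs w) @[w --> cnbhs z] --> ln (cabs z).
  by apply: continuous_cvg (cvg_cabs (z:=z)); exact/continuous_ln/slit_cabs_gt0.
have c2 : (2 * atan (complex.Im w / (cabs w + complex.Re w)) : R) @[w --> cnbhs z]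
    --> (2 * atan (complex.Im z / (cabs z + complex.Re z)) : R).
  apply: cvgM; first exact: cvg_cst.
  apply: continuous_cvg; first exact: continuous_atan.
  apply: cvgM; first exact: cvg_Im.
  apply: cvgV; first by rewrite gt_eqF.
  by apply: cvgD; [exact: cvg_cabs|exact: cvg_Re].
suff: \forall w \near cnbhs z, cabs (clog w - clog z) < e by [].
near=> w; apply: le_lt_trans (cabs_le_ReIm _) _; rewrite ReD ImD ReN ImN [e](splitr e).
by apply: ltrD; rewrite distrC; near: w; [move: c1|move: c2];
  move=> /cvgrPdist_lt/(_ _ e2).
Unshelve. all: by end_near. Qed.

(* An inverse of [cexp] that is continuous is differentiable, since [cexp' != 0]. *)
Lemma cderiv_clog z : slit z -> cderiv clog z z^-1.
Proof.
move=> sz e e0.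
have z0 : 0 < cabs z := slit_cabs_gt0 sz.
pose c := Num.min (cabs z / 2) (e * cabs z ^+ 2 / 2).
have c0 : 0 < c.
  by rewrite /c lt_min; apply/andP; split; [lra|rewrite divr_gt0 ?mulr_gt0 ?exprn_gt0].
have [r1 r10 S] := slit_near sz.
have [r2 r20 E] := @cderiv_cexp R (clog z) _ c0.
have [r3 r30 L] := clog_cts sz r20.
exists (Num.min r1 r3); first by rewrite lt_min r10.
move=> w; rewrite lt_min => /andP[/S sw /L /E].
rewrite (clogK sz) (clogK sw); set l := clog w - clog z => H.
(* w - z = z l + o(l), so |l| <= 2 |w - z| / |z|. *)
have lz : cabs z * cabs l <= 2 * cabs (w - z).
  have : cabs z * cabs l <= cabs (w - z) + cabs (w - z - z * l).
    by have := cabsB (w - z) (w - z - z * l); rewrite subKr cabsM.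
  have : cabs (w - z - z * l) <= cabs z / 2 * cabs l.
    by rewrite (le_trans H)// ler_wpM2r ?cabs_ge0// /c ge_min lexx.
  by have := cabs_ge0 l; nra.
have zn : z != 0 by rewrite -cabs_gt0.
have -> : l - z^-1 * (w - z) = - z^-1 * (w - z - z * l) by field.
rewrite cabsM cabsN cabsV mulrC ler_pdivrMr//.
have H' : cabs (w - z - z * l) <= e * cabs z ^+ 2 / 2 * cabs l.
  by rewrite (le_trans H)// ler_wpM2r ?cabs_ge0// /c ge_min lexx orbT.
apply: le_trans H' _.
have -> : e * cabs z ^+ 2 / 2 * cabs l = e * cabs z / 2 * (cabs z * cabs l) by ring.
have -> : e * cabs (w - z) * cabs z = e * cabs z / 2 * (2 * cabs (w - z)) by field.
by rewrite ler_wpM2l// divr_ge0 ?mulr_ge0 ?ltW.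
Qed.

End Logarithm.

(** * Integrals over the line and Cauchy's theorem in strips *)

Section RealIntegrals.
Variable R : realType.
Implicit Types (x y t : R) (f F g : R -> R) (D : set R).
Local Notation mu := (@lebesgue_measure R).

Definition seg (n : nat) : set R := `[- n%:R, n%:R].

Lemma seg_nondecreasing : nondecreasing_seq seg.
Proof.
move=> m n mn; rewrite subsetEset => x; rewrite /seg /= !in_itv /= => /andP[xm mx].
have : (m%:R : R) <= n%:R by rewrite ler_nat.
by move=> ?; apply/andP; split; lra.
Qed.

Lemma bigcup_seg : \bigcup_n seg n = setT.
Proof.
apply/seteqP; split => // x _; exists (Num.bound x) => //.
rewrite /seg /= in_itv /= -ler_norml.
apply: ltW; have := archi_boundP (normr_ge0 x).
by rewrite /Num.bound /= normr_id.
Qed.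

Lemma cvg_Rintegral_exhaustion D (E : nat -> set R) f :
  measurable D -> (forall n, measurable (E n)) -> nondecreasing_seq E ->
  \bigcup_n E n = D -> mu.-integrable D (EFin \o f) ->
  (\int[mu]_(x in E n) f x) @[n --> \oo] --> \int[mu]_(x in D) f x.
Proof.
move=> mD mE ndE ED intf.
have intE n : mu.-integrable (E n) (EFin \o f).
  by apply: integrableS intf => //; [exact: mE|rewrite -ED; exact: bigcup_sup].
apply: fine_cvg.
rewrite [X in _ --> X](_ : _ = \int[mu]_(x in D) (f x)%:E)%E; last first.
  by rewrite fineK//; exact: integrable_fin_num.
have -> : (fun n => \int[mu]_(x in E n) (f x)%:E)%E =
          (fun n => \int[mu]_(x in D) (((EFin \o f) \_ (E n)) x))%E.
  apply/funext => n; rewrite -integral_mkcondr; congr integral.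
  by apply/esym/setIidr; rewrite -ED; exact: bigcup_sup.
apply: (@dominated_cvg _ _ _ mu D mD _ (EFin \o f) (fun x => `|f x|%:E)%E) => //.
- move=> n; apply: (measurable_int mu); apply/integrable_restrict => //; first exact: mE.
  rewrite setIidr; [exact: intE|rewrite -ED; exact: bigcup_sup].
- move=> x Dx; move: (Dx); rewrite -ED => -[m _ Emx].
  apply: cvg_near_cst; near=> n; rewrite patchE mem_set//.
  have : E m `<=` E n by rewrite -subsetEset; apply: ndE; near: n; exists m.
  exact.
- exact: integrable_norm.
- move=> n x Dx; rewrite patchE; case: ifP => _; first by rewrite /= lee_fin.
  by rewrite abse0 lee_fin.
Unshelve. all: by end_near. Qed.

Lemma cvg_Rintegral_seg f : mu.-integrable setT (EFin \o f) ->
  (\int[mu]_(x in seg n) f x) @[n --> \oo] --> \int[mu]_x f x.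
Proof.
apply: cvg_Rintegral_exhaustion => //.
- by move=> n; exact: measurable_itv.
- exact: seg_nondecreasing.
- exact: bigcup_seg.
Qed.

Lemma integrable_segment f a b : continuous f -> mu.-integrable `[a, b] (EFin \o f).
Proof.
move=> cf; apply: continuous_compact_integrable; first exact: segment_compact.
exact: continuous_subspaceT.
Qed.

Lemma Rintegral_FTC2 F f a b : a <= b -> continuous f ->
  (forall x, is_derive x 1 F (f x)) -> \int[mu]_(x in `[a, b]) f x = F b - F a.
Proof.
move=> ab cf dF; move: ab; rewrite le_eqVlt => /predU1P[->|ab].
  by rewrite set_itv1 Rintegral_set1 subrr.
rewrite /Rintegral (continuous_FTC2 (F := F) ab)//.
- exact: continuous_subspaceT.
- split.
  + by move=> x _; have [] := dF x.
  + by apply: cvg_at_right_filter; exact: (is_derive_continuous (dF a)).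
  + by apply: cvg_at_left_filter; exact: (is_derive_continuous (dF b)).
- by move=> x _; rewrite derive1E; have [_] := dF x.
Qed.

(** Monotone convergence of the integrals over [-n, n], each equal to an increment of [F]. The
    integrability results with explicit antiderivatives rest on this: the logistic function for
    e^(-m|y|), the arctangent for the Poisson kernel, x (1 + x^2)^(-k) for power tails. *)
Lemma integrable_derivative_bounded F f (B : R) : continuous f ->
  (forall x, 0 <= f x) -> (forall x, is_derive x 1 F (f x)) ->
  (forall x, `|F x| <= B) ->
  mu.-integrable setT (EFin \o f) /\ \int[mu]_x f x <= 2 * B.
Proof.
move=> cf f0 dF FB.
have mf : measurable_fun setT f by exact: continuous_measurable_fun.
have le : (\int[mu]_x (f x)%:E <= (2 * B)%:E)%E.
  rewrite -bigcup_seg.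
  have H : (\int[mu]_(x in seg n) (f x)%:E @[n --> \oo]
      --> \int[mu]_(x in \bigcup_n seg n) (f x)%:E)%E.
    apply: ge0_nondecreasing_set_cvg_integral; first exact: seg_nondecreasing.
    - by move=> n; exact: measurable_itv.
    - by move=> n; apply/measurable_EFinP; exact: measurable_funTS.
    - by move=> n x _; rewrite lee_fin.
  apply: (cvge_le _ H); apply: nearW => n.
  have := @Rintegral_FTC2 F f (- n%:R) n%:R _ cf dF.
  rewrite /Rintegral => E.
  rewrite -[X in (X <= _)%E]fineK; last first.
    by apply: integrable_fin_num => //; [exact: measurable_itv|exact: integrable_segment].
  rewrite lee_fin E; last by rewrite (@le_trans _ _ 0)// oppr_le0.
  by move: (FB n%:R) (FB (- n%:R)); rewrite !ler_norml => /andP[? ?] /andP[? ?]; lra.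
have int : mu.-integrable setT (EFin \o f).
  apply/integrableP; split; first exact/measurable_EFinP.
  under eq_integral => x _ do rewrite /= ger0_norm//.
  by rewrite (le_lt_trans le)// ltry.
split=> //; rewrite -lee_fin /Rintegral fineK//; exact: integrable_fin_num.
Qed.

Lemma le_integrable_real D f g : measurable D -> measurable_fun D f ->
  (forall x, D x -> `|f x| <= g x) -> mu.-integrable D (EFin \o g) ->
  mu.-integrable D (EFin \o f).
Proof.
move=> mD mf fg; apply: le_integrable => //; first exact/measurable_EFinP.
by move=> x Dx; rewrite /= lee_fin (le_trans (fg _ Dx))// ler_norm.
Qed.

Lemma integrableZ_real D f c : measurable D -> mu.-integrable D (EFin \o f) ->
  mu.-integrable D (EFin \o (fun x => c * f x)).
Proof.
move=> mD intf; have := @integrableZl _ _ _ mu D mD c _ intf.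
by apply: eq_integrable; [exact: mD|move=> x _; rewrite /= EFinM].
Qed.

Lemma integrableD_real D f g : measurable D -> mu.-integrable D (EFin \o f) ->
  mu.-integrable D (EFin \o g) -> mu.-integrable D (EFin \o (fun x => f x + g x)).
Proof.
move=> mD intf intg; have := @integrableD _ _ _ mu D mD _ _ intf intg.
by apply: eq_integrable; [exact: mD|move=> x _; rewrite /= EFinD].
Qed.

(** Bounds at infinity are available beyond some [N] only; on the segment in between continuity
    suffices. *)
Lemma integrable_continuous_tail f g (N : R) : continuous f ->
  (forall x, 0 <= g x) -> mu.-integrable setT (EFin \o g) ->
  (forall x, N <= `|x| -> `|f x| <= g x) -> mu.-integrable setT (EFin \o f).
Proof.
move=> cf g0 intg fg.
have mf D : measurable_fun D f.
  by apply: measurable_funTS; exact: continuous_measurable_fun.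
pose A : set R := `[- `|N|, `|N|]%classic.
have mA : measurable A by exact: measurable_itv.
have intA : mu.-integrable A (EFin \o f) by exact: integrable_segment.
have intC : mu.-integrable (~` A) (EFin \o f).
  apply: (@le_integrable_real _ _ g) => //; first exact: measurableC.
  - move=> x xN; apply: fg; move: xN; rewrite /A /= in_itv /= -ler_norml => /negP.
    by rewrite -ltNge => /ltW; exact: le_trans (ler_norm N).
  - by apply: integrableS intg => //; exact: measurableC.
apply/integrableP; split; first by apply/measurable_EFinP; exact: mf.
rewrite -(setvU A) ge0_integral_setU//=.
- by apply: lte_add_pinfty; [case/integrableP: intC|case/integrableP: intA].
- exact: measurableC.
- rewrite setvU; apply/measurable_EFinP; apply: measurableT_comp => //.
  exact: mf.
- by apply/disj_setPCr.
Qed.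

End RealIntegrals.

(** * Integrals of complex-valued functions of a real variable *)

Section ComplexIntegrals.
Variable R : realType.
Implicit Types (a b x y t : R) (D : set R) (k : R -> R[i]) (c : R[i]).
Local Notation mu := (@lebesgue_measure R).

Lemma eq_cintegral D k1 k2 : (forall x, D x -> k1 x = k2 x) ->
  cintegral D k1 = cintegral D k2.
Proof.
by move=> E; apply: complexP; apply: eq_Rintegral => x /set_mem /E ->.
Qed.

Lemma cintegrableD D k1 k2 : measurable D -> cintegrable D k1 -> cintegrable D k2 ->
  cintegrable D (fun x => k1 x + k2 x).
Proof.
move=> mD [r1 i1] [r2 i2]; split.
- rewrite (_ : (fun x => _) = EFin \o (fun x => complex.Re (k1 x) + complex.Re (k2 x))).
    exact: integrableD_real.
  by apply/funext => x; rewrite ReD.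
- rewrite (_ : (fun x => _) = EFin \o (fun x => complex.Im (k1 x) + complex.Im (k2 x))).
    exact: integrableD_real.
  by apply/funext => x; rewrite ImD.
Qed.

Lemma cintegralD D k1 k2 : measurable D -> cintegrable D k1 -> cintegrable D k2 ->
  cintegral D (fun x => k1 x + k2 x) = cintegral D k1 + cintegral D k2.
Proof.
move=> mD [r1 i1] [r2 i2]; apply: complexP => /=.
- by rewrite -RintegralD//; apply: eq_Rintegral => x _; rewrite ReD.
- by rewrite -RintegralD//; apply: eq_Rintegral => x _; rewrite ImD.
Qed.

Lemma cintegrableZ D k c : measurable D -> cintegrable D k ->
  cintegrable D (fun x => c * k x).
Proof.
move=> mD [r i]; split.
- rewrite (_ : (fun x => _) = EFin \o (fun x => complex.Re c * complex.Re (k x)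
      + (- complex.Im c) * complex.Im (k x))).
    by apply: integrableD_real => //; apply: integrableZ_real.
  by apply/funext => x; rewrite /= ReM mulNr.
- rewrite (_ : (fun x => _) = EFin \o (fun x => complex.Re c * complex.Im (k x)
      + complex.Im c * complex.Re (k x))).
    by apply: integrableD_real => //; apply: integrableZ_real.
  by apply/funext => x; rewrite /= ImM.
Qed.

Lemma cintegralZ D k c : measurable D -> cintegrable D k ->
  cintegral D (fun x => c * k x) = c * cintegral D k.
Proof.
move=> mD [r i]; apply: complexP; rewrite ?(ReM c) ?(ImM c) /=.
- rewrite -RintegralZl// -[in RHS]RintegralZl// -RintegralB//;
    try exact: integrableZ_real.
  by apply: eq_Rintegral => x _; rewrite ReM.
- rewrite -RintegralZl// -[in RHS]RintegralZl// -RintegralD//;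
    try exact: integrableZ_real.
  by apply: eq_Rintegral => x _; rewrite ImM.
Qed.

Lemma cintegrableB D k1 k2 : measurable D -> cintegrable D k1 -> cintegrable D k2 ->
  cintegrable D (fun x => k1 x - k2 x).
Proof.
move=> mD i1 /(cintegrableZ (-1) mD) i2.
have := cintegrableD mD i1 i2.
by under eq_fun do rewrite mulN1r.
Qed.

Lemma cintegralB D k1 k2 : measurable D -> cintegrable D k1 -> cintegrable D k2 ->
  cintegral D (fun x => k1 x - k2 x) = cintegral D k1 - cintegral D k2.
Proof.
move=> mD i1 i2; have i2' := cintegrableZ (-1) mD i2.
have := cintegralD mD i1 i2'; rewrite cintegralZ// mulN1r => <-.
by apply: eq_cintegral => x _; rewrite mulN1r.
Qed.

(** The factor 2 is the cost of estimating the real and the imaginary part separately. *)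
Lemma cabs_cintegral D k (g : R -> R) : measurable D -> cintegrable D k ->
  mu.-integrable D (EFin \o g) -> (forall x, D x -> cabs (k x) <= g x) ->
  cabs (cintegral D k) <= 2 * \int[mu]_(x in D) g x.
Proof.
move=> mD [r i] ig kg; rewrite (le_trans (cabs_le_ReIm _))//= mulr_natl mulr2n.
apply: lerD.
- apply: le_trans (le_normr_Rintegral _ r) _ => //.
  apply: le_Rintegral => //; first exact: integrable_norm.
  by move=> x /kg; exact: le_trans (cabs_ge_Re _).
- apply: le_trans (le_normr_Rintegral _ i) _ => //.
  apply: le_Rintegral => //; first exact: integrable_norm.
  by move=> x /kg; exact: le_trans (cabs_ge_Im _).
Qed.

Lemma cintegrable_tail k (g : R -> R) (N : R) : (forall t, ccontinuous k t) ->
  (forall x, 0 <= g x) -> mu.-integrable setT (EFin \o g) ->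
  (forall x, N <= `|x| -> cabs (k x) <= g x) -> cintegrable setT k.
Proof.
move=> ck g0 ig kg; split.
- apply: (integrable_continuous_tail (N := N) _ g0 ig); first by move=> t; exact: (ck t).1.
  by move=> x /kg; exact: le_trans (cabs_ge_Re _).
- apply: (integrable_continuous_tail (N := N) _ g0 ig); first by move=> t; exact: (ck t).2.
  by move=> x /kg; exact: le_trans (cabs_ge_Im _).
Qed.

Lemma cintegrable_dominated k (g : R -> R) : (forall t, ccontinuous k t) ->
  mu.-integrable setT (EFin \o g) ->
  (forall x, cabs (k x) <= g x) -> cintegrable setT k.
Proof.
move=> ck ig kg; apply: (cintegrable_tail (N := 0) ck _ ig) => // x.
exact: le_trans (cabs_ge0 _) (kg x).
Qed.

Lemma cintegrable_segment k a b : (forall t, a <= t <= b -> ccontinuous k t) ->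
  cintegrable `[a, b] k.
Proof.
move=> ck; split; apply: continuous_compact_integrable; try exact: segment_compact;
  apply: continuous_in_subspaceT => t; rewrite inE /= in_itv /= => /ck[].
- by [].
- by [].
Qed.

Lemma cintegral_split k a b (c : R) : a <= c <= b -> cintegrable `[a, b] k ->
  cintegral `[a, b] k = cintegral `[a, c] k + cintegral `[c, b] k.
Proof.
move=> /andP[ac cb] [r i].
have H (f : R -> R) : mu.-integrable `[a, b] (EFin \o f) ->
    \int[mu]_(x in `[a, b]) f x = \int[mu]_(x in `[a, c]) f x + \int[mu]_(x in `[c, b]) f x.
  move=> fi; have := @Rintegral_itvB _ f (BLeft a) (BRight b) c fi.
  rewrite !bnd_simp => /(_ ac cb) E.
  have := @Rintegral_itv_obnd_cbnd _ c (BRight b) f.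
  rewrite -E => <-; first by rewrite addrC subrK.
  by apply: integrableS fi => //; apply: subset_itvr; rewrite bnd_simp.
by apply: complexP; exact: H.
Qed.

Lemma cintegral_affine (A B : R[i]) a b : a <= b ->
  cintegral `[a, b] (fun u => A + B * u%:C)
  = A * (b - a)%:C + B * ((b ^+ 2 - a ^+ 2) / 2)%:C.
Proof.
move=> ab.
have H (p q : R) : \int[mu]_(u in `[a, b]) (p + q * u)
    = p * (b - a) + q * ((b ^+ 2 - a ^+ 2) / 2).
  have cf : continuous (fun u => p + q * u).
    move=> u; apply: cvgD; first exact: cvg_cst.
    by apply: cvgM; [exact: cvg_cst|exact: cvg_id].
  have dF (u : R) : is_derive u 1 (fun u : R => p * u + q * (u ^+ 2 / 2)) (p + q * u).
    by apply: is_derive_eq; rewrite /GRing.scale /=; field.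
  by rewrite (Rintegral_FTC2 ab cf dF); field.
apply: complexP => /=.
- rewrite !ReImE /= !mulr0 !subr0 -H; apply: eq_Rintegral => u _.
  by rewrite !ReImE /= mulr0 subr0.
- rewrite !ReImE /= !mulr0 !add0r -H; apply: eq_Rintegral => u _.
  by rewrite !ReImE /= mulr0 add0r.
Qed.

Lemma cvg_cintegral_exhaustion D (E : nat -> set R) k :
  measurable D -> (forall n, measurable (E n)) -> nondecreasing_seq E ->
  \bigcup_n E n = D -> cintegrable D k -> forall e : R, 0 < e ->
  \forall n \near \oo, cabs (cintegral (E n) k - cintegral D k) < e.
Proof.
move=> mD mE ndE ED [r i] e e0; have e2 : 0 < e / 2 by rewrite divr_gt0.
have /cvgrPdist_lt/(_ _ e2) cr := cvg_Rintegral_exhaustion mD mE ndE ED r.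
have /cvgrPdist_lt/(_ _ e2) ci := cvg_Rintegral_exhaustion mD mE ndE ED i.
near=> n; apply: le_lt_trans (cabs_le_ReIm _) _; rewrite !ReImE /= [e](splitr e).
by apply: ltrD; rewrite distrC; near: n; [exact: cr|exact: ci].
Unshelve. all: by end_near. Qed.

Lemma cvg_cintegral_seg k : cintegrable setT k -> forall e : R, 0 < e ->
  \forall n \near \oo, cabs (cintegral (@seg R n) k - cintegral setT k) < e.
Proof.
apply: cvg_cintegral_exhaustion => //.
- by move=> n; exact: measurable_itv.
- exact: seg_nondecreasing.
- exact: bigcup_seg.
Qed.

(** The fundamental theorem on [-n, n], with boundary terms that vanish in the limit; the source of
    integration by parts for the kernel. *)
Lemma cintegral_derivative0 (K k : R -> R[i]) :
  (forall x, is_derive x 1 (fun u => complex.Re (K u)) (complex.Re (k x))) ->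
  (forall x, is_derive x 1 (fun u => complex.Im (K u)) (complex.Im (k x))) ->
  (forall t, ccontinuous k t) -> cintegrable setT k ->
  (forall e : R, 0 < e -> \forall n \near \oo,
     cabs (K n%:R) < e /\ cabs (K (- n%:R)) < e) ->
  cintegral setT k = 0.
Proof.
move=> dr di ck ik K0; apply/eqP; rewrite -cabs_eq0 eq_le cabs_ge0 andbT.
apply/ler_addgt0Pl => e e0; rewrite addr0.
have e3 : 0 < e / 3 by rewrite divr_gt0.
near \oo => n.
have H1 : cabs (cintegral (@seg R n) k - cintegral setT k) < e / 3.
  by near: n; exact: cvg_cintegral_seg.
have [H2 H3] : cabs (K n%:R) < e / 3 /\ cabs (K (- n%:R)) < e / 3.
  by near: n; exact: K0.
have E : cintegral (@seg R n) k = K n%:R - K (- n%:R).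
  have nn : - n%:R <= n%:R :> R by rewrite (@le_trans _ _ 0)// oppr_le0.
  apply: complexP; rewrite ?ReD ?ReN ?ImD ?ImN.
  - by apply: Rintegral_FTC2 => // t; exact: (ck t).1.
  - by apply: Rintegral_FTC2 => // t; exact: (ck t).2.
have -> : cintegral setT k
    = K n%:R - K (- n%:R) - (cintegral (@seg R n) k - cintegral setT k) by rewrite E; ring.
apply: le_trans (cabsB _ _) _; have := cabsB (K n%:R) (K (- n%:R)); lra.
Unshelve. all: by end_near. Qed.

End ComplexIntegrals.

Arguments cabs : simpl never.

(** * Cauchy's theorem for rectangles and strips *)

Section Rectangles.
Variable R : realType.
Implicit Types (a b x y t : R) (z w d : R[i]) (G : R[i] -> R[i]).
Local Notation mu := (@lebesgue_measure R).
Local Notation ci := (ci R).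

Definition holo_strip G (lo hi : R) :=
  forall z, lo < complex.Im z < hi -> exists d, cderiv G z d.

Definition hint G x0 x1 y : R[i] :=
  cintegral `[x0, x1] (fun u => G (u%:C + ci * y%:C)).
Definition vint G x y0 y1 : R[i] :=
  cintegral `[y0, y1] (fun v => G (x%:C + ci * v%:C)).
(** The contour integral along the boundary of a rectangle, counterclockwise. *)
Definition rint G x0 x1 y0 y1 : R[i] :=
  hint G x0 x1 y0 + ci * vint G x1 y0 y1 - hint G x0 x1 y1 - ci * vint G x0 y0 y1.

Arguments rint : simpl never.

Lemma itv_dist a b x y : a <= x <= b -> a <= y <= b -> `|x - y| <= b - a.
Proof. by move=> /andP[? ?] /andP[? ?]; rewrite ler_norml; apply/andP; split; lra. Qed.

Lemma cabs_ci : cabs ci = 1.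
Proof. by rewrite /cabs /= expr0n /= expr1n add0r sqrtr1. Qed.

Lemma Re_point x y : complex.Re (x%:C + ci * y%:C) = x.
Proof. by rewrite !ReImE /=; ring. Qed.

Lemma Im_point x y : complex.Im (x%:C + ci * y%:C) = y.
Proof. by rewrite !ReImE /=; ring. Qed.

Lemma ci2 : ci * ci = -1.
Proof. by apply: complexP; rewrite !ReImE /=; ring. Qed.

Section Strip.
Variables (G : R[i] -> R[i]) (lo hi : R).
Hypothesis hG : holo_strip G lo hi.

Lemma holo_ccontinuous_h y t : lo < y < hi -> ccontinuous (fun u => G (u%:C + ci * y%:C)) t.
Proof.
move=> yh; have [|d dG] := @hG (t%:C + ci * y%:C); first by rewrite Im_point.
exact: cderiv_ccontinuous (contraction_horizontal _) dG.
Qed.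

Lemma holo_ccontinuous_v x t : lo < t < hi -> ccontinuous (fun v => G (x%:C + ci * v%:C)) t.
Proof.
move=> yh; have [|d dG] := @hG (x%:C + ci * t%:C); first by rewrite Im_point.
exact: cderiv_ccontinuous (contraction_vertical _) dG.
Qed.

Lemma hintegrable x0 x1 y : lo < y < hi ->
  cintegrable `[x0, x1] (fun u => G (u%:C + ci * y%:C)).
Proof. by move=> yh; apply: cintegrable_segment => t _; exact: holo_ccontinuous_h. Qed.

Lemma vintegrable x y0 y1 : lo < y0 -> y1 < hi ->
  cintegrable `[y0, y1] (fun v => G (x%:C + ci * v%:C)).
Proof.
move=> l h; apply: cintegrable_segment => t /andP[ty0 ty1].
by apply: holo_ccontinuous_v; rewrite (lt_le_trans l)//= (le_lt_trans ty1).
Qed.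

Lemma rint_split_x x0 m x1 y0 y1 : lo < y0 -> y0 <= y1 -> y1 < hi -> x0 <= m <= x1 ->
  rint G x0 x1 y0 y1 = rint G x0 m y0 y1 + rint G m x1 y0 y1.
Proof.
move=> l y01 h mx; rewrite /rint /hint.
rewrite (cintegral_split (c := m) _ (hintegrable x0 x1 (y := y0) _))//; last first.
  by rewrite l (le_lt_trans y01).
rewrite (cintegral_split (c := m) _ (hintegrable x0 x1 (y := y1) _))//; last first.
  by rewrite h andbT (lt_le_trans l).
ring.
Qed.

Lemma rint_split_y x0 x1 y0 m y1 : lo < y0 -> y1 < hi -> y0 <= m <= y1 ->
  rint G x0 x1 y0 y1 = rint G x0 x1 y0 m + rint G x0 x1 m y1.
Proof.
move=> l h my; rewrite /rint /vint.
rewrite (cintegral_split my (vintegrable x1 l h)) (cintegral_split my (vintegrable x0 l h)).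
ring.
Qed.

Lemma cabs_rint_le x0 x1 y0 y1 (K : R) : x0 <= x1 -> y0 <= y1 -> lo < y0 -> y1 < hi ->
  (forall x y, x0 <= x <= x1 -> y0 <= y <= y1 -> cabs (G (x%:C + ci * y%:C)) <= K) ->
  cabs (rint G x0 x1 y0 y1) <= 4 * K * ((x1 - x0) + (y1 - y0)).
Proof.
move=> x01 y01 l h GK.
have seg_le (k : R -> R[i]) a b : a <= b -> cintegrable `[a, b] k ->
    (forall t, a <= t <= b -> cabs (k t) <= K) -> cabs (cintegral `[a, b] k) <= 2 * (K * (b - a)).
  move=> ab ik kK.
  have := cabs_cintegral (g := fun=> K) _ ik _ _.
  rewrite Rintegral_cst//= lebesgue_measure_itv /= lte_fin.
  have -> : fine (if a < b then (b%:E - a%:E)%E else 0%E) = b - a.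
    move: ab; rewrite le_eqVlt => /predU1P[->|->]; last by [].
    by rewrite ltxx subrr.
  apply => //.
  by apply: (@integrable_segment _ (fun=> K)) => t; exact: cvg_cst.
have H0 : cabs (hint G x0 x1 y0) <= 2 * (K * (x1 - x0)).
  apply: seg_le => //; first by apply: hintegrable; rewrite l (le_lt_trans y01).
  by move=> t tx; apply: GK => //; rewrite lexx.
have H1 : cabs (hint G x0 x1 y1) <= 2 * (K * (x1 - x0)).
  apply: seg_le => //; first by apply: hintegrable; rewrite h (lt_le_trans l).
  by move=> t tx; apply: GK => //; rewrite lexx andbT.
have V0 : cabs (vint G x0 y0 y1) <= 2 * (K * (y1 - y0)).
  apply: seg_le => //; first exact: vintegrable.
  by move=> t tx; apply: GK => //; rewrite lexx.
have V1 : cabs (vint G x1 y0 y1) <= 2 * (K * (y1 - y0)).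
  apply: seg_le => //; first exact: vintegrable.
  by move=> t tx; apply: GK => //; rewrite lexx andbT.
rewrite /rint; have := cabsB (hint G x0 x1 y0 + ci * vint G x1 y0 y1 - hint G x0 x1 y1)
  (ci * vint G x0 y0 y1).
have := cabsB (hint G x0 x1 y0 + ci * vint G x1 y0 y1) (hint G x0 x1 y1).
have := cabsD (hint G x0 x1 y0) (ci * vint G x1 y0 y1).
rewrite !cabsM cabs_ci; lra.
Qed.

End Strip.

(** By direct calculation. It allows the tangent part at the limit point of the bisection to be
    subtracted, so that only the error of the first-order expansion is integrated. *)
Lemma rint_affine z0 A B x0 x1 y0 y1 : x0 <= x1 -> y0 <= y1 ->
  rint (fun z => A + B * (z - z0)) x0 x1 y0 y1 = 0.
Proof.
move=> x01 y01; rewrite /rint /hint /vint.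
have H y : cintegral `[x0, x1] (fun u => A + B * (u%:C + ci * y%:C - z0))
    = (A + B * (ci * y%:C - z0)) * (x1 - x0)%:C + B * ((x1 ^+ 2 - x0 ^+ 2) / 2)%:C.
  by rewrite -cintegral_affine//; apply: eq_cintegral => u _; ring.
have V x : cintegral `[y0, y1] (fun v => A + B * (x%:C + ci * v%:C - z0))
    = (A + B * (x%:C - z0)) * (y1 - y0)%:C + (B * ci) * ((y1 ^+ 2 - y0 ^+ 2) / 2)%:C.
  by rewrite -cintegral_affine//; apply: eq_cintegral => u _; ring.
rewrite !H !V !rmorphM !rmorphB /= !rmorphXn /= fmorphV /= rmorph_nat.
have e : ci ^+ 2 = -1 by rewrite expr2 ci2.
by field: e.
Qed.

Lemma rint_subr G lo hi z0 A B x0 x1 y0 y1 : holo_strip G lo hi ->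
  x0 <= x1 -> y0 <= y1 -> lo < y0 -> y1 < hi ->
  rint (fun z => G z - (A + B * (z - z0))) x0 x1 y0 y1 = rint G x0 x1 y0 y1.
Proof.
move=> hG x01 y01 l h; rewrite -[RHS]subr0 -(rint_affine z0 A B x01 y01).
have hA : holo_strip (fun z => A + B * (z - z0)) lo hi.
  move=> z _; exists (0 + B * (1 - 0)).
  by apply/cderivD/cderivZ/cderivB/cderiv_cst; [exact: cderiv_cst|exact: cderiv_id].
have l1 : lo < y1 by exact: lt_le_trans y01.
have h0 : y0 < hi by exact: le_lt_trans h.
have Hh y : lo < y < hi -> hint (fun z => G z - (A + B * (z - z0))) x0 x1 y
    = hint G x0 x1 y - hint (fun z => A + B * (z - z0)) x0 x1 y.
  by move=> yh; apply: cintegralB; [exact: measurable_itv|exact: (hintegrable hG x0 x1 yh)|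
    exact: (hintegrable hA x0 x1 yh)].
have Vv x : vint (fun z => G z - (A + B * (z - z0))) x y0 y1
    = vint G x y0 y1 - vint (fun z => A + B * (z - z0)) x y0 y1.
  by apply: cintegralB; [exact: measurable_itv|exact: (vintegrable hG x l h)|
    exact: (vintegrable hA x l h)].
rewrite /rint !Vv !Hh ?l ?h ?h0 ?l1//; ring.
Qed.

(** Selects a quarter whose contour integral is at least a fourth of the whole in modulus; the last
    quarter is the default, justified in [quarter_rint]. The parameters of [big] shadow the
    abscissas of the given rectangle, which are therefore read off [r]. *)
Definition quarter G (r : R * R * R * R) : R * R * R * R :=
  let: (x0, x1, y0, y1) := r in
  let mx := (x0 + x1) / 2 in let my := (y0 + y1) / 2 in
  let big x0 x1 y0' y1' := cabs (rint G r.1.1.1 r.1.1.2 y0 y1) <= 4 * cabs (rint G x0 x1 y0' y1') in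
  if big x0 mx y0 my then (x0, mx, y0, my) else
  if big x0 mx my y1 then (x0, mx, my, y1) else
  if big mx x1 y0 my then (mx, x1, y0, my) else (mx, x1, my, y1).

Lemma quarterP G u0 u1 v0 v1 : u0 <= u1 -> v0 <= v1 ->
  let r := quarter G (u0, u1, v0, v1) in
  [/\ u0 <= r.1.1.1, r.1.1.1 <= r.1.1.2, r.1.1.2 <= u1 &
      r.1.1.2 - r.1.1.1 = (u1 - u0) / 2] /\
  [/\ v0 <= r.1.2, r.1.2 <= r.2, r.2 <= v1 & r.2 - r.1.2 = (v1 - v0) / 2].
Proof.
move=> u01 v01; rewrite /quarter /=.
by case: ifP => _ /=; [|case: ifP => _ /=; [|case: ifP => _ /=]];
  split; split; lra.
Qed.

Lemma quarter_rint G lo hi u0 u1 v0 v1 : holo_strip G lo hi ->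
  u0 <= u1 -> v0 <= v1 -> lo < v0 -> v1 < hi ->
  let r := quarter G (u0, u1, v0, v1) in
  cabs (rint G u0 u1 v0 v1) <= 4 * cabs (rint G r.1.1.1 r.1.1.2 r.1.2 r.2).
Proof.
move=> hG u01 v01 l h; rewrite /quarter /=.
have E : rint G u0 u1 v0 v1 =
    rint G u0 ((u0 + u1) / 2) v0 ((v0 + v1) / 2) + rint G u0 ((u0 + u1) / 2) ((v0 + v1) / 2) v1
  + (rint G ((u0 + u1) / 2) u1 v0 ((v0 + v1) / 2) + rint G ((u0 + u1) / 2) u1 ((v0 + v1) / 2) v1).
  rewrite (rint_split_x hG (m := (u0 + u1) / 2) l v01 h); last by apply/andP; split; lra.
  by congr (_ + _); apply: (rint_split_y hG) => //; apply/andP; split; lra.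
case: ifPn => [//|c1]; case: ifPn => [//|c2]; case: ifPn => [//|c3] /=.
rewrite leNgt; apply/negP; move: c1 c2 c3; rewrite -!ltNge.
move: E; set P := rint G u0 u1 v0 v1.
set P1 := rint _ _ _ _ _; set P2 := rint _ _ _ _ _.
set P3 := rint _ _ _ _ _; set P4 := rint _ _ _ _ _ => E c1 c2 c3 c4.
clearbody P P1 P2 P3 P4.
have := cabsD (P1 + P2) (P3 + P4); rewrite -E.
move: (cabsD P1 P2) (cabsD P3 P4) c1 c2 c3 c4.
clear; lra.
Qed.

(* Goursat's lemma, by bisection. *)
Lemma rint0 G lo hi x0 x1 y0 y1 : holo_strip G lo hi ->
  x0 <= x1 -> y0 <= y1 -> lo < y0 -> y1 < hi -> rint G x0 x1 y0 y1 = 0.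
Proof.
move=> hG x01 y01 l h.
apply/eqP; rewrite -cabs_eq0 eq_le cabs_ge0 andbT leNgt; apply/negP => I0.
set I := cabs _ in I0.
pose r n := iter n (quarter G) (x0, x1, y0, y1).
pose X0 n := (r n).1.1.1; pose X1 n := (r n).1.1.2.
pose Y0 n := (r n).1.2; pose Y1 n := (r n).2.
have rE n : r n.+1 = quarter G (X0 n, X1 n, Y0 n, Y1 n).
  by rewrite /X0 /X1 /Y0 /Y1 /r iterS; case: (iter n _ _) => [[[]]].
have inv n : [/\ X0 n <= X1 n, Y0 n <= Y1 n, y0 <= Y0 n, Y1 n <= y1 &
    I <= 4 ^+ n * cabs (rint G (X0 n) (X1 n) (Y0 n) (Y1 n))] /\
    (X1 n - X0 n = (x1 - x0) / 2 ^+ n /\ Y1 n - Y0 n = (y1 - y0) / 2 ^+ n).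
  elim: n => [|n [[a1 a2 a3 a4 a5] [b1 b2]]].
    by rewrite /X0 /X1 /Y0 /Y1 /= !expr0 !divr1 mul1r.
  have := quarter_rint hG a1 a2 (lt_le_trans l a3) (le_lt_trans a4 h).
  have := quarterP G a1 a2; rewrite -rE /= -/(X0 _) -/(X1 _) -/(Y0 _) -/(Y1 _).
  move=> [[c1 c2 c3 c4] [d1 d2 d3 d4]] s5; split; [split => //|split].
  - exact: le_trans d1.
  - exact: le_trans a4.
  - by rewrite (le_trans a5)// exprSr -mulrA ler_wpM2l.
  - by rewrite c4 b1 exprSr; field.
  - by rewrite d4 b2 exprSr; field.
have nest n : [/\ X0 n <= X0 n.+1, X1 n.+1 <= X1 n, Y0 n <= Y0 n.+1 & Y1 n.+1 <= Y1 n].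
  have [[a1 a2 _ _ _] _] := inv n.
  have := quarterP G a1 a2; rewrite -rE /= -/(X0 _) -/(X1 _) -/(Y0 _) -/(Y1 _).
  by move=> [[] ? ? ? ? []].
(* Nested intervals: the supremum of the left endpoints lies in all of them. *)
have mono (A B : nat -> R) : (forall n, A n <= A n.+1) -> (forall n, B n.+1 <= B n) ->
    (forall n, A n <= B n) -> exists c, forall n, A n <= c <= B n.
  move=> Am Bm AB.
  have AA : nondecreasing_seq A by exact/nondecreasing_seqP.
  have BB : nonincreasing_seq B by exact/nonincreasing_seqP.
  have ABmn m n : A m <= B n.
    by rewrite (le_trans (AA _ _ (leq_maxl m n)))// (le_trans (AB _))// BB// leq_maxr.
  exists (sup (range A)) => n; apply/andP; split.
  - apply: ub_le_sup; last by exists n.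
    by exists (B 0%N) => _ [m _ <-].
  - apply: ge_sup; first by exists (A 0%N), 0%N.
    by move=> _ [m _ <-].
have [cx Hx] : exists c, forall n, X0 n <= c <= X1 n.
  by apply: mono => n; [case: (nest n)|case: (nest n)|case: (inv n) => -[]].
have [cy Hy] : exists c, forall n, Y0 n <= c <= Y1 n.
  by apply: mono => n; [case: (nest n)|case: (nest n)|case: (inv n) => -[]].
set zc := cx%:C + ci * cy%:C.
have [d dG] : exists d, cderiv G zc d.
  apply: hG; rewrite Im_point.
  have := Hy 0%N; rewrite /Y0 /Y1 /= => /andP[? ?].
  by rewrite (lt_le_trans l)//= (le_lt_trans _ h).
(* The 1 keeps [S] positive for a degenerate rectangle. *)
set S := (x1 - x0) + (y1 - y0) + 1.
have S0 : 0 < S by rewrite /S; lra.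
(* After n bisections distance and side lengths are at most S / 2^n, so the contour integral is at
   most 4 (I / (8 S^2)) (S / 2^n)^2; multiplied by 4^n this is I / 2. *)
have e0 : 0 < I / (8 * S ^+ 2) by rewrite divr_gt0 ?mulr_gt0 ?exprn_gt0.
have [rr rr0 Hr] := dG _ e0.
have [n nr] : exists n, S / 2 ^+ n < rr.
  have [n Hn] : exists n : nat, S / rr < n%:R.
    by exists (Num.bound (S / rr)); rewrite (le_lt_trans _ (archi_boundP _))// divr_ge0// ltW.
  exists n; rewrite ltr_pdivrMr ?exprn_gt0// -ltr_pdivrMl// mulrC (lt_le_trans Hn)//.
  by rewrite -natrX ler_nat ltnW// ltn_expl.
have [[a1 a2 a3 a4 a5] [b1 b2]] := inv n.
have ll : lo < Y0 n by exact: lt_le_trans a3.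
have hh : Y1 n < hi by exact: le_lt_trans h.
have hG' : holo_strip (fun z => G z - (G zc + d * (z - zc))) lo hi.
  move=> z /hG[d' dG']; exists (d' - (0 + d * (1 - 0))).
  apply: cderivB => //.
  by apply/cderivD/cderivZ/cderivB/cderiv_cst; [exact: cderiv_cst|exact: cderiv_id].
have T0 : 0 < (2 ^+ n)^-1 :> R by rewrite invr_gt0 exprn_gt0.
have := cabs_rint_le hG' (K := I / (8 * S ^+ 2) * (S / 2 ^+ n)) a1 a2 ll hh.
rewrite (rint_subr _ _ _ hG)// => bnd.
have {}bnd : cabs (rint G (X0 n) (X1 n) (Y0 n) (Y1 n))
    <= 4 * (I / (8 * S ^+ 2) * (S / 2 ^+ n)) * (S / 2 ^+ n).
  apply: le_trans (bnd _) _.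
    move=> x y /andP[x0' x1'] /andP[y0' y1'].
    have dist : cabs (x%:C + ci * y%:C - zc) <= (x1 - x0) / 2 ^+ n + (y1 - y0) / 2 ^+ n.
      apply: le_trans (cabs_le_ReIm _) _.
      rewrite ReD ImD ReN ImN !Re_point !Im_point -b1 -b2.
      by apply: lerD; apply: itv_dist; rewrite ?x0' ?x1' ?y0' ?y1' ?Hx ?Hy.
    have dS : cabs (x%:C + ci * y%:C - zc) <= S / 2 ^+ n.
      by apply: le_trans dist _; rewrite -mulrDl ler_pM2r// /S; lra.
    have := Hr (x%:C + ci * y%:C) (le_lt_trans dS nr).
    have -> : G (x%:C + ci * y%:C) - (G zc + d * (x%:C + ci * y%:C - zc))
      = G (x%:C + ci * y%:C) - G zc - d * (x%:C + ci * y%:C - zc) by ring.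
    by move=> /le_trans; apply; rewrite ler_wpM2l// ltW.
  rewrite ler_wpM2l//; first by rewrite mulr_ge0// mulr_ge0 ?(ltW e0)// mulr_ge0 ?(ltW S0) ?(ltW T0).
  by rewrite b1 b2 -mulrDl ler_pM2r// /S; lra.
have : I <= I / 2.
  apply: le_trans a5 _.
  rewrite [leRHS](_ : _ = 4 ^+ n * (4 * (I / (8 * S ^+ 2) * (S / 2 ^+ n)) * (S / 2 ^+ n))).
    by rewrite ler_wpM2l// exprn_ge0.
  have -> : 4 ^+ n = 2 ^+ n * 2 ^+ n :> R by rewrite -exprMn -natrM.
  by field; rewrite ?gt_eqF ?exprn_gt0.
lra.
Qed.

(** Goursat's lemma on [-n, n] times [y0, y1], with n tending to infinity. The condition on the
    values of [g] at n and - n makes the vertical sides vanish and is required separately, since an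
    integrable function need not tend to 0. *)
Lemma strip_shift G lo hi y0 y1 (g : R -> R) (N : R) : holo_strip G lo hi ->
  lo < y0 -> y0 <= y1 -> y1 < hi ->
  (forall x, 0 <= g x) -> mu.-integrable setT (EFin \o g) ->
  (forall e : R, 0 < e -> \forall n \near \oo, g n%:R < e /\ g (- n%:R) < e) ->
  (forall x y, N <= `|x| -> y0 <= y <= y1 -> cabs (G (x%:C + ci * y%:C)) <= g x) ->
  [/\ cintegrable setT (fun x => G (x%:C + ci * y0%:C)),
      cintegrable setT (fun x => G (x%:C + ci * y1%:C)) &
      cintegral setT (fun x => G (x%:C + ci * y0%:C))
      = cintegral setT (fun x => G (x%:C + ci * y1%:C))].
Proof.
move=> hG l y01 h g0 ig glim Gg.
have l1 : lo < y1 by exact: lt_le_trans y01.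
have h0 : y0 < hi by exact: le_lt_trans h.
have i0 : cintegrable setT (fun x => G (x%:C + ci * y0%:C)).
  apply: (cintegrable_tail (N := N) _ g0 ig).
    by move=> t; apply: (holo_ccontinuous_h hG); rewrite l.
  by move=> x xN; apply: Gg => //; rewrite lexx.
have i1 : cintegrable setT (fun x => G (x%:C + ci * y1%:C)).
  apply: (cintegrable_tail (N := N) _ g0 ig).
    by move=> t; apply: (holo_ccontinuous_h hG); rewrite l1.
  by move=> x xN; apply: Gg => //; rewrite lexx andbT.
split => //; apply/eqP; rewrite -subr_eq0 -cabs_eq0 eq_le cabs_ge0 andbT.
apply/ler_addgt0Pl => e e0; rewrite addr0.
have e4 : 0 < e / 4 by rewrite divr_gt0.
set K := 2 * (y1 - y0) + 1.
have K0 : 0 < K by rewrite /K; lra.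
have eK : 0 < e / 4 / K by rewrite divr_gt0.
near \oo => n.
have c0 : cabs (cintegral (@seg R n) (fun x => G (x%:C + ci * y0%:C)) -
    cintegral setT (fun x => G (x%:C + ci * y0%:C))) < e / 4.
  by near: n; exact: cvg_cintegral_seg.
have c1 : cabs (cintegral (@seg R n) (fun x => G (x%:C + ci * y1%:C)) -
    cintegral setT (fun x => G (x%:C + ci * y1%:C))) < e / 4.
  by near: n; exact: cvg_cintegral_seg.
have [gn gNn] : g n%:R < e / 4 / K /\ g (- n%:R) < e / 4 / K by near: n; exact: glim.
have nN : N <= n%:R by near: n; exact: nbhs_infty_ger.
have nn : - n%:R <= n%:R :> R by rewrite (@le_trans _ _ 0)// oppr_le0.
have V x : N <= `|x| -> g x < e / 4 / K -> cabs (vint G x y0 y1) <= e / 4.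
  move=> xN gx.
  have := cabs_cintegral (g := fun=> g x) _ (vintegrable hG x l h) _ _.
  rewrite Rintegral_cst//= lebesgue_measure_itv /= lte_fin.
  have -> : fine (if y0 < y1 then (y1%:E - y0%:E)%E else 0%E) = y1 - y0.
    move: y01; rewrite le_eqVlt => /predU1P[->|->]; last by [].
    by rewrite ltxx subrr.
  move=> /(_ (measurable_itv _)) bnd; apply: le_trans (bnd _ _) _.
  - apply: (@integrable_segment _ (fun=> g x)) => t; exact: cvg_cst.
  - by move=> t; rewrite /= in_itv /=; exact: Gg.
  - have -> : e / 4 = e / 4 / K * K by field; rewrite gt_eqF.
    have := g0 x; rewrite mulrCA => gx0.
    by apply: ler_pM => //; rewrite ?mulr_ge0 ?subr_ge0 ?(ltW gx)// /K; lra.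
have v1 : cabs (vint G n%:R y0 y1) <= e / 4 by apply: V => //; rewrite ger0_norm.
have v0 : cabs (vint G (- n%:R) y0 y1) <= e / 4 by apply: V => //; rewrite normrN ger0_norm.
have := rint0 hG nn y01 l h; rewrite /rint /hint.
move: c0 c1; rewrite /seg.
set A := cintegral `[_, _] _; set A' := cintegral setT _; set B := cintegral `[_, _] _.
set B' := cintegral setT _ => c0 c1 E.
have -> : A' - B' = (B - B') - (A - A') - ci * vint G n%:R y0 y1 + ci * vint G (- n%:R) y0 y1.
  by rewrite -[LHS]subr0 -E; ring.
have := cabsD ((B - B') - (A - A') - ci * vint G n%:R y0 y1) (ci * vint G (- n%:R) y0 y1).
have := cabsB ((B - B') - (A - A')) (ci * vint G n%:R y0 y1).
have := cabsB (B - B') (A - A').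
by rewrite !cabsM cabs_ci !mul1r; lra.
Unshelve. all: by end_near. Qed.

End Rectangles.

Section ContinuousCurves.
Variable R : realType.
Implicit Types (t : R) (w : R[i]).

Lemma ccontinuous_cst w t : ccontinuous (fun=> w) t.
Proof. by split; exact: cvg_cst. Qed.

Lemma ccontinuousD (k l : R -> R[i]) t : ccontinuous k t -> ccontinuous l t ->
  ccontinuous (fun x => k x + l x) t.
Proof.
move=> [k1 k2] [l1 l2]; split.
- rewrite (_ : (fun x => _) = (fun x => complex.Re (k x) + complex.Re (l x))).
    exact: cvgD.
  by apply/funext => x; rewrite ReD.
- rewrite (_ : (fun x => _) = (fun x => complex.Im (k x) + complex.Im (l x))).
    exact: cvgD.
  by apply/funext => x; rewrite ImD.
Qed.

Lemma ccontinuousM (k l : R -> R[i]) t : ccontinuous k t -> ccontinuous l t ->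
  ccontinuous (fun x => k x * l x) t.
Proof.
move=> [k1 k2] [l1 l2]; split.
- rewrite (_ : (fun x => _) = (fun x => complex.Re (k x) * complex.Re (l x)
      - complex.Im (k x) * complex.Im (l x))).
    by apply: cvgB; exact: cvgM.
  by apply/funext => x; rewrite ReM.
- rewrite (_ : (fun x => _) = (fun x => complex.Re (k x) * complex.Im (l x)
      + complex.Im (k x) * complex.Re (l x))).
    by apply: cvgD; exact: cvgM.
  by apply/funext => x; rewrite ImM.
Qed.

Lemma ccontinuousB (k l : R -> R[i]) t : ccontinuous k t -> ccontinuous l t ->
  ccontinuous (fun x => k x - l x) t.
Proof.
move=> ck cl; rewrite (_ : (fun x => _) = (fun x => k x + (-1) * l x)).
  exact/(ccontinuousD ck)/ccontinuousM/cl/ccontinuous_cst.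
by apply/funext => x; rewrite mulN1r.
Qed.

Lemma ccontinuousZ w (k : R -> R[i]) t : ccontinuous k t ->
  ccontinuous (fun x => w * k x) t.
Proof. exact/ccontinuousM/ccontinuous_cst. Qed.

Lemma ccontinuous_real (k : R -> R) t : {for t, continuous k} ->
  ccontinuous (fun x => (k x)%:C) t.
Proof. by move=> ck; split => //; exact: cvg_cst. Qed.

Lemma continuous_cabs (k : R -> R[i]) t : ccontinuous k t ->
  {for t, continuous (fun x => cabs (k x))}.
Proof.
move=> [k1 k2].
rewrite (_ : (fun x => _) = (fun x => Num.sqrt (complex.Re (k x) * complex.Re (k x)
    + complex.Im (k x) * complex.Im (k x)))).
  apply: continuous_comp; last exact: sqrt_continuous.
  by apply: cvgD; exact: cvgM.
by apply/funext => x; rewrite -!expr2 -sqr_cabs sqrtr_sqr ger0_norm ?cabs_ge0.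
Qed.

End ContinuousCurves.

(** * Integrability of exponential tails *)

Section ExpAbs.
Variable R : realType.
Local Notation mu := (@lebesgue_measure R).

Lemma le_sqr_expR (m y : R) : 0 < m -> y ^+ 2 <= 4 / m ^+ 2 * expR (m * `|y|).
Proof.
move=> m0.
have H : 1 + m * `|y| / 2 <= expR (m * `|y| / 2) by exact: expR_ge1Dx.
have y0 : 0 <= m * `|y| / 2 by rewrite divr_ge0 ?mulr_ge0 ?(ltW m0).
have -> : expR (m * `|y|) = expR (m * `|y| / 2) ^+ 2.
  by rewrite -expRM_natl; congr expR; field.
have -> : y ^+ 2 = 4 / m ^+ 2 * (m * `|y| / 2) ^+ 2.
  by rewrite -[y ^+ 2]real_normK ?num_real//; field; rewrite gt_eqF.
rewrite ler_wpM2l ?divr_ge0 ?exprn_ge0 ?(ltW m0)//.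
by rewrite ler_sqr ?nnegrE ?expR_ge0//; move: H y0; clear; lra.
Qed.

Lemma le_abs_expR (m y : R) : 0 < m -> `|y| <= 1 / m * expR (m * `|y|).
Proof.
move=> m0; have H : 1 + m * `|y| <= expR (m * `|y|) by exact: expR_ge1Dx.
rewrite div1r mulrC ler_pdivlMr// mulrC; move: H; clear; lra.
Qed.

Lemma continuous_expR_abs (m : R) : continuous (fun y : R => expR (- m * `|y|)).
Proof.
move=> y; apply: continuous_comp; last exact: continuous_expR.
by apply: continuousM; [exact: cvg_cst|exact: norm_continuous].
Qed.

(** The logistic function F = 1 / (1 + e^(-m y)) is bounded, and its derivative is at least (m / 4)
    e^(-m|y|), because 1 + e^(-m|y|) <= 2. *)
Lemma integrable_expR_abs (m : R) : 0 < m ->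
  mu.-integrable setT (EFin \o (fun y : R => expR (- m * `|y|))).
Proof.
move=> m0.
pose F (y : R) : R := (1 + expR (- m * y))^-1.
pose f (y : R) : R := m * expR (- m * y) * (1 + expR (- m * y)) ^- 2.
have pos y : 0 < 1 + expR (- m * y) by rewrite ltr_pwDl// expR_ge0.
have dF (y : R) : is_derive y 1 F (f y).
  have d1 : is_derive y 1 (fun y : R => 1 + expR (- m * y)) (- m * expR (- m * y)).
    by apply: is_derive_eq; rewrite /GRing.scale /=; ring.
  have := @is_deriveV _ (fun y : R => 1 + expR (- m * y)) y _ 1 _ d1.
  rewrite gt_eqF// => /(_ isT) H; apply: is_derive_eq.
  by rewrite /f /GRing.scale /=; ring.
have ce : continuous (fun y : R => expR (- m * y)).
  move=> y; apply: continuous_comp; last exact: continuous_expR.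
  by apply: cvgM; [exact: cvg_cst|exact: cvg_id].
have cf : continuous f.
  move=> y; apply: cvgM.
    by apply: cvgM; [exact: cvg_cst|exact: ce].
  apply: cvgV; first by rewrite expf_neq0// gt_eqF.
  apply: (@continuous_cvg _ _ _ _ _ _ (fun u : R => u ^+ 2)); first exact: exprn_continuous.
  by apply: cvgD; [exact: cvg_cst|exact: ce].
have f0 y : 0 <= f y.
  by rewrite /f !mulr_ge0 ?invr_ge0 ?exprn_ge0 ?expR_ge0 ?(ltW m0) ?(ltW (pos y)).
have [intf _] : mu.-integrable setT (EFin \o f) /\ \int[mu]_x f x <= 2 * 1.
  apply: (integrable_derivative_bounded cf f0 dF) => y.
  by rewrite ger0_norm /F ?invr_ge0 ?(ltW (pos y))// invf_le1// lerDl expR_ge0.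
have mT : measurable [set: R] by [].
apply: le_integrable_real (integrableZ_real (4 / m) mT intf) => //.
  by apply: continuous_measurable_fun; exact: continuous_expR_abs.
move=> y _; rewrite ger0_norm ?expR_ge0//.
have -> : 4 / m * f y = 4 * expR (- m * y) / (1 + expR (- m * y)) ^+ 2.
  by rewrite /f; field; rewrite !gt_eqF.
rewrite ler_pdivlMr ?exprn_gt0//.
have [y0|y0] := leP 0 y.
  rewrite ger0_norm// mulrC ler_pM2r ?expR_gt0//.
  have : expR (- m * y) <= 1 by rewrite expR_le1 mulNr oppr_le0 mulr_ge0// ltW.
  by have := expR_ge0 (- m * y); nra.
rewrite ltr0_norm// (_ : - m * - y = m * y); last by ring.
have E : expR (m * y) * expR (- m * y) = 1 by rewrite -expRD -expR0; congr expR; ring.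
have : expR (m * y) <= 1 by rewrite expR_le1 nmulr_lle0// ltW.
have := expR_gt0 (m * y); move: E.
move: (expR (m * y)) (expR (- m * y)) => u v E u0 u1.
have v0 : 0 < v by nra.
have -> : u * (1 + v) ^+ 2 = u + 2 * (u * v) + (u * v) * v by ring.
by rewrite E; nra.
Qed.

End ExpAbs.

(** * The integral S and its contiguous relations *)

Section Kernel.
Variable R : realType.
Implicit Types (x y t v m : R) (p r s z w h : R[i]).
Local Notation re := (@complex.Re R).
Local Notation im := (@complex.Im R).

(** Holomorphic for |Im z| < pi; the complex powers of 1 + e^z are defined as exponentials of its
    multiples. *)
Definition softplus z : R[i] := clog (1 + cexp z).

(** Where the real part is not positive, the imaginary part e^x sin y is nonzero: in this strip sin
    y = 0 forces y = 0, and then the real part is positive. *)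
Lemma slit_1Dcexp z : - pi < im z < pi -> slit (1 + cexp z).
Proof.
move=> /andP[zl zh]; rewrite /slit !ReD Re_cexp /=.
have e0 := expR_gt0 (re z).
have [c0|c0] := ltP 0 (1 + expR (re z) * cos (im z)).
  by rewrite ltr_wpDl// cabs_ge0.
have i0 : im (1 + cexp z) != 0.
  rewrite ImD Im_cexp /= add0r; apply: mulf_neq0; first by rewrite gt_eqF.
  have [i0|i0|i0] := ltgtP (im z) 0.
  - by rewrite -[im z]opprK sinN oppr_eq0 gt_eqF// sin_gt0_pi// oppr_gt0 i0 ltrNl.
  - by rewrite gt_eqF// sin_gt0_pi// i0.
  - by move: c0; rewrite i0 cos0 mulr1 leNgt ltr_pwDl// ltW.
have := sqr_cabs (1 + cexp z); rewrite ReD Re_cexp /=.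
have := cabs_ge0 (1 + cexp z).
have : 0 < im (1 + cexp z) ^+ 2 by rewrite exprn_even_gt0.
move: (cabs _) (im _ ^+ 2) c0 => u q; move: (1 + _) => d d0 q0 u0 E.
rewrite ltNge; apply/negP => H.
have := @mulr_ge0 _ (u - d) (- (u + d)); rewrite oppr_ge0 H subr_ge0 (le_trans d0 u0).
by move=> /(_ isT isT); move: q0 E; clear; lra.
Qed.

(** The derivative e^z / (1 + e^z) is written as an exponential, so that multiplying a kernel by it
    merely raises parameters, as in [kernS1]. *)
Lemma cderiv_softplus z : - pi < im z < pi ->
  cderiv softplus z (cexp (z - softplus z)).
Proof.
move=> /slit_1Dcexp sz; rewrite /softplus.
apply: (cderiv_eq (fun=> erefl) _ (cderiv_comp (cderivD (cderiv_cst 1 z) (cderiv_cexp z)) (cderiv_clog sz))).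
by rewrite add0r cexpD cexpN clogK// mulrC.
Qed.

Variable c : R.
Hypothesis c0 : 0 < c.

(* On the real line, [e^(s y) (1 + e^y)^(-p) (1 + e^(y - c))^(-r)]. *)
Definition kern p r s z : R[i] := cexp (s * z - p * softplus z - r * softplus (z - c%:C)).

Lemma kernS1 p r s z : kern p r s z * cexp (z - softplus z) = kern (p + 1) r (s + 1) z.
Proof. by rewrite -cexpD; congr cexp; ring. Qed.

Lemma kernS2 p r s z : kern p r s z * cexp (z - c%:C - softplus (z - c%:C))
  = (expR (- c))%:C * kern p (r + 1) (s + 1) z.
Proof. by rewrite -cexpD -cexp_real -cexpD rmorphN; congr cexp; ring. Qed.

(** One factor 1 + e^z is taken out of (1 + e^z)^(-p) and expanded. *)
Lemma kern_split1 p r s z : - pi < im z < pi ->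
  kern p r s z = kern (p + 1) r s z + kern (p + 1) r (s + 1) z.
Proof.
move=> zpi; have E := clogK (slit_1Dcexp zpi).
have -> : kern p r s z = kern (p + 1) r s z * cexp (softplus z).
  by rewrite -cexpD; congr cexp; ring.
rewrite {1}/softplus E mulrDr mulr1 -cexpD; congr (_ + cexp _); ring.
Qed.

Lemma kern_split2 p r s z : - pi < im z < pi ->
  kern p r s z = kern p (r + 1) s z + (expR (- c))%:C * kern p (r + 1) (s + 1) z.
Proof.
move=> zpi; have zpi' : - pi < im (z - c%:C) < pi by rewrite ImD ImN /= subr0.
have E := clogK (slit_1Dcexp zpi').
have -> : kern p r s z = kern p (r + 1) s z * cexp (softplus (z - c%:C)).
  by rewrite -cexpD; congr cexp; ring.
rewrite {1}/softplus E mulrDr mulr1 -cexpD -cexp_real -cexpD rmorphN.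
congr (_ + cexp _); ring.
Qed.

Lemma cderiv_kern p r s z : - pi < im z < pi ->
  cderiv (kern p r s) z (s * kern p r s z - p * kern (p + 1) r (s + 1) z
     - r * (expR (- c))%:C * kern p (r + 1) (s + 1) z).
Proof.
move=> zpi; have zpi' : - pi < im (z - c%:C) < pi by rewrite ImD ImN /= subr0.
have d1 := cderiv_softplus zpi.
have d2 : cderiv (fun z => softplus (z - c%:C)) z (cexp (z - c%:C - softplus (z - c%:C)) * (1 - 0)).
  apply: (@cderiv_comp _ softplus (fun z => z - c%:C) z).
    by apply: cderivB; [exact: cderiv_id|exact: cderiv_cst].
  exact: cderiv_softplus.
have := cderiv_comp (cderivB (cderivB (cderivZ s (@cderiv_id R z)) (cderivZ p d1)) (cderivZ r d2))
  (@cderiv_cexp R _).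
apply: cderiv_eq => //.
rewrite -(mulrA r) -kernS2 -kernS1 /kern; ring.
Qed.

Lemma cabs_kern p r s z : cabs (kern p r s z) = expR (re (s * z)
  - (re p * ln (cabs (1 + cexp z)) - im p * im (softplus z))
  - (re r * ln (cabs (1 + cexp (z - c%:C))) - im r * im (softplus (z - c%:C)))).
Proof. by rewrite cabs_cexp !ReD !ReN (ReM p) (ReM r). Qed.

Lemma softplus_real y : softplus y%:C = (ln (1 + expR y))%:C.
Proof.
by rewrite /softplus cexp_real -(rmorph1 (real_complex R)) -rmorphD /= clog_real// ltr_pwDl// expR_ge0.

Qed.

Lemma im_real y : - pi < im y%:C < pi.
Proof. by rewrite /= oppr_lt0 pi_gt0. Qed.

Lemma le_ln1DexpR y : Num.max 0 y <= ln (1 + expR y).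
Proof.
have e0 := expR_ge0 y; rewrite ge_max; apply/andP; split.
  by rewrite ln_ge0// lerDl.
rewrite -[leLHS]expRK ler_ln ?posrE ?expR_gt0 ?ltr_pwDl//.
by rewrite lerDr.
Qed.

(** On the real line ln (1 + e^y) >= max(0, y). The factor e^(c Re r) is the price of replacing
    max(0, y - c) by max(0, y) - c. *)
Lemma cabs_kern_real p r s m y : 0 <= re p -> 0 <= re r -> m <= re s ->
  m <= re p + re r - re s ->
  cabs (kern p r s y%:C) <= expR (re r * c) * expR (- m * `|y|).
Proof.
move=> p0 r0 ms mpr; rewrite cabs_cexp -expRD ler_expR.
have -> : y%:C - c%:C = (y - c)%:C by rewrite rmorphB.
rewrite !softplus_real !ReD !ReN (mulrC s) (mulrC p) (mulrC r) !ReMl.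
have := le_ln1DexpR y; have := le_ln1DexpR (y - c).
rewrite !ge_max => /andP[a1 a2] /andP[b1 b2].
have [y0|y0] := leP 0 y.
- rewrite ger0_norm//.
  have := ler_wpM2r p0 b2; have := ler_wpM2r r0 a2; have := ler_wpM2r y0 mpr.
  rewrite !mulrBl !mulrDl !mulNr; lra.
- rewrite ltr0_norm//.
  have := mulr_ge0 b1 p0; have := mulr_ge0 a1 r0; have := mulr_ge0 r0 (ltW c0).
  have y0' : 0 <= - y by rewrite oppr_ge0 ltW.
  have := ler_wpM2r y0' ms; rewrite !mulrN !mulNr opprK; lra.
Qed.

Lemma kern_real_ccontinuous p r s t : ccontinuous (fun y => kern p r s y%:C) t.
Proof.
have := @cderiv_ccontinuous R (kern p r s) _ (fun x => x%:C + 0) t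
  (contraction_horizontal 0) (cderiv_kern p r s _).
rewrite addr0 => /(_ (im_real t)); by under eq_fun do rewrite addr0.
Qed.

(** The last two conditions are convergence at - oo, where the kernel behaves like e^(s y), and at +
    oo, where it behaves like e^((s - p - r) y). *)
Definition admissible p r s := [/\ 0 <= re p, 0 <= re r, 0 < re s & re s < re p + re r].

Definition margin p r s := Num.min (re s) (re p + re r - re s).

Lemma margin_gt0 p r s : admissible p r s -> 0 < margin p r s.
Proof. by case=> _ _ s0 spr; rewrite lt_min s0 subr_gt0. Qed.

Lemma kern_margin p r s y : admissible p r s ->
  cabs (kern p r s y%:C) <= expR (re r * c) * expR (- margin p r s * `|y|).
Proof. by case=> *; apply: cabs_kern_real; rewrite ?ge_min ?lexx ?orbT. Qed.

Lemma cintegrable_kern p r s : admissible p r s ->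
  cintegrable setT (fun y => kern p r s y%:C).
Proof.
move=> adm; apply: cintegrable_dominated (fun y => kern_margin y adm).
  exact: kern_real_ccontinuous.
exact/integrableZ_real/integrable_expR_abs/margin_gt0.
Qed.

Definition S p r s : R[i] := cintegral setT (fun y => kern p r s y%:C).

Lemma S_split1 p r s : admissible p r s ->
  S p r s = S (p + 1) r s + S (p + 1) r (s + 1).
Proof.
move=> [p0 r0 s0 spr]; rewrite /S -cintegralD//.
- by apply: eq_cintegral => y _; rewrite -kern_split1// im_real.
- by apply: cintegrable_kern; split; rewrite ?ReD /=; lra.
- by apply: cintegrable_kern; split; rewrite ?ReD /=; lra.
Qed.

Lemma S_split2 p r s : admissible p r s ->
  S p r s = S p (r + 1) s + (expR (- c))%:C * S p (r + 1) (s + 1).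
Proof.
move=> [p0 r0 s0 spr].
have a1 : admissible p (r + 1) s by split; rewrite ?ReD /=; lra.
have a2 : admissible p (r + 1) (s + 1) by split; rewrite ?ReD /=; lra.
rewrite /S -cintegralZ//; last exact: cintegrable_kern.
rewrite -cintegralD//; [|exact: cintegrable_kern|exact/cintegrableZ/cintegrable_kern].
by apply: eq_cintegral => y _; rewrite -kern_split2// im_real.
Qed.

(* Integration by parts: the integral of the derivative of the kernel vanishes. *)
Lemma S_parts p r s : admissible p r s ->
  s * S p r s = p * S (p + 1) r (s + 1) + r * (expR (- c))%:C * S p (r + 1) (s + 1).
Proof.
move=> adm; have [p0 r0 s0 spr] := adm.
have i0 := cintegrable_kern adm.
have i1 : cintegrable setT (fun y => kern (p + 1) r (s + 1) y%:C).
  by apply: cintegrable_kern; split; rewrite ?ReD /=; lra.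
have i2 : cintegrable setT (fun y => kern p (r + 1) (s + 1) y%:C).
  by apply: cintegrable_kern; split; rewrite ?ReD /=; lra.
(* The derivative of the kernel is transported to the point y + 0, the form that [cderiv_is_derive]
   expects. *)
have d (y : R) := cderiv_is_derive (x := y) (w := 0)
  (eq_rect _ (fun z => cderiv _ z _) (cderiv_kern p r s (im_real y)) _ (esym (addr0 _))).
have E : (fun t => kern p r s (t%:C + 0)) = (fun t => kern p r s t%:C).
  by apply/funext => t; rewrite addr0.
have mT : measurable [set: R] by [].
have ik : cintegrable setT (fun y => s * kern p r s y%:C - p * kern (p + 1) r (s + 1) y%:C
     - r * (expR (- c))%:C * kern p (r + 1) (s + 1) y%:C).
  by do 2 (apply: cintegrableB => //; last exact: cintegrableZ); exact: cintegrableZ.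
have : cintegral setT (fun y => s * kern p r s y%:C - p * kern (p + 1) r (s + 1) y%:C
     - r * (expR (- c))%:C * kern p (r + 1) (s + 1) y%:C) = 0.
  apply: (@cintegral_derivative0 _ (fun y => kern p r s y%:C) _ _ _ _ ik).
  - move=> y; have [] := d y.
    by rewrite (_ : (fun t => re (kern p r s (t%:C + 0))) = (fun t => re (kern p r s t%:C)))//;
      apply/funext => t; rewrite addr0.
  - move=> y; have [_] := d y.
    by rewrite (_ : (fun t => im (kern p r s (t%:C + 0))) = (fun t => im (kern p r s t%:C)))//;
      apply/funext => t; rewrite addr0.
  - move=> t; have ck p' r' s' := kern_real_ccontinuous p' r' s' t.
    exact: ccontinuousB (ccontinuousB (ccontinuousZ _ (ck _ _ _)) (ccontinuousZ _ (ck _ _ _)))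
      (ccontinuousZ _ (ck _ _ _)).
  - move=> e e0; have m0 := margin_gt0 adm.
    have K0 : 0 < expR (re r * c) by exact: expR_gt0.
    have lim : \forall n \near \oo,
        expR (re r * c) * expR (- margin p r s * `|n%:R|) < e.
      have : \forall n \near \oo, (expR (re r * c) / (margin p r s * e) : R) < n%:R.
        exact: nbhs_infty_gtr.
      apply: filterS => n Hn; rewrite ger0_norm// mulNr expRN.
      rewrite ltr_pdivrMr ?expR_gt0//.
      have := expR_gt1Dx (x := margin p r s * n%:R).
      move: Hn; rewrite ltr_pdivrMr ?mulr_gt0// => Hn.
      have n0 : 0 <= margin p r s * n%:R by rewrite mulr_ge0 ?(ltW m0).
      have := expR_ge1Dx (margin p r s * n%:R) => H _.
      apply: lt_le_trans Hn _.
      have -> : n%:R * (margin p r s * e) = e * (margin p r s * n%:R) by ring.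
      by rewrite ler_pM2l// (le_trans _ H)// lerDr.
    near=> n; split; apply: le_lt_trans (kern_margin _ adm) _; rewrite ?normrN;
      by near: n.
have j1 := cintegrableZ s mT i0; have j2 := cintegrableZ p mT i1.
have j3 := cintegrableZ (r * (expR (- c))%:C) mT i2.
rewrite (cintegralB mT (cintegrableB mT j1 j2) j3) (cintegralB mT j1 j2).
rewrite (cintegralZ _ mT i0) (cintegralZ _ mT i1) (cintegralZ _ mT i2) -!/(S _ _ _).
move=> /eqP; rewrite subr_eq0 subr_eq => /eqP ->; ring.
Unshelve. all: by end_near. Qed.

End Kernel.

(** * Holomorphy of S in its last parameter *)

Section Holomorphy.
Variable R : realType.
Implicit Types (x y t v m : R) (p r s z w h : R[i]).
Local Notation mu := (@lebesgue_measure R).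
Local Notation re := (@complex.Re R).
Variable c : R.
Hypothesis c0 : 0 < c.
Local Notation kern := (kern c).
Local Notation S := (S c).

Lemma kernD p r s h z : kern p r (s + h) z = kern p r s z * cexp (h * z).
Proof. by rewrite -cexpD; congr cexp; ring. Qed.

(** Differentiation under the integral sign with the error of [cexp_increment2]. Of the decay rate m
    of the kernel, one half is kept for integrability, a quarter absorbs y^2 and a quarter absorbs
    e^(|h||y|) for |h| <= m / 4. *)
Lemma S_cderiv p r s : admissible p r s -> exists d, cderiv (S p r) s d.
Proof.
move=> adm; have [p0 r0 s0 spr] := adm.
have m0 := margin_gt0 adm; set m := margin p r s in m0.
set E := expR (re r * c); have E0 : 0 < E by exact: expR_gt0.
have mT : measurable [set: R] by [].
have ik := cintegrable_kern c0 adm.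
have m2 : 0 < m / 2 by rewrite divr_gt0.
have m4 : 0 < m / 4 by rewrite divr_gt0.
have iexp := integrable_expR_abs m2.
set J := \int[mu]_y expR (- (m / 2) * `|y|).
have J0 : 0 <= J by apply: Rintegral_ge0 => y _; exact: expR_ge0.
have idk : cintegrable setT (fun y => y%:C * kern p r s y%:C).
  apply: (cintegrable_dominated (g := fun y => E * (1 / (m / 2)) * expR (- (m / 2) * `|y|))).
  - move=> t; apply: ccontinuousM; last exact: kern_real_ccontinuous.
    by apply: ccontinuous_real; exact: cvg_id.
  - exact: integrableZ_real.
  - move=> y; rewrite cabsM cabs_real.
    have := ler_pM (normr_ge0 y) (cabs_ge0 _) (le_abs_expR y m2) (kern_margin c0 y adm).
    rewrite -/E -/m => /le_trans; apply.
    have -> : - m * `|y| = - (m / 2) * `|y| - m / 2 * `|y| by field.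
    rewrite expRB [leLHS](_ : _ = E * (1 / (m / 2)) * expR (- (m / 2) * `|y|))//.
    by field; rewrite !gt_eqF ?expR_gt0.
exists (cintegral setT (fun y => y%:C * kern p r s y%:C)) => e e0.
(* The coefficient of |h|^2 in the integrated error, the last 2 coming from [cabs_cintegral]; the 1
   makes it positive. *)
set K := 4 * E * (4 / (m / 4) ^+ 2) * J * 2 + 1.
have K0 : 0 < K.
  by rewrite ltr_wpDl// !mulr_ge0 ?invr_ge0 ?exprn_ge0 ?(ltW E0) ?(ltW m4).
exists (Num.min (m / 4) (e / K)); first by rewrite lt_min m4 divr_gt0.
move=> w; rewrite lt_min => /andP[wm wK].
set h := w - s in wm wK *.
have wE : w = s + h by rewrite addrC subrK.
have admw : admissible p r w.
  have := cabs_ge_Re h; rewrite ler_norml => /andP[h1 h2].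
  have ms : m <= re s by rewrite /m /margin ge_min lexx.
  have mp : m <= re p + re r - re s by rewrite /m /margin ge_min lexx orbT.
  rewrite wE /admissible ReD; clearbody m; split => //.
    by move: wm ms h1 m0; clear; lra.
  by move: wm mp h2 m0; clear; lra.
have iw := cintegrable_kern c0 admw.
have -> : S p r w - S p r s - cintegral setT (fun y => y%:C * kern p r s y%:C) * h
  = cintegral setT (fun y => kern p r w y%:C - kern p r s y%:C - h * (y%:C * kern p r s y%:C)).
  have j1 := cintegrableZ h mT idk; have j2 := cintegrableB mT iw ik.
  by rewrite (cintegralB mT j2 j1) (cintegralB mT iw ik) (cintegralZ _ mT idk) mulrC.
have bnd := @cabs_cintegral R setT _
  (fun y => 4 * E * (4 / (m / 4) ^+ 2) * cabs h ^+ 2 * expR (- (m / 2) * `|y|)) mT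
  (cintegrableB mT (cintegrableB mT iw ik) (cintegrableZ h mT idk)) (integrableZ_real _ mT iexp).
apply: le_trans (bnd _) _.
- move=> y _.
  have -> : kern p r w y%:C - kern p r s y%:C - h * (y%:C * kern p r s y%:C)
     = kern p r s y%:C * (cexp (h * y%:C) - 1 - h * y%:C) by rewrite wE kernD; ring.
  rewrite cabsM; have := ler_pM (cabs_ge0 _) (cabs_ge0 _) (kern_margin c0 y adm) (cexp_increment2 (h * y%:C)).
  rewrite -/E -/m => /le_trans; apply; rewrite cabsM cabs_real.
  have -> : - m * `|y| = - (m / 2) * `|y| - m / 4 * `|y| - m / 4 * `|y| by field.
  rewrite !expRB exprMn [`|y| ^+ 2]real_normK ?num_real//.
  set u := expR (m / 4 * `|y|); have u0 : 0 < u by exact: expR_gt0.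
  set b := expR (- (m / 2) * `|y|); have b0 : 0 < b by exact: expR_gt0.
  have e1 : expR (cabs h * `|y|) <= u by rewrite ler_expR ler_wpM2r// ltW.
  have e2 := le_sqr_expR y m4; rewrite -/u in e2.
  have -> : E * (b / u / u) * (4 * (cabs h ^+ 2 * y ^+ 2) * expR (cabs h * `|y|))
    = (4 * E * cabs h ^+ 2 * b) * (y ^+ 2 / u) * (expR (cabs h * `|y|) / u).
    by field; rewrite gt_eqF.
  have -> : 4 * E * (4 / (m / 4) ^+ 2) * cabs h ^+ 2 * b
    = (4 * E * cabs h ^+ 2 * b) * (4 / (m / 4) ^+ 2) * 1 by ring.
  have z0 : 0 <= 4 * E * cabs h ^+ 2 * b.
    by rewrite !mulr_ge0 ?exprn_ge0 ?cabs_ge0 ?(ltW E0) ?(ltW b0).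
  apply: ler_pM.
  + by rewrite mulr_ge0// divr_ge0 ?sqr_ge0 ?(ltW u0).
  + by rewrite divr_ge0 ?expR_ge0 ?(ltW u0).
  + by rewrite ler_wpM2l// ler_pdivrMr.
  + by rewrite ler_pdivrMr// mul1r.
- rewrite RintegralZl// -/J.
  have hK : K * cabs h <= e by rewrite mulrC -ler_pdivlMr// ltW.
  have := ler_wpM2r (cabs_ge0 h) hK; apply: le_trans.
  rewrite /K mulrDl mul1r mulrDl.
  have := mulr_ge0 (cabs_ge0 h) (cabs_ge0 h).
  by move: (cabs h) => a; lra.
Qed.

End Holomorphy.

(** * Decay of S along vertical lines *)

Section ModulusBounds.
Variable R : realType.
Implicit Types (x y t v m : R) (p r s z w h : R[i]).
Local Notation re := (@complex.Re R).
Local Notation im := (@complex.Im R).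

Lemma atan_le x : 0 <= x -> atan x <= x.
Proof.
move=> x0; have cv := continuous_subspaceT (@continuous_atan R).
have [d] := MVT_segment x0 (fun u _ => is_derive1_atan u) (cv _).
rewrite in_itv /= atan0 !subr0 => /andP[d0 _] ->.
by rewrite ler_piMl// invf_le1 ?ltr_pwDl ?sqr_ge0// lerDl sqr_ge0.
Qed.

Lemma sqr_cabs_1Dcexp z : cabs (1 + cexp z) ^+ 2
  = 1 + 2 * expR (re z) * cos (im z) + expR (re z) ^+ 2.
Proof.
rewrite sqr_cabs ReD ImD Re_cexp Im_cexp /=.
have := cos2Dsin2 (im z); move: (expR _) (cos _) (sin _) => e u v H.
have -> : (1 + e * u) ^+ 2 + (0 + e * v) ^+ 2 = 1 + 2 * e * u + e ^+ 2 * (u ^+ 2 + v ^+ 2) by ring.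
by rewrite H mulr1.
Qed.

(** With x = Re z and y = Im z, |1 + e^z|^2 = (1 - e^x)^2 + 2 e^x (1 + cos y). At distance 2 atan
    tau from the line Im z = - pi, 1 + cos y >= 2 tau^2 / (1 + tau^2) >= tau^2. Measuring the
    distance by 2 atan tau makes the cosine rational in [tau]. *)
Lemma sqr_cabs_1Dcexp_ge (tau : R) z : 0 < tau <= 1 ->
  - (pi - 2 * atan tau) <= im z <= 0 ->
  (1 - expR (re z)) ^+ 2 + 2 * tau ^+ 2 * expR (re z) <= cabs (1 + cexp z) ^+ 2.
Proof.
move=> /andP[t0 t1] /andP[z1 z2]; rewrite sqr_cabs_1Dcexp.
have e0 := expR_gt0 (re z).
have at0 : 0 <= 2 * atan tau by rewrite mulr_ge0// -atan0 le_atan// ltW.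
have atp : 2 * atan tau <= pi.
  by have := atan_ltpi2 tau; have := pi_gt0 R; clear; move: (pi) (atan _) => u v; lra.
have H : - ((1 - tau ^+ 2) / (1 + tau ^+ 2)) <= cos (im z).
  rewrite -cos_2atan -(cosN (im z)).
  have -> : - cos (2 * atan tau) = cos (pi - 2 * atan tau).
    by rewrite cosB cospi sinpi; ring.
  rewrite leNgt ltr_cos ?in_itv /=.
  - by rewrite -leNgt; move: z1; clear; move: (im z) (pi - _) => u v; lra.
  - by apply/andP; split; move: z1 z2 at0 atp; clear; move: (im z) (atan _) (pi) => u v q; lra.
  - by apply/andP; split; move: z1 z2 at0 atp; clear; move: (im z) (atan _) (pi) => u v q; lra.
move: H e0; move: (cos _) (expR _) => u e H e0.
have d0 : 0 < 1 + tau ^+ 2 by rewrite ltr_pwDl ?sqr_ge0.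
have {}H : 0 <= e * (u + (1 - tau ^+ 2) / (1 + tau ^+ 2)).
  by rewrite mulr_ge0// ?(ltW e0)//; move: H; clear; lra.
have E : (1 - tau ^+ 2) / (1 + tau ^+ 2) = 1 - 2 * tau ^+ 2 / (1 + tau ^+ 2).
  by field; rewrite gt_eqF.
have G : tau ^+ 2 <= 2 * tau ^+ 2 / (1 + tau ^+ 2).
  rewrite ler_pdivlMr// mulrC ler_wpM2r ?sqr_ge0//.
  have : tau ^+ 2 <= 1 by rewrite expr_le1// ltW.
  by clear; lra.
have := ler_wpM2l (ltW e0) G; move: H; rewrite E.
by move: (2 * tau ^+ 2 / (1 + tau ^+ 2)) => g; clear; lra.
Qed.

(** Small enough for both terms of the next bound: at most 1/4, and a quarter of e^(-1), the least
    value of e^(-|v|) for |v| <= 1. *)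
Definition kappa0 : R := (4 * expR 1)^-1.

Lemma kappa0_gt0 : 0 < kappa0.
Proof. by rewrite invr_gt0 mulr_gt0// expR_gt0. Qed.

(** Once e^(2 max(0, v)) is taken out, the right-hand side depends on u = |v| only, through w =
    e^(-u). Then 1 - w is at least u / 2 for u <= 1 and at least 1/2 beyond. The left-hand side
    separates growth at + oo from closeness to the branch point at v = 0. *)
Lemma one_minus_exp_ge (tau v : R) : 0 < tau <= 1 ->
  kappa0 * expR (Num.max 0 v) ^+ 2 * ((v ^+ 2 + tau ^+ 2) / (v ^+ 2 + 1))
  <= (1 - expR v) ^+ 2 + 2 * tau ^+ 2 * expR v.
Proof.
move=> /andP[t0 t1].
set u := `|v|; set w := expR (- u).
have u0 : 0 <= u by exact: normr_ge0.
have w0 : 0 < w by exact: expR_gt0.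
have v2 : v ^+ 2 = u ^+ 2 by rewrite /u real_normK ?num_real.
have wu : (1 + u) * w <= 1.
  have := expR_ge1Dx u; have <- : expR u * w = 1 by rewrite /w -expRD subrr expR0.
  by rewrite ler_pM2r.
have E : (1 - expR v) ^+ 2 + 2 * tau ^+ 2 * expR v
    = expR (Num.max 0 v) ^+ 2 * ((1 - w) ^+ 2 + 2 * tau ^+ 2 * w).
  have [v0|v0] := leP 0 v.
    have -> : expR v = w^-1 by rewrite /w /u ger0_norm// expRN invrK.
    by field; rewrite gt_eqF.
  by rewrite expR0 /w /u ltr0_norm// opprK; ring.
rewrite E (mulrC kappa0) -(mulrA (expR (Num.max 0 v) ^+ 2)).
apply: ler_wpM2l; first by rewrite exprn_ge0// expR_ge0.
rewrite v2.
have k4 : kappa0 <= 1 / 4.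
  rewrite /kappa0 invfM div1r ler_piMr ?invr_ge0// invf_le1 ?expR_gt0//.
  by have := expR_ge1Dx (1 : R); clear; lra.
have k0 := kappa0_gt0.
have d0 : 0 < u ^+ 2 + 1 by rewrite ltr_wpDl ?sqr_ge0.
have t2 : 0 <= tau ^+ 2 <= 1 by rewrite sqr_ge0 expr_le1// ltW.
have [u1|u1] := leP u 1.
  have w1 : (expR 1)^-1 <= w by rewrite /w -expRN ler_expR lerN2.
  have k1 : kappa0 * 4 <= w.
    rewrite (le_trans _ w1)// /kappa0 invfM; have := expR_gt0 (1 : R).
    by rewrite -invr_gt0; move: (_^-1) => g; clear; lra.
  have wh : u / 2 <= 1 - w by move: wu u1 u0 w0; clear; nra.
  have : (u / 2) ^+ 2 <= (1 - w) ^+ 2.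
    by rewrite ler_sqr ?nnegrE ?divr_ge0// (le_trans _ wh)// divr_ge0.
  have le1 : (u ^+ 2 + tau ^+ 2) / (u ^+ 2 + 1) <= u ^+ 2 + tau ^+ 2.
    rewrite ler_pdivrMr// ler_peMr ?lerDr ?sqr_ge0// addr_ge0 ?sqr_ge0//.
  have := ler_wpM2l (ltW k0) le1.
  case/andP: t2 => t2 _.
  have := ler_wpM2r (sqr_ge0 u) k4; have := ler_wpM2r t2 k1.
  move: ((u ^+ 2 + tau ^+ 2) / (u ^+ 2 + 1)) => g; move: (t2) (sqr_ge0 u).
  rewrite expr_div_n.
  have := mulr_ge0 (ltW k0) t2.
  by clear; lra.
have wh : 1 / 2 <= 1 - w by move: wu u1 w0; clear; nra.
have H : (1 / 2) ^+ 2 <= (1 - w) ^+ 2.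
  by rewrite ler_sqr ?nnegrE// (le_trans _ wh).
have le1 : (u ^+ 2 + tau ^+ 2) / (u ^+ 2 + 1) <= 1.
  by rewrite ler_pdivrMr// mul1r lerD2l; case/andP: t2.
have := ler_wpM2l (ltW k0) le1; rewrite mulr1.
have : 0 <= 2 * tau ^+ 2 * w by rewrite mulr_ge0 ?(ltW w0)// mulr_ge0// sqr_ge0.
move: H k4; rewrite expr_div_n expr1n.
move: ((u ^+ 2 + tau ^+ 2) / (u ^+ 2 + 1)) (2 * tau ^+ 2 * w) => g g'.
by clear; lra.
Qed.

(** The logarithmic loss in |1 + e^z|^2 caused by the branch point: at most 2 ln (1 / tau), and
    bounded independently of [tau] away from v = 0. *)
Definition Mlog (tau v : R) : R := ln ((v ^+ 2 + 1) / (v ^+ 2 + tau ^+ 2)).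

Lemma Mlog_arg_gt0 (tau v : R) : 0 < tau -> 0 < (v ^+ 2 + 1) / (v ^+ 2 + tau ^+ 2).
Proof. by move=> t0; rewrite divr_gt0// ltr_wpDl ?sqr_ge0// exprn_gt0. Qed.

Lemma Mlog_ge0 (tau v : R) : 0 < tau <= 1 -> 0 <= Mlog tau v.
Proof.
move=> /andP[t0 t1]; apply: ln_ge0; rewrite ler_pdivlMr ?ltr_wpDl ?sqr_ge0 ?exprn_gt0//.
by rewrite mul1r lerD2l expr_le1// ltW.
Qed.

Lemma Mlog_le (tau v : R) : 0 < tau <= 1 -> Mlog tau v <= - 2 * ln tau.
Proof.
move=> /andP[t0 t1].
have -> : - 2 * ln tau = ln (tau ^- 2).
  by rewrite lnV ?posrE ?exprn_gt0// lnXn// mulNr mulr_natl.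
rewrite ler_ln ?posrE ?Mlog_arg_gt0// ?invr_gt0 ?exprn_gt0//.
rewrite ler_pdivrMr ?ltr_wpDl ?sqr_ge0 ?exprn_gt0// mulrDr mulVf ?expf_neq0 ?gt_eqF//.
by rewrite lerD2r ler_peMl ?sqr_ge0// invf_ge1 ?exprn_gt0// expr_le1// ltW.
Qed.

(** The branch points have real parts 0 and c, so every v is at distance at least c / 2 from one of
    them, where this bound applies. *)
Lemma Mlog_far (tau v c : R) : 0 < tau -> 0 < c -> c / 2 <= `|v| ->
  Mlog tau v <= ln (1 + 4 / c ^+ 2).
Proof.
move=> t0 c0 cv.
have c2 : 0 < c ^+ 2 by rewrite exprn_gt0.
rewrite ler_ln ?posrE ?Mlog_arg_gt0 ?ltr_pwDl ?divr_ge0 ?(ltW c2)//.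
have H : c ^+ 2 / 4 <= v ^+ 2.
  rewrite -[v ^+ 2]real_normK ?num_real//.
  have -> : c ^+ 2 / 4 = (c / 2) ^+ 2 by field.
  by rewrite ler_sqr ?nnegrE ?divr_ge0// ltW.
rewrite ler_pdivrMr ?ltr_wpDl ?sqr_ge0 ?exprn_gt0//.
have : 1 <= 4 / c ^+ 2 * v ^+ 2.
  rewrite mulrAC ler_pdivlMr// mul1r; move: H; clear; lra.
have := mulr_ge0 (divr_ge0 (ler0n R 4) (ltW c2)) (sqr_ge0 tau).
have := sqr_ge0 tau; rewrite mulrDl mulrDr; move: (4 / c ^+ 2) => g; clear; lra.
Qed.

Lemma ln_cabs_ge (tau : R) z : 0 < tau <= 1 ->
  - (pi - 2 * atan tau) <= im z <= 0 ->
  ln kappa0 / 2 + Num.max 0 (re z) - Mlog tau (re z) / 2 <= ln (cabs (1 + cexp z)).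
Proof.
move=> t01 zt; have /andP[t0 t1] := t01.
have k0 := kappa0_gt0.
have E0 : 0 < expR (Num.max 0 (re z)) ^+ 2 by rewrite exprn_gt0 ?expR_gt0.
have d0 : 0 < (re z ^+ 2 + tau ^+ 2) / (re z ^+ 2 + 1).
  by rewrite divr_gt0// ltr_wpDl ?sqr_ge0// exprn_gt0.
have L0 : 0 < kappa0 * expR (Num.max 0 (re z)) ^+ 2 * ((re z ^+ 2 + tau ^+ 2) / (re z ^+ 2 + 1)).
  exact: mulr_gt0 (mulr_gt0 k0 E0) d0.
have H := le_trans (one_minus_exp_ge (re z) t01) (sqr_cabs_1Dcexp_ge t01 zt).
have A0 : 0 < cabs (1 + cexp z).
  rewrite lt_def cabs_ge0 andbT; apply: contraTneq (lt_le_trans L0 H) => ->.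
  by rewrite expr0n ltxx.
have : ln (kappa0 * expR (Num.max 0 (re z)) ^+ 2 * ((re z ^+ 2 + tau ^+ 2) / (re z ^+ 2 + 1)))
   <= ln (cabs (1 + cexp z) ^+ 2) by rewrite ler_ln ?posrE ?exprn_gt0.
rewrite (lnM (mulr_gt0 k0 E0) d0) (lnM k0 E0) lnXn ?expR_gt0// expRK lnXn//.
have -> : ln ((re z ^+ 2 + tau ^+ 2) / (re z ^+ 2 + 1)) = - Mlog tau (re z).
  by rewrite /Mlog -lnV ?posrE ?Mlog_arg_gt0// invf_div.
by move: (ln _) (ln _) (Num.max _ _) (Mlog _ _) => a b d e; clear; lra.
Qed.

End ModulusBounds.

(** * The kernel close to its branch points *)

Section KernelOnStrips.
Variable R : realType.
Implicit Types (x y t v m : R) (p r s z w h : R[i]).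
Local Notation mu := (@lebesgue_measure R).
Local Notation re := (@complex.Re R).
Local Notation im := (@complex.Im R).
Variable c : R.
Hypothesis c0 : 0 < c.
Local Notation kern := (kern c).
Local Notation S := (S c).

(** Up to the factor tau / pi, the Poisson kernel of the half-plane at height [tau]. Its integral pi
    / tau supplies a power of 1 / tau. *)
Definition poisson (tau v : R) : R := (v ^+ 2 + tau ^+ 2)^-1.

Lemma poisson_gt0 (tau v : R) : 0 < tau -> 0 < poisson tau v.
Proof. by move=> t0; rewrite invr_gt0 ltr_wpDl ?sqr_ge0// exprn_gt0. Qed.

Lemma poisson_integrable (tau d : R) : 0 < tau ->
  mu.-integrable setT (EFin \o (fun v => poisson tau (v - d))) /\
  \int[mu]_v poisson tau (v - d) <= pi / tau.
Proof.
move=> t0.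
have tn : tau != 0 by rewrite gt_eqF.
have d0 v : 0 < (v - d) ^+ 2 + tau ^+ 2 by rewrite ltr_wpDl ?sqr_ge0// exprn_gt0.
have -> : pi / tau = 2 * (pi / 2 / tau) by field.
apply: (@integrable_derivative_bounded _ (fun v => atan ((v - d) / tau) / tau)).
- move=> v; apply: cvgV; first by rewrite gt_eqF.
  apply: cvgD; last exact: cvg_cst.
  apply: (@continuous_cvg _ _ _ _ _ _ (fun u : R => u ^+ 2)); first exact: exprn_continuous.
  by apply: cvgB; [exact: cvg_id|exact: cvg_cst].
- by move=> v; rewrite ltW// poisson_gt0.
- move=> v.
  have d1 : is_derive v 1 (fun v : R => (v - d) / tau) tau^-1.
    by apply: is_derive_eq; rewrite /GRing.scale /=; field.
  have d2 := @is_derive1_comp _ (@atan R) (fun v : R => (v - d) / tau) v _ _ (is_derive1_atan _) d1.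
  have : is_derive v 1 (fun v : R => tau^-1 * (atan ((v - d) / tau))) (poisson tau (v - d)).
    apply: is_derive_eq; rewrite /poisson /GRing.scale /=; field.
    by rewrite tn !gt_eqF// expr_div_n; have := sqr_ge0 ((v - d) / tau); rewrite expr_div_n; lra.
  by rewrite (_ : (fun v => _) = (fun v => atan ((v - d) / tau) / tau))//;
    apply/funext => u; rewrite mulrC.
- move=> v; rewrite normrM normfV (gtr0_norm t0) ler_pM2r ?invr_gt0//.
  by rewrite ler_norml !ltW ?atan_gtNpi2 ?atan_ltpi2.
Qed.

(** The factor of the far branch point is bounded. At the near one k / 2 = 1 + (k / 2 - 1): one full
    exponential of [Mlog] is (u^2 + 1) times the Poisson kernel, and the rest is at most tau^(-(k -
    2)), which uses k >= 2. The polynomial u^2 + 1 is absorbed by e^(-m|v|). *)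
Lemma exp_Mlog_le (tau k m v : R) : 0 < tau <= 1 -> 2 <= k -> 0 < m ->
  expR (- m * `|v|) * expR (k / 2 * (Mlog tau v + Mlog tau (v - c)))
  <= expR (k / 2 * ln (1 + 4 / c ^+ 2)) * (8 / m ^+ 2 + 2 * c ^+ 2 + 1)
     * expR (- (k - 2) * ln tau) * (poisson tau v + poisson tau (v - c)).
Proof.
move=> t01 k2 m0; have /andP[t0 t1] := t01.
set D := ln (1 + 4 / c ^+ 2); set T := - (k - 2) * ln tau.
(* From (v - c)^2 + 1 <= 2 v^2 + 2 c^2 + 1 and v^2 e^(-m|v|) <= 4 / m^2. *)
set Kc := 8 / m ^+ 2 + 2 * c ^+ 2 + 1.
have c2 : 0 < c ^+ 2 by rewrite exprn_gt0.
have m2 : 0 < m ^+ 2 by rewrite exprn_gt0.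
have k0 : 0 <= k / 2 by rewrite divr_ge0// (le_trans _ k2).
(* [u] is the coordinate relative to the near branch point, [u'] relative to the far one. *)
have key (u u' : R) : Mlog tau u' <= D -> expR (- m * `|v|) * (u ^+ 2 + 1) <= Kc ->
    expR (- m * `|v|) * expR (k / 2 * (Mlog tau u + Mlog tau u'))
    <= expR (k / 2 * D) * Kc * expR T * poisson tau u.
  move=> M1 hK.
  have eM : expR (Mlog tau u) = (u ^+ 2 + 1) * poisson tau u.
    by rewrite lnK// posrE Mlog_arg_gt0.
  have H : k / 2 * (Mlog tau u + Mlog tau u') <= k / 2 * D + (Mlog tau u + T).
    have arith (a b l d : R) : k / 2 * b <= k / 2 * d ->
        (k / 2 - 1) * a <= (k / 2 - 1) * (- 2 * l) ->
        k / 2 * (a + b) <= k / 2 * d + (a + - (k - 2) * l).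
      by clear; lra.
    apply: arith; first exact: ler_wpM2l.
    by apply: ler_wpM2l (Mlog_le u t01); move: k2; clear; lra.
  have {}H : expR (k / 2 * (Mlog tau u + Mlog tau u'))
      <= expR (k / 2 * D) * ((u ^+ 2 + 1) * poisson tau u * expR T).
    by rewrite -eM -!expRD ler_expR.
  apply: le_trans (ler_wpM2l (expR_ge0 _) H) _.
  have p0 := ltW (poisson_gt0 u t0).
  have arith (a b d e f g : R) : 0 <= b -> 0 <= d -> 0 <= e -> a * f <= g ->
      a * (b * (f * e * d)) <= b * g * d * e.
    by move=> b0 d0 e0 H'; have := ler_wpM2r (mulr_ge0 (mulr_ge0 b0 d0) e0) H'; clear; lra.
  by apply: arith; rewrite ?expR_ge0.
have v2 : v ^+ 2 = `|v| ^+ 2 by rewrite real_normK ?num_real.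
have b0 : expR (- m * `|v|) * v ^+ 2 <= 4 / m ^+ 2.
  have := ler_wpM2l (expR_ge0 (- m * `|v|)) (le_sqr_expR v m0).
  rewrite [leRHS]mulrCA -expRD (_ : - m * `|v| + m * `|v| = 0); last by ring.
  by rewrite expR0 mulr1.
have b1 : expR (- m * `|v|) <= 1 by rewrite expR_le1 mulNr oppr_le0 mulr_ge0// ltW.
have e0 := expR_ge0 (- m * `|v|).
have P0 : 0 <= expR (k / 2 * D) * Kc * expR T.
  rewrite mulr_ge0 ?expR_ge0// mulr_ge0 ?expR_ge0// /Kc.
  have : 0 <= (m ^+ 2)^-1 by rewrite invr_ge0 ltW.
  by move: c2; clear; lra.
have [vc|vc] := leP (c / 2) `|v|.
- rewrite [Mlog tau v + _]addrC.
  apply: le_trans (key (v - c) v (Mlog_far t0 c0 vc) _) _; last first.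
    by rewrite ler_wpM2l// lerDr ltW// poisson_gt0.
  have : (v - c) ^+ 2 + 1 <= 2 * v ^+ 2 + 2 * c ^+ 2 + 1.
    by have := sqr_ge0 (v + c); clear; lra.
  move=> /(ler_wpM2l e0)/le_trans; apply.
  have := ler_wpM2r (ltW c2) b1; rewrite /Kc; move: b0 b1; rewrite mul1r.
  by move: (expR _) (m ^+ 2)^-1 => a i; clear; lra.
- apply: le_trans (key v (v - c) (Mlog_far t0 c0 _) _) _; last first.
  + by rewrite ler_wpM2l// lerDl ltW// poisson_gt0.
  + rewrite mulrDr mulr1 /Kc; move: b0 b1 c2; have : 0 <= (m ^+ 2)^-1 by rewrite invr_ge0 ltW.
    by move: (expR (- m * `|v|)) (m ^+ 2)^-1; clear => a i; lra.
  + have := ler_normB c (c - v); rewrite subKr (gtr0_norm c0) distrC.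
    by move: vc; have := lerB_dist c v; rewrite (gtr0_norm c0) (distrC c v); clear; lra.
Qed.

(** The point is uniformity: [C] depends neither on [tau] nor on [s], whose imaginary part enters
    through one explicit exponential only. *)
Lemma kern_strip p r (k m : R) : 0 <= re p <= k -> 0 <= re r <= k -> 2 <= k -> 0 < m ->
  exists2 C : R, 0 <= C & forall (tau : R) s z, 0 < tau <= 1 ->
    m <= re s -> m <= re p + re r - re s ->
    - (pi - 2 * atan tau) <= im z <= 0 ->
    cabs (kern p r s z) <= C * expR (- im s * im z) * expR (- (k - 2) * ln tau)
      * (poisson tau (re z) + poisson tau (re z - c)).
Proof.
move=> /andP[p0 pk] /andP[r0 rk] k2 m0.
(* The arguments of both logarithms are at most pi; the other terms come from [kappa0] and from
   max(0, v - c) >= max(0, v) - c. *)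
pose K0 := pi * `|im p| + pi * `|im r| - (re p + re r) * (ln (@kappa0 R) / 2) + re r * c.
exists (expR K0 * (expR (k / 2 * ln (1 + 4 / c ^+ 2)) * (8 / m ^+ 2 + 2 * c ^+ 2 + 1))).
  rewrite mulr_ge0 ?expR_ge0// mulr_ge0 ?expR_ge0//.
  have : 0 <= (m ^+ 2)^-1 by rewrite invr_ge0 exprn_ge0// ltW.
  have : 0 <= c ^+ 2 by exact: sqr_ge0.
  by clear; lra.
move=> tau s z t01 ms mpr zt; have /andP[t0 t1] := t01.
have := exp_Mlog_le (re z) t01 k2 m0.
move=> /(ler_wpM2l (expR_ge0 (K0 + - im s * im z))) H.
rewrite [leRHS](_ : _ = expR (K0 + - im s * im z) *
   (expR (k / 2 * ln (1 + 4 / c ^+ 2)) * (8 / m ^+ 2 + 2 * c ^+ 2 + 1)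
     * expR (- (k - 2) * ln tau) * (poisson tau (re z) + poisson tau (re z - c)))); last first.
  by rewrite (expRD K0); ring.
apply: le_trans H; rewrite cabs_kern -!expRD ler_expR.
have zt' : - (pi - 2 * atan tau) <= im (z - c%:C) <= 0 by rewrite ImD ImN /= subr0.
have L1 := ln_cabs_ge t01 zt; have L2 := ln_cabs_ge t01 zt'.
have rez : re (z - c%:C) = re z - c by rewrite ReD ReN.
rewrite rez in L2.
have A1 : im p * im (softplus z) <= pi * `|im p|.
  rewrite (le_trans (ler_norm _))// normrM mulrC ler_wpM2r//; exact: Im_clog.
have A2 : im r * im (softplus (z - c%:C)) <= pi * `|im r|.
  rewrite (le_trans (ler_norm _))// normrM mulrC ler_wpM2r//; exact: Im_clog.
have M1 := Mlog_ge0 (re z) t01; have M2 := Mlog_ge0 (re z - c) t01.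
have B1 := ler_wpM2l p0 L1; have B2 := ler_wpM2l r0 L2.
have M3 : re p * Mlog tau (re z) <= k * Mlog tau (re z) by rewrite ler_wpM2r.
have M4 : re r * Mlog tau (re z - c) <= k * Mlog tau (re z - c) by rewrite ler_wpM2r.
have V : re s * re z - re p * Num.max 0 (re z) - re r * Num.max 0 (re z - c)
    <= - m * `|re z| + re r * c.
  have X1 : Num.max 0 (re z) - c <= Num.max 0 (re z - c).
    have [v0|v0] := leP 0 (re z); first by rewrite le_max lexx orbT.
    by rewrite le_max sub0r oppr_le0 (ltW c0).
  have := ler_wpM2l r0 X1.
  have [v0|v0] := leP 0 (re z).
  - have := ler_wpM2r v0 mpr; rewrite ger0_norm//.
    by clear; lra.
  - have v0' : 0 <= - re z by rewrite oppr_ge0 ltW.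
    have := ler_wpM2r v0' ms; rewrite ltr0_norm//.
    by clear; lra.
rewrite ReM.
move: A1 A2 B1 B2 M3 M4 V; rewrite /K0.
move: (im p * im (softplus z)) (im r * im (softplus (z - c%:C))) => a1 a2.
move: (ln (cabs (1 + cexp z))) (ln (cabs (1 + cexp (z - c%:C)))) => l1 l2.
move: (ln (@kappa0 R)) (Mlog tau (re z)) (Mlog tau (re z - c)) => l3 o1 o2.
move: (Num.max 0 (re z)) (Num.max 0 (re z - c)) => v1 v2.
move: (pi) `|im p| `|im r| `|re z| => u1 u2 u3 u4.
move: (re p) (re r) (re s) (re z) (im s) (im z) => w1 w2 w3 w4 w5 w6.
clear; lra.
Qed.

End KernelOnStrips.

(** * The decay estimate for S *)

Section VerticalDecay.
Variable R : realType.
Implicit Types (x y t v m : R) (p r s z w h : R[i]).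
Local Notation mu := (@lebesgue_measure R).
Local Notation ci := (ci R).
Local Notation re := (@complex.Re R).
Local Notation im := (@complex.Im R).
Variable c : R.
Hypothesis c0 : 0 < c.
Local Notation kern := (kern c).
Local Notation S := (S c).

Lemma poisson_le (tau v : R) : 0 < tau -> 1 <= `|v| -> poisson tau v <= `|v|^-1.
Proof.
move=> t0 v1; have v0 : 0 < `|v| by exact: lt_le_trans v1.
rewrite lef_pV2 ?posrE ?ltr_wpDl ?sqr_ge0 ?exprn_gt0//.
rewrite -[v ^+ 2]real_normK ?num_real// ler_wpDr ?sqr_ge0// expr2.
by rewrite ler_peMl// ltW.
Qed.

Lemma poisson_lim (tau K : R) : 0 < tau -> 0 <= K -> forall e : R, 0 < e ->
  \forall n \near \oo,
    K * (poisson tau n%:R + poisson tau (n%:R - c)) < e /\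
    K * (poisson tau (- n%:R) + poisson tau (- n%:R - c)) < e.
Proof.
move=> t0 K0 e e0; near=> n.
have n1 : c + 1 + 2 * (K + 1) / e < n%:R.
  by near: n; exact: nbhs_infty_gtr.
have Ke : 0 < 2 * (K + 1) / e by rewrite divr_gt0// mulr_gt0// ltr_wpDl.
have key (u u' : R) : n%:R - c <= `|u| -> n%:R - c <= `|u'| ->
    K * (poisson tau u + poisson tau u') < e.
  have d0 : 0 < n%:R - c by move: n1 Ke; clear; lra.
  have P (w : R) : n%:R - c <= `|w| -> poisson tau w <= (n%:R - c)^-1.
    move=> nw; apply: le_trans (poisson_le t0 _) _.
      by move: nw n1 Ke; clear; lra.
    by rewrite lef_pV2// posrE// (lt_le_trans d0).
  move=> /P Pu /P Pu'.
  have H : K * (poisson tau u + poisson tau u') <= K * (2 * (n%:R - c)^-1).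
    by rewrite ler_wpM2l//; move: Pu Pu'; clear; lra.
  apply: le_lt_trans H _; rewrite mulrA ltr_pdivrMr//.
  have : 2 * (K + 1) / e < n%:R - c by move: n1; clear; lra.
  rewrite ltr_pdivrMr// (mulrC e); clear; lra.
have N : `|n%:R : R| = n%:R by rewrite ger0_norm.
split; apply: key; rewrite ?normrN ?N; first by rewrite gerBl ltW.
- exact: ler_norm.
- by rewrite gerBl ltW.
- by rewrite -opprD normrN (le_trans _ (ler_norm _))// lerD2l (le_trans _ (ltW c0))// oppr_le0 ltW.
Unshelve. all: by end_near. Qed.

(** With tau = 1 / x the new line is Im y = - (pi - 2 atan (1 / x)). There the exponential factor is
    at most e^2 e^(-pi x), because x atan (1 / x) <= 1. The power x^(k - 1) consists of x^(k - 2)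
    from [kern_strip] and of pi x, the integral of each Poisson kernel. *)
Lemma S_bound p r (k m : R) : 0 <= re p <= k -> 0 <= re r <= k -> 2 <= k -> 0 < m ->
  exists2 C : R, 0 <= C & forall x s, 1 <= x -> im s = - x ->
    m <= re s -> m <= re p + re r - re s ->
    cabs (S p r s) <= C * expR (- pi * x + (k - 1) * ln x).
Proof.
move=> pk rk k2 m0; have [C C0 HC] := kern_strip c0 pk rk k2 m0.
exists (2 * C * expR 2 * (2 * pi)); first by rewrite !mulr_ge0 ?expR_ge0 ?pi_ge0.
move=> x s x1 sx ms mpr.
have x0 : 0 < x by exact: lt_le_trans x1.
pose tau := x^-1; have t0 : 0 < tau by rewrite invr_gt0.
have t01 : 0 < tau <= 1 by rewrite t0 invf_le1.
have at0 : 0 < atan tau by rewrite -atan0 lt_atan.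
have atx : x * atan tau <= 1.
  by rewrite -ler_pdivlMl// mulr1; apply/atan_le/ltW.
have atp := atan_ltpi2 tau.
pose y0 := - (pi - 2 * atan tau).
have y0lo : - pi < y0 by rewrite /y0; move: at0; clear; move: (pi) (atan _) => u v; lra.
have y00 : y0 <= 0 by rewrite /y0; move: atp; clear; move: (pi) (atan _) => u v; lra.
pose K := C * expR (- (k - 2) * ln tau).
have K0 : 0 <= K by rewrite mulr_ge0 ?expR_ge0.
have xE : expR (ln x) = x by rewrite lnK.
have piE : pi / tau = pi * x by rewrite /tau invrK.
have E2 : expR (x * y0) <= expR 2 * expR (- pi * x).
  by rewrite -expRD ler_expR /y0; move: atx; clear; move: (pi) (atan _) => u v; lra.
have K2 : K = C * expR ((k - 2) * ln x).
  by rewrite /K /tau lnV ?posrE// mulrNN.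
have arith (b g1 g2 I e2 ep el q : R) : b * g1 * g2 * I <= b * g1 * g2 * (2 * q * el) ->
    g2 * (b * g1 * (2 * q * el)) <= e2 * ep * (b * g1 * (2 * q * el)) ->
    2 * (b * g1 * g2 * I) <= 2 * b * e2 * (2 * q) * (ep * (g1 * el)).
  by clear; lra.
have hol : holo_strip (kern p r s) (- pi) pi.
  by move=> z zpi; eexists; exact: cderiv_kern.
have [i1 l1] := poisson_integrable c t0; have [i0 l0] := poisson_integrable 0 t0.
have i0' : mu.-integrable setT (EFin \o poisson tau).
  by move: i0; under eq_fun do rewrite subr0.
have mT : measurable [set: R] by [].
have ig := integrableD_real mT i0' i1.
have bnd v y : y0 <= y <= 0 -> cabs (kern p r s (v%:C + ci * y%:C))
    <= K * expR (x * y) * (poisson tau v + poisson tau (v - c)).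
  move=> yy; have := HC tau s (v%:C + ci * y%:C) t01 ms mpr.
  rewrite Re_point Im_point sx opprK => /(_ yy) /le_trans; apply.
  by rewrite /K (mulrAC C).
have pos v : 0 <= poisson tau v + poisson tau (v - c).
  by rewrite addr_ge0 ?(ltW (poisson_gt0 _ t0)).
have := strip_shift (N := 0) hol y0lo y00 (pi_gt0 R) _ (integrableZ_real K mT ig)
  (poisson_lim t0 K0) _.
case.
- by move=> v; rewrite mulr_ge0.
- move=> v y _ yy; apply: le_trans (bnd _ _ yy) _.
  apply: ler_wpM2r; first exact: pos.
  rewrite ler_piMr// expR_le1 mulr_ge0_le0 ?(ltW x0)//; by case/andP: yy.
move=> j0 _ E.
have -> : S p r s = cintegral setT (fun v => kern p r s (v%:C + ci * y0%:C)).
  by rewrite E; apply: eq_cintegral => v _; rewrite mulr0 addr0.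
have ig2 := integrableZ_real (K * expR (x * y0)) mT ig.
apply: le_trans (cabs_cintegral mT j0 ig2 (fun v _ => bnd v y0 _)) _.
  by rewrite lexx.
have EZ := @RintegralZl _ _ _ mu setT (fun v => poisson tau v + poisson tau (v - c))
  (K * expR (x * y0)) mT ig.
have ED := @RintegralD _ _ _ mu setT (poisson tau) (fun v => poisson tau (v - c)) mT i0' i1.
rewrite EZ ED.
have -> : \int[mu]_v poisson tau v = \int[mu]_v poisson tau (v - 0).
  by apply: eq_Rintegral => v _; rewrite subr0.
have L : \int[mu]_v poisson tau (v - 0) + \int[mu]_v poisson tau (v - c) <= 2 * pi * expR (ln x).
  by rewrite xE; move: l0 l1; rewrite piE; clear; lra.
have H1 := ler_wpM2l (mulr_ge0 K0 (expR_ge0 (x * y0))) L.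
have H2 := ler_wpM2r (mulr_ge0 K0 (mulr_ge0 (mulr_ge0 (ler0n R 2) (pi_ge0 R)) (expR_ge0 (ln x)))) E2.
have -> : (k - 1) * ln x = (k - 2) * ln x + ln x by ring.
rewrite (expRD (- pi * x)) (expRD _ (ln x)); move: H1 H2; rewrite K2; exact: arith.
Qed.

End VerticalDecay.

(** * The Gamma function and the hypergeometric series *)

Section Correlation.
Variable R : realType.
Implicit Types (x y t : R) (u v : R -> R).
Local Notation mu := (@lebesgue_measure R).

Lemma ge0_integral_translation u d : continuous u -> (forall x, 0 <= u x) ->
  (\int[mu]_x (u (x + d))%:E = \int[mu]_x (u x)%:E)%E.
Proof.
move=> cu u0.
have d1 : ((fun x : R => x + d)^`() = cst 1)%classic.
  apply/funext => x; rewrite derive1E; have : is_derive x 1 (fun x : R => x + d) 1.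
    by apply: is_derive_eq; rewrite addr0.
  by case.
rewrite (@increasing_ge0_integration_by_substitutionT _ (fun x => x + d) u) //.
- by apply: eq_integral => x _; rewrite d1 /= mulr1.
- by move=> x y xy; rewrite ltrD2r.
- by rewrite d1; move=> x; exact: cvg_cst.
- by rewrite d1; exact: is_cvg_cst.
- by rewrite d1; exact: is_cvg_cst.
- by apply/cvgrNyPle => A; near=> x; rewrite -lerBrDr; near: x; apply: nbhs_ninfty_le; rewrite num_real.
- by apply/cvgryPge => A; near=> x; rewrite -lerBlDr; near: x; apply: nbhs_pinfty_ge; rewrite num_real.
Unshelve. all: by end_near. Qed.

Lemma continuous_normr_comp u : continuous u -> continuous (fun x => `|u x|).
Proof. by move=> cu x; apply: continuous_comp; [exact: cu|exact: norm_continuous]. Qed.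

Lemma continuous_translation u d : continuous u -> continuous (fun x => u (x + d)).
Proof.
move=> cu x; apply: continuous_comp; last exact: cu.
by apply: cvgD; [exact: cvg_id|exact: cvg_cst].
Qed.

(** The signed case follows from the nonnegative one applied to |u| and to u + |u|. *)
Lemma integrable_translation u d : continuous u -> mu.-integrable setT (EFin \o u) ->
  mu.-integrable setT (EFin \o (fun x => u (x + d))) /\
  \int[mu]_x u (x + d) = \int[mu]_x u x.
Proof.
move=> cu iu.
have ge0case v : continuous v -> (forall x, 0 <= v x) -> mu.-integrable setT (EFin \o v) ->
    mu.-integrable setT (EFin \o (fun x => v (x + d))) /\
    \int[mu]_x v (x + d) = \int[mu]_x v x.
  move=> cv v0 iv; split; last by rewrite /Rintegral ge0_integral_translation.
  apply/integrableP; split.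
    apply/measurable_EFinP; apply: continuous_measurable_fun.
    exact: continuous_translation cv.
  under eq_integral => x _ do rewrite /= ger0_norm//.
  rewrite ge0_integral_translation//; case/integrableP: iv => _; apply: le_lt_trans.
  by rewrite le_eqVlt; apply/orP; left; apply/eqP; apply: eq_integral => x _; rewrite /= ger0_norm.
have mT : measurable [set: R] by [].
have ia : mu.-integrable setT (EFin \o (fun x => `|u x|)) by exact: integrable_norm.
have [i1 e1] := ge0case _ (continuous_normr_comp cu) (fun x => normr_ge0 _) ia.
have is_ := integrableD_real mT iu ia.
have cs : continuous (fun x => u x + `|u x|).
  by move=> x; apply: cvgD; [exact: cu|exact: continuous_normr_comp].
have s0 x : 0 <= u x + `|u x| by rewrite -lerBlDl sub0r -normrN ler_norm.
have [i2 e2] := ge0case _ cs s0 is_.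
have iN : mu.-integrable setT (EFin \o (fun x => u (x + d))).
  apply: le_integrable_real i1 => //.
  by apply: continuous_measurable_fun; exact: continuous_translation.
split => //.
by have := e2; rewrite RintegralD// RintegralD// e1 => /addIr.
Qed.

(** Fubini for (y, q) -> u(q + y) v(q). Integrability of the inner function is asked at every y, so
    that the inner real integral is the finite value of the extended one everywhere and not only
    almost everywhere. *)
Lemma integral_correlation u v : continuous u -> continuous v ->
  mu.-integrable setT (EFin \o u) -> mu.-integrable setT (EFin \o v) ->
  (forall y, mu.-integrable setT (EFin \o (fun q => u (q + y) * v q))) ->
  mu.-integrable setT (EFin \o (fun y => \int[mu]_q (u (q + y) * v q))) /\
  \int[mu]_y (\int[mu]_q (u (q + y) * v q)) = (\int[mu]_x u x) * (\int[mu]_x v x).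
Proof.
move=> cu cv iu iv iin.
have mT : measurable [set: R] by [].
pose f (z : R * R) : \bar R := (u (z.2 + z.1) * v z.2)%:E.
have mf : measurable_fun setT f.
  apply/measurable_EFinP; apply: measurable_funM.
  - apply: (measurableT_comp (continuous_measurable_fun cu)).
    by apply: measurable_funD; [exact: measurable_snd|exact: measurable_fst].
  - by apply: (measurableT_comp (continuous_measurable_fun cv)); exact: measurable_snd.
have iu' q : mu.-integrable setT (EFin \o (fun y => u (q + y))).
  have [i _] := integrable_translation q cu iu.
  by move: i; under eq_fun do rewrite addrC.
have eu' q : \int[mu]_y u (q + y) = \int[mu]_y u y.
  have [_ <-] := integrable_translation q cu iu.
  by apply: eq_Rintegral => y _; rewrite addrC.
have ia : mu.-integrable setT (EFin \o (fun x => `|u x|)) by exact: integrable_norm.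
have imf : (mu \x mu)%E.-integrable setT f.
  apply/integrable21ltyP => //.
  have E q : (\int[mu]_y `|f (y, q)| = (`|v q| * \int[mu]_y `|u y|)%:E)%E.
    rewrite /f /=.
    have iq := integrableZ_real `|v q| mT (integrable_norm (iu' q)).
    under eq_integral => y _ do rewrite normrM mulrC.
    have fin := @integrable_fin_num _ _ _ mu setT _ _ iq.
    rewrite -[LHS]fineK; last exact: fin.
    congr EFin; rewrite -[LHS]/(\int[mu]_y (`|v q| * `|u (q + y)|)) RintegralZl//; last first.
      exact: (integrable_norm (iu' q)).
    congr (_ * _); have [_ <-] := integrable_translation q (continuous_normr_comp cu) ia.
    by apply: eq_Rintegral => y _; rewrite addrC.
  under eq_integral do rewrite E.
  have := integrableZ_real (\int[mu]_y `|u y|) mT (integrable_norm iv).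
  case/integrableP => _; apply: le_lt_trans; apply: ge0_le_integral => //=.
  - by move=> x _; rewrite lee_fin mulr_ge0// Rintegral_ge0.
  - apply/measurable_EFinP; apply: measurable_funM => //.
    by apply: continuous_measurable_fun; exact: continuous_normr_comp.
  - apply/measurable_EFinP; apply: measurableT_comp => //; apply: measurable_funM => //.
    by apply: continuous_measurable_fun; exact: continuous_normr_comp.
  - by move=> x _; rewrite lee_fin mulrC ler_norm.
have GE : fubini_F mu f = EFin \o (fun y => \int[mu]_q (u (q + y) * v q)).
  apply/funext => y; rewrite /fubini_F /= /Rintegral fineK//.
  by apply: integrable_fin_num => //; exact: iin.
split; first by rewrite -GE; exact: integrable_fubini_F.
have := Fubini imf; rewrite -/(fubini_F mu f) => F.
have F1 q : (\int[mu]_y f (y, q) = ((\int[mu]_x u x) * v q)%:E)%E.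
  rewrite /f /=.
  have iq : mu.-integrable setT (EFin \o (fun y => u (q + y) * v q)).
    by have := integrableZ_real (v q) mT (iu' q); under eq_fun do rewrite mulrC.
  have fin := @integrable_fin_num _ _ _ mu setT _ _ iq.
  rewrite -[LHS]fineK; last exact: fin.
  congr EFin; rewrite -[LHS]/(\int[mu]_y (u (q + y) * v q)).
  by rewrite (@RintegralZr _ _ _ mu setT _ _ mT (iu' q)) eu'.
have : fine (\int[mu]_q (\int[mu]_y f (y, q)))%E
     = fine (\int[mu]_y (\int[mu]_q f (y, q)))%E by rewrite F.
under eq_integral do rewrite F1.
rewrite -[LHS]/(\int[mu]_q ((\int[mu]_x u x) * v q)) RintegralZl// => ->.
by rewrite /Rintegral; congr fine; apply: eq_integral => y _; rewrite -[RHS]/(fubini_F mu f y) GE.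
Qed.

End Correlation.

(** * The substitution y = ln x on the half-line *)

Section LogSubstitution.
Variable R : realType.
Implicit Types (x y t : R) (u v : R -> R).
Local Notation mu := (@lebesgue_measure R).

Definition mseg (n : nat) : set R := `[expR (- n%:R), expR n%:R].

Lemma mseg_nondecreasing : nondecreasing_seq mseg.
Proof.
move=> m n mn; rewrite subsetEset => x; rewrite /mseg /= !in_itv /= => /andP[xm mx].
have mn' : (m%:R : R) <= n%:R by rewrite ler_nat.
apply/andP; split; first by apply: le_trans xm; rewrite ler_expR lerN2.
by apply: le_trans mx _; rewrite ler_expR.
Qed.

Lemma bigcup_mseg : \bigcup_n mseg n = `]0, +oo[%classic.
Proof.
apply/seteqP; split => x.
  move=> [n _]; rewrite /mseg /= !in_itv /= andbT => /andP[+ _].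
  exact/lt_le_trans/expR_gt0.
rewrite /= in_itv /= andbT => x0; have [n _ Hn] : (\bigcup_n @seg R n) (ln x) by rewrite bigcup_seg.
exists n => //; move: Hn; rewrite /mseg /seg /= !in_itv /= => /andP[a b].
by rewrite -(lnK x0) !ler_expR a b.
Qed.

Definition logform u x : R := u (ln x) / x.

Lemma logform_continuous u x : continuous u -> 0 < x -> {for x, continuous (logform u)}.
Proof.
move=> cu x0; apply: cvgM; last by apply: cvgV; [rewrite gt_eqF|exact: cvg_id].
by apply: continuous_comp; [exact: continuous_ln|exact: cu].
Qed.

Lemma integral_logform_mseg u n : continuous u ->
  (\int[mu]_(x in mseg n) (logform u x)%:E = \int[mu]_(y in @seg R n) (u y)%:E)%E.
Proof.
move=> cu; have nn : - n%:R <= n%:R :> R by rewrite (@le_trans _ _ 0)// oppr_le0.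
have dE : ((@expR R)^`() = @expR R)%classic.
  by apply/funext => y; rewrite derive1E; have [_ ->] := is_derive_expR y.
rewrite /mseg (integration_by_substitution_increasing nn).
- apply: eq_integral => y _; rewrite dE; congr EFin.
  by rewrite -[LHS]/(u (ln (expR y)) / expR y * expR y) expRK divfK// gt_eqF// expR_gt0.
- by move=> x y _ _; rewrite ltr_expR.
- by rewrite dE => y _; exact: continuous_expR.
- by rewrite dE; apply/cvg_ex; eexists; apply: cvg_at_right_filter; exact: continuous_expR.
- by rewrite dE; apply/cvg_ex; eexists; apply: cvg_at_left_filter; exact: continuous_expR.
- split; first by move=> y _; exact: derivable_expR.
  + by apply: cvg_at_right_filter; exact: continuous_expR.
  + by apply: cvg_at_left_filter; exact: continuous_expR.
- apply: continuous_in_subspaceT => y; rewrite inE /= in_itv /= => /andP[y0 _].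
  by apply: logform_continuous => //; exact: lt_le_trans (expR_gt0 _) y0.
Qed.

Lemma measurable_logform u : continuous u ->
  measurable_fun (`]0, +oo[%classic : set R) (logform u).
Proof.
move=> cu; apply: open_continuous_measurable_fun => // x.
by rewrite inE /= in_itv /= andbT; exact: logform_continuous.
Qed.

(** The substitution is made on the segments [mseg], the images of [-n, n] under the exponential.
    Integrability on the half-line follows from |u| by monotone convergence, the value by
    exhaustion. *)
Lemma integral_logform u : continuous u -> mu.-integrable setT (EFin \o u) ->
  mu.-integrable `]0, +oo[ (EFin \o logform u) /\
  \int[mu]_(x in `]0, +oo[) logform u x = \int[mu]_y u y.
Proof.
move=> cu iu.
have mD : measurable (`]0, +oo[%classic : set R) by exact: measurable_itv.
have mE n : measurable (mseg n) by exact: measurable_itv.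
have mf := measurable_logform cu.
have iG : mu.-integrable `]0, +oo[ (EFin \o logform u).
  pose a (y : R) : R := `|u y|.
  have ca : continuous a by exact: continuous_normr_comp.
  have ia : mu.-integrable setT (EFin \o a) by exact: integrable_norm.
  have ma := measurable_logform ca.
  have H : (\int[mu]_(x in mseg n) (logform a x)%:E @[n --> \oo]
      --> \int[mu]_(x in \bigcup_n mseg n) (logform a x)%:E)%E.
    apply: ge0_nondecreasing_set_cvg_integral => //.
    - exact: mseg_nondecreasing.
    - move=> n; apply/measurable_EFinP; apply: measurable_funS ma => //.
      by rewrite -bigcup_mseg; exact: bigcup_sup.
    - move=> n x; rewrite /mseg /= in_itv /= => /andP[x0 _].
      by rewrite lee_fin divr_ge0 ?normr_ge0// ltW// (lt_le_trans _ x0)// expR_gt0.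
  rewrite bigcup_mseg in H.
  apply/integrableP; split; first exact/measurable_EFinP.
  apply: (@le_lt_trans _ _ (\int[mu]_y (a y)%:E)%E); last first.
    case/integrableP: ia => _; apply: le_lt_trans.
    by apply: ge0_le_integral => //=; [move=> x _; rewrite lee_fin normr_ge0|
      apply/measurable_EFinP; exact: continuous_measurable_fun|
      apply/measurable_EFinP; apply: measurableT_comp => //; exact: continuous_measurable_fun|
      move=> x _; rewrite lee_fin ler_norm].
  have -> : (\int[mu]_(x in `]0%R, +oo[) `|(EFin \o logform u) x|
      = \int[mu]_(x in `]0%R, +oo[) (logform a x)%:E)%E.
    apply: eq_integral => x; rewrite inE /= in_itv /= andbT => x0.
    by rewrite /logform normrM normfV (gtr0_norm x0).
  apply: (cvge_le _ H); apply: nearW => n; rewrite integral_logform_mseg//.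
  apply: ge0_subset_integral => //.
  - exact: measurable_itv.
  - by apply/measurable_EFinP; exact: continuous_measurable_fun.
  - by move=> x _; rewrite lee_fin /a normr_ge0.
split => //.
have L1 := cvg_Rintegral_exhaustion mD mE mseg_nondecreasing bigcup_mseg iG.
have L2 := cvg_Rintegral_seg iu.
have E : (fun n => \int[mu]_(x in mseg n) logform u x) = (fun n => \int[mu]_(x in @seg R n) u x).
  by apply/funext => n; rewrite /Rintegral integral_logform_mseg.
rewrite E in L1; exact: (cvg_unique _ L1 L2).
Qed.

End LogSubstitution.

(** * The squared modulus of Gamma as a beta integral *)

Section GammaBeta.
Variable R : realType.
Implicit Types (x y t : R) (u v : R -> R).
Local Notation mu := (@lebesgue_measure R).
Variable a : R.
Hypothesis a0 : 0 < a.

(** Euler's integrand for Gamma(b) after x = e^y. *)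
Definition gumbel (b y : R) : R := expR (b * y - expR y).

Lemma gumbel_continuous (b : R) : continuous (gumbel b).
Proof.
move=> y; apply: continuous_comp; last exact: continuous_expR.
by apply: cvgB; [apply: cvgM; [exact: cvg_cst|exact: cvg_id]|exact: continuous_expR].
Qed.

(** For y >= 0, e^y >= (1 + y / 2)^2, and completing the square in b y - y^2 / 4 leads to the
    constant (b + 1)^2. *)
Lemma gumbel_le (b y : R) : 0 < b ->
  gumbel b y <= expR ((b + 1) ^+ 2) * expR (- Num.min b 1 * `|y|).
Proof.
move=> b0; rewrite -expRD ler_expR.
have [y0|y0] := leP 0 y.
- rewrite ger0_norm//.
  have H : 1 + y / 2 <= expR (y / 2) by exact: expR_ge1Dx.
  have E : expR y = expR (y / 2) ^+ 2 by rewrite -expRM_natl; congr expR; field.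
  have H2 : (1 + y / 2) ^+ 2 <= expR y.
    by rewrite E ler_sqr ?nnegrE ?expR_ge0// addr_ge0// divr_ge0.
  have M : - y <= - Num.min b 1 * y.
    by rewrite mulNr lerN2 ler_piMl// ge_min lexx orbT.
  have := sqr_ge0 (y / 2 - (b + 1)).
  by move: H2 M b0 y0; clear; move: (Num.min _ _ ) (expR y) => m e; lra.
- rewrite ltr0_norm//.
  have M : - Num.min b 1 * - y >= b * y.
    rewrite mulrNN -subr_ge0 -mulrBl mulr_le0//; last exact: ltW.
    by rewrite subr_le0 ge_min lexx.
  have := sqr_ge0 (b + 1); have := expR_ge0 y; move: M; clear.
  by move: (_ * - _) (expR y) => m e; lra.
Qed.

Lemma gumbel_integrable (b : R) : 0 < b -> mu.-integrable setT (EFin \o gumbel b).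
Proof.
move=> b0; have m0 : 0 < Num.min b 1 by rewrite lt_min b0 ltr01.
have mT : measurable [set: R] by [].
apply: le_integrable_real (integrableZ_real (expR ((b + 1) ^+ 2)) mT (integrable_expR_abs m0)) => //.
  by apply: continuous_measurable_fun; exact: gumbel_continuous.
by move=> y _; rewrite ger0_norm ?expR_ge0// gumbel_le.
Qed.

Lemma gumbel_bounded_integrable (b : R) u : 0 < b -> continuous u -> (forall y, `|u y| <= 1) ->
  continuous (fun y => gumbel b y * u y) /\
  mu.-integrable setT (EFin \o (fun y => gumbel b y * u y)).
Proof.
move=> b0 cu u1.
have cgu : continuous (fun y => gumbel b y * u y).
  by move=> y; apply: cvgM; [exact: gumbel_continuous|exact: cu].
split => //; apply: le_integrable_real (gumbel_integrable b0) => //.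
  exact: continuous_measurable_fun.
by move=> y _; rewrite normrM ger0_norm ?expR_ge0// ler_piMr ?expR_ge0.
Qed.

Lemma cos_lin_continuous t : continuous (fun y : R => cos (t * y)).
Proof.
move=> y; apply: continuous_comp; last exact: continuous_cos.
by apply: cvgM; [exact: cvg_cst|exact: cvg_id].
Qed.

Lemma sin_lin_continuous t : continuous (fun y : R => sin (t * y)).
Proof.
move=> y; apply: continuous_comp; last exact: continuous_sin.
by apply: cvgM; [exact: cvg_cst|exact: cvg_id].
Qed.

Lemma cGammaE t : cGamma (a +i* t)
  = (\int[mu]_y (gumbel a y * cos (t * y))) +i* (\int[mu]_y (gumbel a y * sin (t * y))).
Proof.
have [c1 i1] := gumbel_bounded_integrable a0 (@cos_lin_continuous t) (fun y => cos_max _).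
have [c2 i2] := gumbel_bounded_integrable a0 (@sin_lin_continuous t) (fun y => sin_max _).
have [_ <-] := integral_logform c1 i1; have [_ <-] := integral_logform c2 i2.
have key x : `]0, +oo[%classic x ->
    cexp ((a +i* t - 1) * (ln x)%:C) * (expR (- x))%:C
    = logform (fun y => gumbel a y * cos (t * y)) x +i* logform (fun y => gumbel a y * sin (t * y)) x.
  rewrite /= in_itv /= andbT => x0; rewrite /logform /gumbel lnK//.
  have -> : a * ln x - x = (a - 1) * ln x - x + ln x by ring.
  rewrite (expRD _ (ln x)) lnK// (expRD _ (- x)).
  have e1 : complex.Re ((a +i* t - 1) * (ln x)%:C) = (a - 1) * ln x by rewrite ReM /=; ring.
  have e2 : complex.Im ((a +i* t - 1) * (ln x)%:C) = t * ln x by rewrite ImM /=; ring.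
  by apply: complexP; rewrite mulrC ?ReMl ?ImMl ?Re_cexp ?Im_cexp e1 e2 /=; field; rewrite gt_eqF.
by rewrite /cGamma /cintegral; congr Complex; apply: eq_Rintegral => x /set_mem /key ->.
Qed.

Definition logistic_density y : R := expR (a * y - 2 * a * ln (1 + expR y)).

(** Because e^(q + y) + e^q = e^(q + ln (1 + e^y)). This is the factorisation behind Gamma(z)
    Gamma(w) = Gamma(z + w) B(z, w). *)
Lemma gumbel_correlation q y :
  gumbel a (q + y) * gumbel a q
  = logistic_density y * gumbel (2 * a) (q + ln (1 + expR y)).
Proof.
have p0 : 0 < 1 + expR y by rewrite ltr_pwDl// expR_ge0.
rewrite /gumbel /logistic_density -!expRD; congr expR.
by rewrite !expRD lnK//; ring.
Qed.

Lemma gumbel_autocorrelation y :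
  mu.-integrable setT (EFin \o (fun q => gumbel a (q + y) * gumbel a q)) /\
  \int[mu]_q (gumbel a (q + y) * gumbel a q)
    = logistic_density y * \int[mu]_q gumbel (2 * a) q.
Proof.
have a2 : 0 < 2 * a by rewrite mulr_gt0.
have mT : measurable [set: R] by [].
have [i1 e1] := integrable_translation (ln (1 + expR y)) (@gumbel_continuous (2 * a))
  (gumbel_integrable a2).
rewrite (_ : (fun q => gumbel a (q + y) * gumbel a q)
    = (fun q => logistic_density y * gumbel (2 * a) (q + ln (1 + expR y)))).
  split; first exact: (integrableZ_real _ mT i1).
  by rewrite RintegralZl ?e1.
by apply/funext => q; exact: gumbel_correlation.
Qed.

Lemma gumbel_autocorrelation_bounded y v : continuous v -> (forall q, `|v q| <= 1) ->
  mu.-integrable setT (EFin \o (fun q => gumbel a (q + y) * gumbel a q * v q)).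
Proof.
move=> cv v1; have [i _] := gumbel_autocorrelation y.
apply: le_integrable_real i => //.
  apply: continuous_measurable_fun => q; apply: cvgM; last exact: cv.
  apply: cvgM; last exact: gumbel_continuous.
  exact: (@continuous_translation _ (gumbel a) y (@gumbel_continuous a) q).
move=> q _; rewrite normrM ger0_norm ?mulr_ge0 ?expR_ge0//.
by rewrite ler_piMr// mulr_ge0 ?expR_ge0.
Qed.

(** Gamma(a + i t) is a Fourier transform of the Gumbel function, so its squared modulus is that of
    the autocorrelation, which factors into Gamma(2 a) and a beta integrand. It is applied with c =
    2 phi in the kernel and with c = 1 for the weight alone. *)
Lemma sqr_cabs_cGamma c t : 0 < c ->
  (cabs (cGamma (a +i* t)) ^+ 2)%:C
  = (\int[mu]_q gumbel (2 * a) q)%:C * S c (2 * a)%:C 0 (a -i* t).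
Proof.
move=> c0; set G0 := \int[mu]_q gumbel (2 * a) q.
have mT : measurable [set: R] by [].
pose uc y := gumbel a y * cos (t * y); pose us y := gumbel a y * sin (t * y).
have [cc ic] : continuous uc /\ mu.-integrable setT (EFin \o uc).
  exact: (gumbel_bounded_integrable a0 (@cos_lin_continuous t) (fun y => cos_max _)).
have [cs is_] : continuous us /\ mu.-integrable setT (EFin \o us).
  exact: (gumbel_bounded_integrable a0 (@sin_lin_continuous t) (fun y => sin_max _)).
have trig (f g : R -> R) : continuous f -> continuous g ->
    (forall y, `|f y| <= 1) -> (forall y, `|g y| <= 1) -> forall y,
    mu.-integrable setT (EFin \o (fun q => gumbel a (q + y) * f (t * (q + y)) * (gumbel a q * g (t * q)))).
  move=> cf cg f1 g1 y.
  have := @gumbel_autocorrelation_bounded y (fun q => f (t * (q + y)) * g (t * q)).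
  rewrite (_ : (fun q => gumbel a (q + y) * gumbel a q * _)
     = (fun q => gumbel a (q + y) * f (t * (q + y)) * (gumbel a q * g (t * q)))); last first.
    by apply/funext => q; ring.
  apply.
  - move=> q; apply: cvgM.
      apply: continuous_comp; last exact: cf.
      by apply: cvgM; [exact: cvg_cst|apply: cvgD; [exact: cvg_id|exact: cvg_cst]].
    apply: continuous_comp; last exact: cg.
    by apply: cvgM; [exact: cvg_cst|exact: cvg_id].
  - by move=> q; rewrite normrM mulr_ile1.
have kcc := trig _ _ (@continuous_cos R) (@continuous_cos R) (@cos_max R) (@cos_max R).
have kss := trig _ _ (@continuous_sin R) (@continuous_sin R) (@sin_max R) (@sin_max R).
have ksc := trig _ _ (@continuous_sin R) (@continuous_cos R) (@sin_max R) (@cos_max R).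
have kcs := trig _ _ (@continuous_cos R) (@continuous_sin R) (@cos_max R) (@sin_max R).
have [icc ecc] := integral_correlation cc cc ic ic kcc.
have [iss ess] := integral_correlation cs cs is_ is_ kss.
have [isc esc] := integral_correlation cs cc is_ ic ksc.
have [ics ecs] := integral_correlation cc cs ic is_ kcs.
(* The addition formulas recombine the four real correlations into the transform of the
   autocorrelation. *)
have Ecos y : \int[mu]_q (uc (q + y) * uc q) + \int[mu]_q (us (q + y) * us q)
    = G0 * (logistic_density y * cos (t * y)).
  rewrite -RintegralD//; [|exact: kcc|exact: kss].
  have [ig eg] := gumbel_autocorrelation y.
  rewrite mulrA (mulrC G0) -/G0 -eg -RintegralZr//; apply: eq_Rintegral => q _.
  have -> : cos (t * y) = cos (t * (q + y) - t * q) by congr cos; ring.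
  by rewrite cosB /uc /us; ring.
have Esin y : \int[mu]_q (us (q + y) * uc q) - \int[mu]_q (uc (q + y) * us q)
    = G0 * (logistic_density y * sin (t * y)).
  rewrite -RintegralB//; [|exact: ksc|exact: kcs].
  have [ig eg] := gumbel_autocorrelation y.
  rewrite mulrA (mulrC G0) -/G0 -eg -RintegralZr//; apply: eq_Rintegral => q _.
  have -> : sin (t * y) = sin (t * (q + y) - t * q) by congr sin; ring.
  by rewrite sinB /uc /us; ring.
have kE y : kern c (2 * a)%:C 0 (a -i* t) y%:C
    = logistic_density y * cos (t * y) +i* - (logistic_density y * sin (t * y)).
  rewrite /kern softplus_real mul0r subr0 (mulrC (a -i* t)) -rmorphM.
  have e1 : complex.Re (y%:C * (a -i* t) - (2 * a * ln (1 + expR y))%:C)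
     = a * y - 2 * a * ln (1 + expR y) by rewrite ReD ReN ReMl /=; ring.
  have e2 : complex.Im (y%:C * (a -i* t) - (2 * a * ln (1 + expR y))%:C)
     = - (t * y) by rewrite ImD ImN ImMl /=; ring.
  by apply: complexP; rewrite ?Re_cexp ?Im_cexp e1 e2 ?cosN ?sinN ?mulrN.
have adm : admissible (2 * a)%:C 0 (a -i* t).
  by split; rewrite /=; move: a0; clear; lra.
have [ir ii] := cintegrable_kern c0 adm.
have {}ir : mu.-integrable setT (EFin \o (fun y => logistic_density y * cos (t * y))).
  by move: ir; under eq_fun do rewrite kE.
have {}ii : mu.-integrable setT (EFin \o (fun y => - (logistic_density y * sin (t * y)))).
  by move: ii; under eq_fun do rewrite kE.
have ii' : mu.-integrable setT (EFin \o (fun y => logistic_density y * sin (t * y))).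
  by have := integrableZ_real (-1) mT ii; under eq_fun do rewrite mulN1r opprK.
have SE : S c (2 * a)%:C 0 (a -i* t) = (\int[mu]_y (logistic_density y * cos (t * y)))
    +i* (\int[mu]_y (- (logistic_density y * sin (t * y)))).
  by rewrite /S /cintegral; congr Complex; apply: eq_Rintegral => y _; rewrite kE.
rewrite SE sqr_cabs cGammaE /=.
apply: complexP; rewrite ?ReMl ?ImMl /=.
- rewrite -RintegralZl//.
  under eq_Rintegral => y _ do rewrite -Ecos.
  by rewrite RintegralD// ecc ess !expr2.
- have -> : \int[mu]_y - (logistic_density y * sin (t * y))
     = - \int[mu]_y (logistic_density y * sin (t * y)).
    rewrite -mulN1r -RintegralZl//; apply: eq_Rintegral => y _; by rewrite mulN1r.
  rewrite mulrN -RintegralZl//; under eq_Rintegral => y _ do rewrite -Esin.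
  by rewrite RintegralB// esc ecs mulrC subrr oppr0.
Qed.

End GammaBeta.

(** * The binomial series with remainder *)

Section BinomialSeries.
Variable R : realType.
Implicit Types (x y t : R) (z w : R[i]).

Lemma cderivX f z d n : cderiv f z d ->
  @cderiv R (fun w => f w ^+ n) z (n%:R * f z ^+ n.-1 * d).
Proof.
move=> df; elim: n => [|n IH].
  by apply: cderiv_eq (cderiv_cst 1 z) => [w|]; rewrite ?expr0// mulr0n !mul0r.
apply: cderiv_eq (cderivM df IH) => [w|]; first by rewrite exprS.
case: n {IH} => [|n] /=; first by rewrite mulr0n expr0; ring.
by rewrite exprS -[in RHS]natr1; ring.
Qed.

Lemma natC n : n%:R = (n%:R)%:C :> R[i].
Proof. by rewrite rmorph_nat. Qed.

Lemma cabs_nat n : cabs (n%:R : R[i]) = n%:R.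
Proof. by rewrite natC cabs_real ger0_norm. Qed.

Lemma pochhammerS (a : R[i]) n : pochhammer a n.+1 = pochhammer a n * (a + n%:R).
Proof. by rewrite /pochhammer big_ord_recr. Qed.

(** The coefficients of the power series of (1 - x)^(-a). *)
Definition bcoef (a : R[i]) n : R[i] := pochhammer a n / n`!%:R.

Lemma factC_neq0 n : (n`!%:R : R[i]) != 0.
Proof. by rewrite pnatr_eq0 -lt0n fact_gt0. Qed.

Lemma bcoefS (a : R[i]) n : n.+1%:R * bcoef a n.+1 = (a + n%:R) * bcoef a n.
Proof.
rewrite /bcoef pochhammerS factS natrM.
have : n.+1%:R != 0 :> R[i] by rewrite pnatr_eq0.
move: (factC_neq0 n); move: (n`!%:R) (n.+1%:R) => f u f0 u0.
by field; rewrite f0 u0.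
Qed.

Definition bpoly (a : R[i]) N z : R[i] := \sum_(n < N) bcoef a n * z ^+ n.

(* With [x = 1 - e^-z], the derivative of [(1 - x)^a * bpoly a N x] telescopes to
   its last term. *)
Lemma cderiv_bpoly (a : R[i]) N z :
  cderiv (fun w => cexp (- a * w) * bpoly a N (1 - cexp (- w))) z
    (- (cexp (- a * z) * (N%:R * bcoef a N * (1 - cexp (- z)) ^+ N.-1))).
Proof.
have dN : cderiv (fun w => - w) z (- 1) by exact: cderivN (cderiv_id z).
have de : cderiv (fun w => cexp (- w)) z (cexp (- z) * - 1).
  exact: (@cderiv_comp R (@cexp R) (fun w => - w) z _ _ dN (cderiv_cexp _)).
have dx : cderiv (fun w => 1 - cexp (- w)) z (0 - cexp (- z) * - 1).
  by apply: cderivB => //; exact: cderiv_cst.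
have da : cderiv (fun w => cexp (- a * w)) z (cexp (- a * z) * (- a * 1)).
  apply: (@cderiv_comp R (@cexp R) (fun w => - a * w)); last exact: cderiv_cexp.
  by apply: cderivZ; exact: cderiv_id.
elim: N => [|N IH].
  apply: cderiv_eq (cderiv_cst 0 z) => [w|]; first by rewrite /bpoly big_ord0 mulr0.
  by rewrite !mul0r mulr0 oppr0.
have dt := cderivM da (cderivZ (bcoef a N) (cderivX N dx)).
apply: cderiv_eq (cderivD IH dt) => [w|].
  by rewrite /bpoly big_ord_recr /= mulrDr.
rewrite bcoefS /=; set E := cexp (- a * z); set x := 1 - cexp (- z).
have -> : cexp (- z) = 1 - x by rewrite /x; ring.
case: N {IH dt} => [|N] /=; first by rewrite !expr0; ring.
by rewrite !exprS; ring.
Qed.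

(** With x = 1 - e^(-tau) the sum (1 - x)^(-a) of the series is cexp (a tau). The mean value
    inequality on [0, tau] gives a bound uniform in tau <= c, hence uniform in the variable of
    integration when the series is integrated. *)
Lemma bpoly_remainder (a : R[i]) N (c tau : R) : 0 <= complex.Re a -> 0 <= tau <= c ->
  cabs (bpoly a N.+1 (1 - expR (- tau))%:C - cexp (a * tau%:C))
  <= expR (complex.Re a * c) * (2 * c) *
     (cabs (N.+1%:R * bcoef a N.+1) * (1 - expR (- c)) ^+ N).
Proof.
move=> ra /andP[t0 tc].
pose D w := cexp (- a * w) * bpoly a N.+1 (1 - cexp (- w)).
have key := @curve_increment R (fun u => D (u%:C + 0))
  (fun u => - (cexp (- a * u%:C) * (N.+1%:R * bcoef a N.+1 * (1 - cexp (- u%:C)) ^+ N)))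
  (cabs (N.+1%:R * bcoef a N.+1) * (1 - expR (- c)) ^+ N) _ _ tau t0 _.
have x1 (u : R) : 1 - cexp (- u%:C) = (1 - expR (- u))%:C.
  by rewrite -rmorphN cexp_real rmorphB rmorph1.
have D0 : D (0%:C + 0) = 1.
  rewrite /D addr0 x1 oppr0 expR0 subrr mulr0 cexp0 mul1r /bpoly big_ord_recl /= expr0 mulr1.
  rewrite big1 ?addr0; last by move=> i _; rewrite /= expr0n /= mulr0.
  by rewrite /bcoef /pochhammer big_ord0 divr1.
have Dt : D (tau%:C + 0) = cexp (- a * tau%:C) * bpoly a N.+1 (1 - expR (- tau))%:C.
  by rewrite /D addr0 x1.
have -> : bpoly a N.+1 (1 - expR (- tau))%:C - cexp (a * tau%:C)
   = cexp (a * tau%:C) * (D (tau%:C + 0) - D (0%:C + 0)).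
  by rewrite D0 Dt mulrBr mulr1 mulrA -cexpD mulNr subrr cexp0 mul1r.
rewrite cabsM cabs_cexp (mulrC a) ReMl -mulrA.
apply: ler_pM; rewrite ?expR_ge0 ?cabs_ge0//.
  by rewrite ler_expR mulrC ler_wpM2l.
have z0 : 0 <= 1 - expR (- c).
  by rewrite subr_ge0 expR_le1 oppr_le0 (le_trans t0).
have B0 : 0 <= cabs (N.+1%:R * bcoef a N.+1) * (1 - expR (- c)) ^+ N.
  by rewrite mulr_ge0 ?cabs_ge0 ?exprn_ge0.
apply: le_trans (key _ _ _) _.
- by move=> u; have := cderiv_bpoly a N.+1 (u%:C + 0) => /cderiv_is_derive[]; rewrite addr0.
- by move=> u; have := cderiv_bpoly a N.+1 (u%:C + 0) => /cderiv_is_derive[_]; rewrite addr0.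
- move=> u /andP[u0 ut]; rewrite cabsN cabsM cabs_cexp x1 -rmorphXn cabsM cabs_real.
  have e1 : expR (complex.Re (- a * u%:C)) <= 1.
    by rewrite expR_le1 mulrC ReMl ReN mulrN oppr_le0 mulr_ge0.
  have x0 : 0 <= 1 - expR (- u) by rewrite subr_ge0 expR_le1 oppr_le0.
  rewrite -[leRHS]mul1r; apply: ler_pM => //; first by rewrite mulr_ge0 ?cabs_ge0.
  apply: ler_wpM2l; first exact: cabs_ge0.
  rewrite ger0_norm ?exprn_ge0// lerXn2r ?nnegrE//.
  by rewrite lerD2l lerN2 ler_expR lerN2 (le_trans ut).
- by rewrite mulrAC ler_wpM2r// ler_wpM2l.
Qed.

Lemma ratio_test (v : nat -> R) (rho : R) (n0 : nat) : 0 <= rho < 1 ->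
  (forall n, 0 <= v n) -> (forall n, (n0 <= n)%N -> v n.+1 <= rho * v n) ->
  v n @[n --> \oo] --> (0 : R).
Proof.
move=> /andP[r0 r1] v0 H.
have geo n : v (n + n0)%N <= v n0 * rho ^+ n.
  elim: n => [|n IH]; first by rewrite expr0 mulr1.
  rewrite addSn (le_trans (H _ _)) ?leq_addl// exprS mulrCA.
  by rewrite ler_wpM2l.
rewrite -(cvg_shiftn n0).
have glim : v n0 * rho ^+ n @[n --> \oo] --> (0 : R).
  rewrite -[X in _ --> X](mulr0 (v n0)); apply: cvgM; first exact: cvg_cst.
  by apply: cvg_expr; rewrite ger0_norm.
apply: squeeze_cvgr (cvg_cst 0) glim.
by apply: nearW => n; rewrite v0 /= geo.
Qed.

Lemma bcoef_lim (a : R[i]) (x : R) : 0 <= x < 1 ->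
  (cabs (n.+1%:R * bcoef a n.+1) * x ^+ n) @[n --> \oo] --> (0 : R).
Proof.
move=> /andP[x0 x1].
(* Beyond [n0], |a| <= n (1 - x) / 2, so (|a| + n) x / n is at most (1 + x) / 2 < 1. *)
pose n0 := Num.bound (2 * cabs a / (1 - x)).
have d0 : 0 < 1 - x by rewrite subr_gt0.
apply: (@ratio_test _ ((1 + x) / 2) n0).
- by apply/andP; split; move: x0 x1; clear; lra.
- by move=> n; rewrite mulr_ge0 ?cabs_ge0 ?exprn_ge0.
- move=> n nn0; rewrite bcoefS cabsM exprS.
  have n1 : 0 < n.+1%:R :> R by [].
  have -> : cabs (bcoef a n.+1) = cabs (n.+1%:R * bcoef a n.+1) / n.+1%:R.
    by rewrite cabsM cabs_nat mulrAC mulfV ?mul1r// gt_eqF.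
  have cn : cabs (a + n.+1%:R) <= cabs a + n.+1%:R.
    by apply: le_trans (cabsD _ _) _; rewrite cabs_nat.
  have H : (cabs a + n.+1%:R) * x <= (1 + x) / 2 * n.+1%:R.
    have : 2 * cabs a / (1 - x) < n.+1%:R.
      apply: (lt_le_trans (archi_boundP _)).
        by rewrite divr_ge0 ?mulr_ge0 ?cabs_ge0 ?(ltW d0).
      by rewrite ler_nat (leq_trans nn0).
    rewrite ltr_pdivrMr//; have := mulr_ge0 (cabs_ge0 a) (ltW d0).
    by move: (cabs a) (n.+1%:R) => u m; clear; lra.
  have p0 : 0 <= cabs (n.+1%:R * bcoef a n.+1) * x ^+ n.
    by rewrite mulr_ge0 ?cabs_ge0 ?exprn_ge0.
  have {}H : cabs (a + n.+1%:R) * x <= (1 + x) / 2 * n.+1%:R.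
    by apply: le_trans H; rewrite ler_wpM2r.
  move: p0; set m := cabs (_ * _) => p0.
  rewrite [leLHS](_ : _ = cabs (a + n.+1%:R) * x * (m * x ^+ n) / n.+1%:R); last first.
    by field; rewrite gt_eqF.
  rewrite ler_pdivrMr// [leRHS](_ : _ = (1 + x) / 2 * n.+1%:R * (m * x ^+ n)); last by ring.
  exact: ler_wpM2r.
Qed.

End BinomialSeries.

(** * The Gauss series as a ratio of integrals S *)

Section GaussSeries.
Variable R : realType.
Implicit Types (x y t : R) (z w : R[i]).
Local Notation re := (@complex.Re R).
Variable c : R.
Hypothesis c0 : 0 < c.

Definition logistic y : R := expR (y - ln (1 + expR y)).

Lemma kern_logistic (p s : R[i]) n y :
  kern c p 0 s y%:C * (logistic y)%:C ^+ n = kern c (p + n%:R) 0 (s + n%:R) y%:C.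
Proof.
elim: n => [|n IH]; first by rewrite !addr0 mulr1.
rewrite exprSr mulrA IH /logistic -cexp_real rmorphB /= -softplus_real kernS1.
by rewrite -!natr1 !addrA.
Qed.

(** (1 + e^(y - c)) / (1 + e^y) = 1 - (1 - e^(-c)) e^y / (1 + e^y). This makes the binomial series
    in x = 1 - e^(-tau) one in powers of the logistic function, and the kernel is stable under
    multiplication by these. *)
Lemma logistic_tau y (tau := ln (1 + expR y) - ln (1 + expR (y - c))) :
  0 <= tau <= c /\ (1 - expR (- c)) * logistic y = 1 - expR (- tau).
Proof.
have p1 : 0 < 1 + expR y by rewrite ltr_pwDl// expR_ge0.
have p2 : 0 < 1 + expR (y - c) by rewrite ltr_pwDl// expR_ge0.
split.
  have le1 : expR (y - c) <= expR y by rewrite ler_expR gerBl ltW.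
  apply/andP; split.
    by rewrite subr_ge0 ler_ln// lerD2l.
  rewrite lerBlDl -[leRHS]expRK ler_ln ?posrE ?expR_gt0// (expRD (ln _)) lnK// mulrDl mul1r -expRD subrK.
  by rewrite lerD2r -expR0 ler_expR ltW.
rewrite /logistic /tau opprB (expRB y (ln _)) (expRB (ln _) (ln _)) !lnK// expRB expRN.
have := expR_gt0 c; move: p1 p2; rewrite expRB; move: (expR y) (expR c) => u v p1 p2 v0.
by field; rewrite (gt_eqF p1) (gt_eqF v0).
Qed.

Lemma kern_bpoly_limit (a' p s : R[i]) y :
  kern c (p - a') a' s y%:C = kern c p 0 s y%:C
    * cexp (a' * (ln (1 + expR y) - ln (1 + expR (y - c)))%:C).
Proof.
rewrite -cexpD; congr cexp; rewrite -rmorphB !softplus_real rmorphB /=; ring.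
Qed.

(** The moments of the beta integrand. Each step is integration by parts at r = 0, which reads s S p
    0 s = p S (p + 1) 0 (s + 1). *)
Lemma pochhammer_S (p s : R[i]) n : admissible p 0 s ->
  pochhammer s n * S c p 0 s = pochhammer p n * S c (p + n%:R) 0 (s + n%:R).
Proof.
move=> [p0 _ s0 sp]; elim: n => [|n IH].
  by rewrite /pochhammer !big_ord0 !addr0.
rewrite !pochhammerS mulrAC IH.
have adm : admissible (p + n%:R) 0 (s + n%:R).
  have nR := natC R n.
  have n0 : 0 <= n%:R :> R by [].
  by split; rewrite ?ReD ?nR /=; move: p0 s0 sp n0; rewrite /=; clear; lra.
have P := S_parts c0 adm; rewrite mul0r mul0r addr0 -!addrA natr1 in P.
by rewrite -[LHS]mulrA -[RHS]mulrA -P; congr (_ * _); exact: mulrC.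
Qed.

Lemma pochhammer_neq0 (p : R[i]) n : 0 < re p -> pochhammer p n != 0.
Proof.
move=> p0; apply/prodf_neq0 => i _.
rewrite -cabs_gt0; apply: lt_le_trans (cabs_ge_Re _).
by rewrite normr_gt0 gt_eqF// ReD natC /= ltr_wpDr.
Qed.

Definition gauss_term (a' b p z : R[i]) (n : nat) : R[i] :=
  pochhammer a' n * pochhammer b n / (pochhammer p n * n`!%:R) * z ^+ n.

(** Term by term, the nth power of the logistic function integrates to (b)_n / (p)_n times the full
    integral, which turns a binomial coefficient into a Gauss coefficient. *)
Lemma gauss_partial (a' p b : R[i]) N : admissible p 0 b ->
  (\sum_(n < N) gauss_term a' b p (1 - expR (- c))%:C n) * S c p 0 b
  = cintegral setT (fun y => kern c p 0 b y%:C
      * bpoly a' N ((1 - expR (- c)) * logistic y)%:C)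
  /\ cintegrable setT (fun y => kern c p 0 b y%:C
      * bpoly a' N ((1 - expR (- c)) * logistic y)%:C).
Proof.
move=> adm; have [p0 _ b0 bp] := adm; rewrite /= addr0 in bp.
have rp : 0 < re p by exact: lt_trans bp.
have mT : measurable [set: R] by [].
elim: N => [|N [IH iH]].
  rewrite big_ord0 mul0r.
  have E : (fun y => kern c p 0 b y%:C * bpoly a' 0 ((1 - expR (- c)) * logistic y)%:C)
      = (fun y => 0 * kern c p 0 b y%:C).
    by apply/funext => y; rewrite /bpoly big_ord0 mulr0 mul0r.
  rewrite E; have ik := cintegrable_kern c0 adm.
  by split; [rewrite cintegralZ// mul0r|exact: cintegrableZ].
have nR := natC R N.
have admN : admissible (p + N%:R) 0 (b + N%:R).
  have n0 : 0 <= N%:R :> R by [].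
  by split; rewrite ?ReD ?nR /=; move: p0 b0 bp n0; rewrite /=; clear; lra.
have ik := cintegrable_kern c0 admN.
set K := bcoef a' N * (1 - expR (- c))%:C ^+ N.
have E : (fun y => kern c p 0 b y%:C * bpoly a' N.+1 ((1 - expR (- c)) * logistic y)%:C)
   = (fun y => kern c p 0 b y%:C * bpoly a' N ((1 - expR (- c)) * logistic y)%:C
        + K * kern c (p + N%:R) 0 (b + N%:R) y%:C).
  apply/funext => y; rewrite /bpoly big_ord_recr /= mulrDr -kern_logistic; congr (_ + _).
  by rewrite rmorphM /= exprMn /K; ring.
rewrite E; split; last by apply: cintegrableD => //; exact: cintegrableZ.
rewrite cintegralD//; last exact: cintegrableZ.
rewrite cintegralZ// -IH big_ord_recr /= mulrDl; congr (_ + _).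
have pn0 := pochhammer_neq0 N rp.
have -> : gauss_term a' b p (1 - expR (- c))%:C N * S c p 0 b
   = K / pochhammer p N * (pochhammer b N * S c p 0 b).
  rewrite /gauss_term /K /bcoef; field.
  by rewrite pn0 factC_neq0.
rewrite (pochhammer_S N adm) -/(S c (p + N%:R) 0 (b + N%:R)); field.
exact: pn0.
Qed.

(** The remainder bound does not depend on y, so it can be integrated against the kernel. The factor
    S p 0 b stays on the side of the series to avoid dividing by it. *)
Lemma gauss_series_cvg (a' p b : R[i]) : admissible p 0 b -> 0 <= re a' <= re p ->
  forall e : R, 0 < e -> \forall N \near \oo,
    cabs ((\sum_(n < N) gauss_term a' b p (1 - expR (- c))%:C n) * S c p 0 b
      - S c (p - a') a' b) < e.
Proof.
move=> adm /andP[ra rap] e e0; have [p0 _ b0 bp] := adm; rewrite /= addr0 in bp.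
have mT : measurable [set: R] by [].
have m0 := margin_gt0 adm.
have iexp := integrable_expR_abs m0.
set J := \int[(@lebesgue_measure R)]_y expR (- margin p 0 b * `|y|) in iexp *.
have J0 : 0 <= J by apply: Rintegral_ge0 => y _; exact: expR_ge0.
have admI : admissible (p - a') a' b.
  by split => //; rewrite ?ReD ?ReN; move: rap bp; clear; lra.
have iI := cintegrable_kern c0 admI.
set A := expR (re a' * c) * (2 * c).
have A0 : 0 <= A by rewrite mulr_ge0 ?expR_ge0// mulr_ge0// ltW.
pose d n := cabs (n.+1%:R * bcoef a' n.+1) * (1 - expR (- c)) ^+ n.
have d0 n : 0 <= d n.
  by rewrite mulr_ge0 ?cabs_ge0// exprn_ge0// subr_ge0 expR_le1 oppr_le0 ltW.
have dlim : d n @[n --> \oo] --> (0 : R).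
  apply: bcoef_lim; rewrite subr_ge0 expR_le1 oppr_le0 (ltW c0) /=.
  by rewrite gtrBl expR_gt0.
set M := 2 * (A * J) + 1.
have M0 : 0 < M by rewrite ltr_wpDl// mulr_ge0// mulr_ge0.
have eM : 0 < e / M by rewrite divr_gt0.
have H n : cabs ((\sum_(i < n.+1) gauss_term a' b p (1 - expR (- c))%:C i) * S c p 0 b
      - S c (p - a') a' b) <= M * d n.
  have [-> iN] := gauss_partial a' n.+1 adm.
  rewrite -cintegralB//.
  have ig := integrableZ_real (A * d n) mT iexp.
  apply: le_trans (cabs_cintegral mT (cintegrableB mT iN iI) ig _) _.
    move=> y _; rewrite kern_bpoly_limit -mulrBr cabsM.
    have [tc ->] := logistic_tau y.
    have := bpoly_remainder n ra tc; rewrite -/A -/(d n) => hb.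
    have := kern_margin c0 y adm; rewrite mul0r expR0 mul1r => hk.
    by rewrite mulrC; apply: ler_pM; rewrite ?cabs_ge0.
  rewrite RintegralZl// -/J /M; move: (d0 n); move: (d n) => u u0.
  by rewrite mulrDl mul1r; move: u0; clear; lra.
have Hn : \forall n \near \oo, cabs ((\sum_(i < n.+1) gauss_term a' b p (1 - expR (- c))%:C i)
    * S c p 0 b - S c (p - a') a' b) < e.
  have /cvgrPdist_lt/(_ _ eM) := dlim; apply: filterS => n.
  rewrite sub0r normrN ger0_norm// ltr_pdivlMr// => dn.
  by apply: le_lt_trans (H n) _; rewrite mulrC.
(* The remainder estimate concerns sums of n + 1 terms, so the threshold moves by one. *)
case: Hn => n0 _ Hn; exists n0.+1 => // -[//|n] /= n0n.
exact: Hn.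
Qed.

Lemma gauss2F1_S (a' p b : R[i]) : admissible p 0 b -> 0 <= re a' <= re p ->
  S c p 0 b * gauss2F1 a' b p (1 - expR (- c))%:C = S c (p - a') a' b.
Proof.
move=> adm rap; have H := gauss_series_cvg adm rap.
(* No proof that the beta integral is nonzero is required: if it vanishes, the convergence just
   established forces the right-hand side to vanish as well. *)
have [B0|B0] := eqVneq (S c p 0 b) 0.
  rewrite B0 mul0r; apply/eqP; rewrite eq_sym -cabs_eq0 eq_le cabs_ge0 andbT.
  apply/ler_addgt0Pl => e e0; rewrite addr0.
  have [N _ /(_ N)] := H _ e0; rewrite /= leqnn B0 mulr0 sub0r cabsN.
  by move=> /(_ isT) /ltW.
set l := S c (p - a') a' b / S c p 0 b.
suff : gauss2F1 a' b p (1 - expR (- c))%:C = l by move=> ->; rewrite mulrC divfK.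
have BC : 0 < cabs (S c p 0 b) by rewrite cabs_gt0.
have cvl : series (gauss_term a' b p (1 - expR (- c))%:C : nat -> R[i]^o) @ \oo --> (l : R[i]^o).
  apply/cvgrPdist_lt => /= e e0.
  have eC : e = (re e)%:C by move: e0; rewrite ltcE /= => /andP[/eqP]; case: e => u v /= ->.
  have e0' : 0 < re e by move: e0; rewrite eC ltcR.
  have := H _ (mulr_gt0 e0' BC); apply: filterS => N.
  rewrite cabs_normE eC ltcR /series /= big_mkord.
  set s := \sum_(_ < _) _ => Hs.
  rewrite -(ltr_pM2r BC) -cabsM (_ : (l - s) * S c p 0 b = - (s * S c p 0 b - S c (p - a') a' b)) ?cabsN//.
  by rewrite /l; field.
exact: (cvg_lim _ cvl).
Qed.

End GaussSeries.

(** * The weight *)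

Section Tails.
Variable R : realType.
Implicit Types (x y t e k : R).
Local Notation mu := (@lebesgue_measure R).

(** (1 + x^2)^(-k), a smooth substitute for |x|^(-2 k). *)
Definition bracket k x : R := expR (- k * ln (1 + x ^+ 2)).

Lemma bracket_arg_gt0 x : 0 < 1 + x ^+ 2.
Proof. by rewrite ltr_pwDl ?sqr_ge0. Qed.

Lemma bracket_gt0 k x : 0 < bracket k x.
Proof. exact: expR_gt0. Qed.

Lemma bracket_is_derive k x : is_derive x 1 (fun u => u * bracket k u)
  (bracket k x * (1 - 2 * k + 2 * k / (1 + x ^+ 2))).
Proof.
have d1 : is_derive x 1 (fun u : R => 1 + u ^+ 2) (2 * x).
  by apply: is_derive_eq; rewrite /GRing.scale /=; ring.
have d2 := @is_derive1_comp _ (@ln R) (fun u : R => 1 + u ^+ 2) x _ _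
  (is_derive1_ln (bracket_arg_gt0 x)) d1.
have d3 : is_derive x 1 (fun u : R => - k * ln (1 + u ^+ 2)) (- k * ((1 + x ^+ 2)^-1 * (2 * x))).
  by apply: is_derive_eq; rewrite /GRing.scale /=; ring.
have d4 : is_derive x 1 (bracket k) (bracket k x * (- k * ((1 + x ^+ 2)^-1 * (2 * x)))).
  exact: (@is_derive1_comp _ (@expR R) (fun u : R => - k * ln (1 + u ^+ 2)) x _ _ (is_derive_expR _) d3).
apply: is_derive_eq; rewrite /GRing.scale /=; field.
by rewrite gt_eqF// bracket_arg_gt0.
Qed.

Lemma bracket_continuous k : continuous (bracket k).
Proof.
move=> x; apply: continuous_comp; last exact: continuous_expR.
apply: cvgM; first exact: cvg_cst.
apply: continuous_comp; last by apply: continuous_ln; exact: bracket_arg_gt0.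
by apply: cvgD; [exact: cvg_cst|exact: exprn_continuous].
Qed.

Lemma bracket_le k k' x : k <= k' -> bracket k' x <= bracket k x.
Proof.
move=> kk; rewrite ler_expR ler_wpM2r ?lerN2//.
by rewrite ln_ge0// lerDl sqr_ge0.
Qed.

Lemma bracket_half x : bracket (1 / 2) x * `|x| <= 1.
Proof.
have p := bracket_arg_gt0 x; have b := bracket_gt0 (1 / 2) x.
have E : bracket (1 / 2) x ^+ 2 * (1 + x ^+ 2) = 1.
  have -> : bracket (1 / 2) x ^+ 2 = expR (- ln (1 + x ^+ 2)).
    by rewrite -expRM_natl; congr expR; field.
  by rewrite expRN lnK// mulVf// gt_eqF.
have : (bracket (1 / 2) x * `|x|) ^+ 2 <= 1 ^+ 2.
  rewrite exprMn real_normK ?num_real// expr1n -[leRHS]E.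
  by apply: ler_wpM2l; [rewrite exprn_ge0// ltW|rewrite lerDr].
by rewrite ler_sqr ?nnegrE ?mulr_ge0 ?(ltW b).
Qed.

(* The function [x (1 + x^2)^-k] with [2 k = 1 + e] is bounded with derivative
   [~ - e |x|^(- 2 k)]; adding a multiple of [x (1 + x^2)^(-1/2)] makes
   the derivative of constant sign everywhere. *)
Lemma bracket_integrable e : 0 < e ->
  mu.-integrable setT (EFin \o bracket ((1 + e) / 2)).
Proof.
move=> e0; set k := (1 + e) / 2.
pose f x := (1 + e) * (bracket (1 / 2) x * (1 - 2 * (1 / 2) + 2 * (1 / 2) / (1 + x ^+ 2)))
  - bracket k x * (1 - 2 * k + 2 * k / (1 + x ^+ 2)).
have cq : continuous (fun x : R => (1 + x ^+ 2)^-1).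
  move=> x; apply: cvgV; first by rewrite gt_eqF// bracket_arg_gt0.
  by apply: cvgD; [exact: cvg_cst|exact: exprn_continuous].
have ct k' : continuous (fun x => bracket k' x * (1 - 2 * k' + 2 * k' / (1 + x ^+ 2))).
  move=> x; apply: cvgM; first exact: bracket_continuous.
  apply: cvgD; first exact: cvg_cst.
  by apply: cvgM; [exact: cvg_cst|exact: cq].
have cf : continuous f.
  by move=> x; apply: cvgB; [apply: cvgM; [exact: cvg_cst|exact: ct]|exact: ct].
have ef x : e * bracket k x <= f x.
  have kk : 1 / 2 <= k by rewrite /k; move: e0; clear; lra.
  have := bracket_le x kk.
  have i0 : 0 < (1 + x ^+ 2)^-1 by rewrite invr_gt0 bracket_arg_gt0.
  move=> /(ler_wpM2r (ltW i0)).
  have e1 : 0 <= 1 + e by move: e0; clear; lra.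
  move=> /(ler_wpM2l e1); rewrite /f /k.
  by move: (bracket ((1 + e) / 2) x) (bracket (1 / 2) x) ((1 + x ^+ 2)^-1) => u v w; clear; lra.
have f0 x : 0 <= f x by apply: le_trans (ef x); rewrite mulr_ge0 ?(ltW e0) ?(ltW (bracket_gt0 _ _)).
pose F x := (1 + e) * (x * bracket (1 / 2) x) - x * bracket k x.
have dF (x : R) : is_derive x 1 F (f x).
  have d1 := bracket_is_derive (1 / 2) x; have d2 := bracket_is_derive k x.
  by apply: is_derive_eq; rewrite /f /GRing.scale /=; ring.
have FB x : `|F x| <= 2 + e.
  have H1 := bracket_half x.
  have H2 : bracket k x * `|x| <= 1.
    by apply: le_trans H1; rewrite ler_wpM2r// bracket_le// /k; move: e0; clear; lra.
  apply: le_trans (ler_normB _ _) _.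
  rewrite !normrM (ger0_norm (ltW (bracket_gt0 _ _))) (ger0_norm (ltW (bracket_gt0 k _))).
  have e1 : 0 <= 1 + e by move: e0; clear; lra.
  rewrite (ger0_norm e1) !(mulrC `|x|).
  have := ler_wpM2l e1 H1; move: H2; clear; lra.
have [intf _] := integrable_derivative_bounded cf f0 dF FB.
have mT : measurable [set: R] by [].
apply: le_integrable_real (integrableZ_real e^-1 mT intf) => //.
  by apply: continuous_measurable_fun; exact: bracket_continuous.
move=> x _; rewrite ger0_norm ?(ltW (bracket_gt0 _ _))//.
by rewrite mulrC ler_pdivlMr// mulrC.
Qed.

Lemma bracket_lim k (K : R) : 0 < k -> 0 <= K -> forall e : R, 0 < e ->
  \forall n \near \oo, K * bracket k n%:R < e /\ K * bracket k (- n%:R) < e.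
Proof.
move=> k0 K0 e e0.
have sq n : bracket k (- n%:R) = bracket k n%:R by rewrite /bracket sqrrN.
have lim : \forall n \near \oo, (K + 1) / e * expR 1 <= 1 + k * ln (1 + (n%:R : R) ^+ 2).
  have H : \forall n \near \oo, expR (((K + 1) / e * expR 1) / k) <= (n%:R : R).
    exact: nbhs_infty_ger.
  near=> n.
  have n1 : expR (((K + 1) / e * expR 1) / k) <= 1 + (n%:R : R) ^+ 2.
    have : expR (((K + 1) / e * expR 1) / k) <= n%:R by near: n.
    by have := sqr_ge0 ((n%:R : R) - 1); clear; move: (expR _) => u; move: (n%:R : R) => v; nra.
  have : ((K + 1) / e * expR 1) / k <= ln (1 + (n%:R : R) ^+ 2).
    by rewrite -[leLHS]expRK ler_ln ?posrE ?expR_gt0 ?bracket_arg_gt0.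
  by rewrite ler_pdivrMr// (mulrC (ln _)) => /le_trans; apply; rewrite lerDr.
apply: filterS lim => n Hn; rewrite sq; suff : K * bracket k n%:R < e by [].
have L := expR_ge1Dx (k * ln (1 + (n%:R : R) ^+ 2)).
rewrite /bracket mulNr expRN ltr_pdivrMr ?expR_gt0//.
have Hn' : (K + 1) / e * expR 1 <= 1 + k * ln (1 + (n%:R : R) ^+ 2) := Hn.
have := le_trans Hn' L; rewrite -ler_pdivlMr ?expR_gt0//.
have E1 : 1 <= expR 1 :> R by rewrite -expR0 ler_expR.
have X0 := expR_ge0 (k * ln (1 + (n%:R : R) ^+ 2)).
move=> H; have {}H : (K + 1) / e <= expR (k * ln (1 + (n%:R : R) ^+ 2)).
  by apply: le_trans H _; rewrite ler_piMr// invf_le1// expR_gt0.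
by move: H; rewrite ler_pdivrMr// mulrC; move: K0; clear; lra.
Unshelve. all: by end_near. Qed.

(** From 1 + x^2 <= 2 x^2 for |x| >= 1. *)
Lemma power_le_bracket e x : 0 < e -> 1 <= `|x| ->
  expR (- (1 + e) * ln `|x|) <= expR ((1 + e) / 2 * ln 2) * bracket ((1 + e) / 2) x.
Proof.
move=> e0 x1; have x0 : 0 < `|x| by exact: lt_le_trans x1.
rewrite -expRD ler_expR.
have H : ln (1 + x ^+ 2) <= ln 2 + 2 * ln `|x|.
  have -> : 2 * ln `|x| = ln (x ^+ 2).
    by rewrite -[x ^+ 2]real_normK ?num_real// lnXn// mulr_natl.
  have x2 : 1 <= x ^+ 2 by rewrite -[x ^+ 2]real_normK ?num_real// exprn_ege1.
  have x20 : 0 < x ^+ 2 := lt_le_trans ltr01 x2.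
  rewrite -lnM ?posrE// ler_ln ?posrE ?bracket_arg_gt0 ?(mulr_gt0 _ x20)//.
  by move: x2; clear; lra.
have k0 : 0 <= (1 + e) / 2 by move: e0; clear; lra.
by have := ler_wpM2l k0 H; move: (ln `|x|) (ln 2) (ln (1 + x ^+ 2)) => u v w; clear; lra.
Qed.

End Tails.

(** * Bounds for the weight *)

Section WeightBounds.
Variable R : realType.
Implicit Types (x y t e k : R).
Local Notation mu := (@lebesgue_measure R).
Local Notation re := (@complex.Re R).
Variables alpha : R.
Hypothesis alpha0 : 0 < alpha.

Local Notation a := (alpha / 2).

Lemma half_gt0 : 0 < a. Proof. by rewrite divr_gt0. Qed.
Local Notation a0 := half_gt0.

Lemma cabs_cGamma_even t : cabs (cGamma (a +i* (- t))) = cabs (cGamma (a +i* t)).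
Proof.
have b0 := half_gt0; apply/eqP; rewrite -(@eqrXn2 _ 2)// ?cabs_ge0// !sqr_cabs !cGammaE//=.
have -> : \int[mu]_y (gumbel a y * cos (- t * y)) = \int[mu]_y (gumbel a y * cos (t * y)).
  by apply: eq_Rintegral => y _; rewrite mulNr cosN.
have iS : mu.-integrable setT (EFin \o (fun y => gumbel a y * sin (t * y))).
  exact: (gumbel_bounded_integrable a0 (@sin_lin_continuous R t) (fun y => sin_max _)).2.
have mT : measurable [set: R] by [].
have -> : \int[mu]_y (gumbel a y * sin (- t * y)) = -1 * \int[mu]_y (gumbel a y * sin (t * y)).
  have <- := @RintegralZl _ _ _ mu setT (fun y => gumbel a y * sin (t * y)) (-1) mT iS.
  by apply: eq_Rintegral => y _; rewrite mulNr sinN mulN1r mulrN.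
by rewrite mulN1r sqrrN.
Qed.

(** [S_bound] needs k >= 2 and would give too high a power of x for alpha < 2. Two integrations by
    parts raise p from alpha to k = alpha + 2, and the two factors 1 / |z| bring the exponent alpha
    + 1 down to alpha - 1, as in Stirling's formula. *)
Lemma S_gamma_bound (c : R) : 0 < c -> exists2 C : R, 0 <= C & forall x, 1 <= x ->
  cabs (S c alpha%:C 0 (a -i* x)) <= C * expR (- pi * x + (alpha - 1) * ln x).
Proof.
move=> c0; have b0 := half_gt0.
have [|||C C0 HC] := @S_bound _ c c0 (alpha%:C + 1 + 1) 0 (alpha + 2) a _ _ _ a0.
- by rewrite !ReD /=; apply/andP; split; move: alpha0; clear; lra.
- by rewrite /= lexx; move: alpha0; clear; lra.
- by move: alpha0; clear; lra.
have al1 : 0 < alpha + 1 by rewrite addr_gt0.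
have A0 : 0 <= alpha * (alpha + 1) by move: alpha0; clear; nra.
exists (alpha * (alpha + 1) * C); first by rewrite mulr_ge0.
move=> x x1; have x0 : 0 < x by exact: lt_le_trans x1.
have aE : alpha = a + a by field.
move: b0 aE HC; set b := alpha / 2 => b0 aE HC; set z := b -i* x.
have adm1 : admissible alpha%:C 0 z.
  by split; rewrite /= ?aE; move: b0; clear; lra.
have adm2 : admissible (alpha%:C + 1) 0 (z + 1).
  by split; rewrite /= ?aE; move: b0; clear; lra.
have P1 := S_parts c0 adm1; have P2 := S_parts c0 adm2.
rewrite !mul0r !addr0 in P1 P2.
have H := HC x (z + 1 + 1) x1.
have {}H : cabs (S c (alpha%:C + 1 + 1) 0 (z + 1 + 1)) <= C * expR (- pi * x + (alpha + 2 - 1) * ln x).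
  by apply: H; rewrite /z /= ?addr0 ?aE; move: b0; clear; lra.
have zx : x <= cabs z.
  by have := cabs_ge_Im z; rewrite /z /= normrN (gtr0_norm x0).
have z1x : x <= cabs (z + 1).
  by have := cabs_ge_Im (z + 1); rewrite /z /= addr0 normrN (gtr0_norm x0).
have N1 : cabs z * cabs (S c alpha%:C 0 z) = alpha * cabs (S c (alpha%:C + 1) 0 (z + 1)).
  by rewrite -cabsM P1 cabsM cabs_real (gtr0_norm alpha0).
have N2 : cabs (z + 1) * cabs (S c (alpha%:C + 1) 0 (z + 1))
    = (alpha + 1) * cabs (S c (alpha%:C + 1 + 1) 0 (z + 1 + 1)).
  rewrite -cabsM P2 cabsM; congr (_ * _).
  by rewrite -(rmorph1 (real_complex R)) -rmorphD cabs_real (gtr0_norm al1).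
have E : expR (- pi * x + (alpha + 2 - 1) * ln x) = x ^+ 2 * expR (- pi * x + (alpha - 1) * ln x).
  have -> : x ^+ 2 = expR (2 * ln x) by rewrite expRM_natl lnK.
  by rewrite -expRD; congr expR; ring.
have M1 : x * cabs (S c alpha%:C 0 z) <= alpha * cabs (S c (alpha%:C + 1) 0 (z + 1)).
  by rewrite -N1 ler_wpM2r ?cabs_ge0.
have M2 : x * cabs (S c (alpha%:C + 1) 0 (z + 1))
    <= (alpha + 1) * (C * (x ^+ 2 * expR (- pi * x + (alpha - 1) * ln x))).
  apply: (@le_trans _ _ (cabs (z + 1) * cabs (S c (alpha%:C + 1) 0 (z + 1)))).
    by rewrite ler_wpM2r ?cabs_ge0.
  by rewrite N2 -E; exact: ler_wpM2l (ltW al1) _ _ H.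
have x2 : 0 < x ^+ 2 by rewrite exprn_gt0.
rewrite -(ler_pM2l x2).
have T1 := ler_wpM2l (ltW x0) M1; have T2 := ler_wpM2l (ltW alpha0) M2.
move: T1 T2; move: (cabs _) (cabs _) (expR _) => u v w; clear; lra.
Qed.

Lemma weightE (c : R) t : 0 < c -> weight alpha t = (2 * pi)^-1
  * (\int[mu]_q gumbel alpha q * re (S c alpha%:C 0 (a -i* t))) * expR (pi * t).
Proof.
move=> c0; rewrite /weight; congr (_ * _ * _).
have := sqr_cabs_cGamma a0 t c0; rewrite (_ : 2 * a = alpha); last by field.
by move=> /(congr1 re); rewrite ReMl.
Qed.

(** The bound for t >= 1 passes to t <= -1 because |Gamma(a + i t)| is even; the only asymmetry of
    the weight is e^(pi t). *)
Lemma weight_bound : exists2 C : R, 0 <= C & forall t, 1 <= `|t| ->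
  weight alpha t <= C * expR (pi * (t - `|t|) + (alpha - 1) * ln `|t|).
Proof.
have [C C0 HC] := S_gamma_bound (@ltr01 R).
set G := \int[mu]_q gumbel alpha q.
have G0 : 0 <= G by apply: Rintegral_ge0 => y _; exact: expR_ge0.
exists ((2 * pi)^-1 * (G * C)).
  by rewrite mulr_ge0 ?mulr_ge0// invr_ge0 mulr_ge0// pi_ge0.
move=> t t1.
have E : weight alpha t = weight alpha `|t| * expR (pi * (t - `|t|)).
  rewrite /weight -[RHS]mulrA -expRD -mulrDr (addrC `|t|) subrK; congr (_ * _ * _).
  have [t0|t0] := leP 0 t; first by rewrite ger0_norm.
  by rewrite (ltr0_norm t0) (cabs_cGamma_even t).
have H := le_trans (le_trans (ler_norm _) (cabs_ge_Re _)) (HC _ t1).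
have P0 : 0 <= (2 * pi)^-1 * G :> R by rewrite mulr_ge0// invr_ge0 mulr_ge0// pi_ge0.
rewrite E (weightE _ (@ltr01 R)) -/G.
have {}H := ler_wpM2r (expR_ge0 (pi * `|t| + pi * (t - `|t|))) (ler_wpM2l P0 H).
apply: (le_trans (le_trans _ H)); first by rewrite (expRD (pi * `|t|)) !mulrA.
rewrite -[X in X <= _]mulrA -[X in _ * X <= _]mulrA -(expRD (- pi * _ + _)) !mulrA.
by rewrite le_eqVlt; apply/orP; left; apply/eqP; congr (_ * expR _); ring.
Qed.

End WeightBounds.

(** * Shifting the contour *)

Section Lifted.
Variable R : realType.
Local Notation mu := (@lebesgue_measure R).
Local Notation ci := (ci R).
Local Notation re := (@complex.Re R).
Local Notation im := (@complex.Im R).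
Variables (a c : R) (p r : R[i]).
Hypotheses (a0 : 0 < a) (c0 : 0 < c) (pa : re p = a) (ra : re r = a).
Implicit Types (tau : R[i]) (t : R).

(** The function Y, defined on a complex strip. Adding i to [tau] adds 1 to the last parameter of
    [S]. *)
Definition Slift tau : R[i] := S c (p + 1) (r + 1) (a%:C - ci * tau).

Lemma re_rotate tau : re (a%:C - ci * tau) = a + im tau.
Proof. by rewrite ReD ReN (ReM ci) /=; ring. Qed.

Lemma im_rotate tau : im (a%:C - ci * tau) = - re tau.
Proof. by rewrite ImD ImN (ImM ci) /=; ring. Qed.

Lemma re1 (z : R[i]) : re (z + 1) = re z + 1.
Proof. by rewrite ReD. Qed.

Lemma Slift_holo : holo_strip Slift (- a) (a + 2).
Proof.
move=> tau /andP[t1 t2].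
have adm : admissible (p + 1) (r + 1) (a%:C - ci * tau).
  by split; rewrite ?re1 ?re_rotate ?pa ?ra; move: a0 t1 t2; lra.
have [d Hd] := S_cderiv c0 adm.
exists (d * (0 - ci * 1)); apply: (@cderiv_comp R (S c (p + 1) (r + 1)) (fun z => a%:C - ci * z)) => //.
by apply: cderivB; [exact: cderiv_cst | apply: cderivZ; exact: cderiv_id].
Qed.

(** Intended for Re tau < 0, where the factor e^(pi tau) of the integrand provides the decay. *)
Lemma Slift_bounded : exists2 C : R, 0 <= C &
  forall tau, 0 <= im tau <= 2 -> cabs (Slift tau) <= C.
Proof.
have mT : measurable [set: R] by [].
pose g (y : R) := expR ((a + 1) * c) * expR (- a * `|y|).
have ig : mu.-integrable setT (EFin \o g).
  exact/(integrableZ_real _ mT)/integrable_expR_abs.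
exists (2 * \int[mu]_y g y).
  by rewrite mulr_ge0//; apply: Rintegral_ge0 => y _; rewrite mulr_ge0 ?expR_ge0.
move=> tau /andP[t1 t2].
have adm : admissible (p + 1) (r + 1) (a%:C - ci * tau).
  by split; rewrite ?re1 ?re_rotate ?pa ?ra; move: a0 t1 t2; lra.
apply: (cabs_cintegral mT (cintegrable_kern c0 adm) ig) => y _.
have -> : g y = expR (re (r + 1) * c) * expR (- a * `|y|) by rewrite re1 ra.
apply: (cabs_kern_real c0);
  by rewrite ?re1 ?re_rotate ?pa ?ra; move: a0 t1 t2; lra.
Qed.

(** One integration by parts raises each exponent in turn, so that k = a + 2 serves for every a > 0;
    the factor 1 / |z| brings the power a + 1 down to a. *)
Lemma Slift_decay : exists2 C : R, 0 <= C &
  forall tau, 0 <= im tau <= 2 -> 1 <= re tau ->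
    cabs (Slift tau) <= C * expR (- pi * re tau + a * ln (re tau)).
Proof.
have [|||C1 C10 H1] := @S_bound _ c c0 (p + 1 + 1) (r + 1) (a + 2) a _ _ _ a0.
- by rewrite !re1 pa; move: a0; lra.
- by rewrite !re1 ra; move: a0; lra.
- by move: a0; lra.
have [|||C2 C20 H2] := @S_bound _ c c0 (p + 1) (r + 1 + 1) (a + 2) a _ _ _ a0.
- by rewrite !re1 pa; move: a0; lra.
- by rewrite !re1 ra; move: a0; lra.
- by move: a0; lra.
pose K1 := cabs (p + 1); pose K2 := cabs ((r + 1) * (expR (- c))%:C).
exists (K1 * C1 + K2 * C2); first by rewrite addr_ge0// mulr_ge0 ?cabs_ge0.
move=> tau /andP[t1 t2] x1; set z := a%:C - ci * tau.
have zr : re z = a + im tau by exact: re_rotate.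
have zi : im z = - re tau by exact: im_rotate.
have adm : admissible (p + 1) (r + 1) z.
  by split; rewrite ?re1 ?zr ?pa ?ra; move: a0 t1 t2; lra.
have zi1 : im (z + 1) = - re tau by rewrite ImD zi addr0.
have x0 : 0 < re tau := lt_le_trans ltr01 x1.
have B1 := H1 _ _ x1 zi1; have B2 := H2 _ _ x1 zi1.
have {}B1 : cabs (S c (p + 1 + 1) (r + 1) (z + 1)) <= C1 * expR (- pi * re tau + (a + 2 - 1) * ln (re tau)).
  by apply: B1; rewrite ?re1 ?zr ?pa ?ra; move: a0 t1 t2; lra.
have {}B2 : cabs (S c (p + 1) (r + 1 + 1) (z + 1)) <= C2 * expR (- pi * re tau + (a + 2 - 1) * ln (re tau)).
  by apply: B2; rewrite ?re1 ?zr ?pa ?ra; move: a0 t1 t2; lra.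
have E : expR (- pi * re tau + (a + 2 - 1) * ln (re tau))
    = re tau * expR (- pi * re tau + a * ln (re tau)).
  by rewrite -{3}(lnK x0) -expRD; congr expR; ring.
have zx : re tau <= cabs z.
  by have := cabs_ge_Im z; rewrite zi normrN ger0_norm// ltW.
have P := S_parts c0 adm.
rewrite -(ler_pM2l x0) -/z.
apply: (@le_trans _ _ (cabs (z * S c (p + 1) (r + 1) z))).
  by rewrite cabsM ler_wpM2r ?cabs_ge0.
rewrite P (le_trans (cabsD _ _))// !(cabsM _ (S _ _ _ _)) -/K1 -/K2.
have T1 := ler_wpM2l (cabs_ge0 (p + 1)) B1.
have T2 := ler_wpM2l (cabs_ge0 ((r + 1) * (expR (- c))%:C)) B2.
apply: le_trans (lerD T1 T2) _; rewrite E -/K1 -/K2 le_eqVlt; apply/orP; left; apply/eqP.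
by ring.
Qed.

Lemma S_lift t : let z := a%:C - ci * t%:C in let q := (expR (- c))%:C in
  S c p r z = Slift t%:C + (1 + q) * Slift (t%:C + ci) + q * Slift (t%:C + ci + ci).
Proof.
move=> z q.
have zr : re z = a by rewrite re_rotate addr0.
have s1 : S c (p + 1) (r + 1) (z + 1) = Slift (t%:C + ci).
  by congr S; rewrite /z mulrDr ci2; ring.
have s2 : S c (p + 1) (r + 1) (z + 1 + 1) = Slift (t%:C + ci + ci).
  by congr S; rewrite /z !mulrDr ci2; ring.
rewrite (S_split1 c0); last by split; rewrite ?zr ?pa ?ra; move: a0; lra.
rewrite (S_split2 c0); last by split; rewrite ?re1 ?zr ?pa ?ra; move: a0; lra.
rewrite (S_split2 c0 (p := p + 1) (r := r) (s := z + 1)); last by split; rewrite ?re1 ?zr ?pa ?ra; move: a0; lra.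
by rewrite s1 s2 -/(Slift _) -/q; move: (Slift _) (Slift _) (Slift _) => u v w; ring.
Qed.

(** Integration by parts raises one of the two exponents in each term; the other one is then raised
    by splitting. No term without a shift appears, since the last parameter is already z + 1. *)
Lemma S_lift_parts t : let z := a%:C - ci * t%:C in let q := (expR (- c))%:C in
  z * S c p r z = (p + r * q) * Slift (t%:C + ci) + (p + r) * q * Slift (t%:C + ci + ci).
Proof.
move=> z q.
have zr : re z = a by rewrite re_rotate addr0.
have s1 : S c (p + 1) (r + 1) (z + 1) = Slift (t%:C + ci).
  by congr S; rewrite /z mulrDr ci2; ring.
have s2 : S c (p + 1) (r + 1) (z + 1 + 1) = Slift (t%:C + ci + ci).
  by congr S; rewrite /z !mulrDr ci2; ring.
rewrite (S_parts c0); last by split; rewrite ?zr ?pa ?ra; move: a0; lra.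
rewrite (S_split2 c0); last by split; rewrite ?re1 ?zr ?pa ?ra; move: a0; lra.
rewrite (S_split1 c0 (p := p) (r := r + 1) (s := z + 1)); last by split; rewrite ?re1 ?zr ?pa ?ra; move: a0; lra.
by rewrite s1 s2 -/q; move: (Slift _) (Slift _) => v w; ring.
Qed.

End Lifted.

(** * Decay of the functions in H[w] *)

Section Decay.
Variable R : realType.
Local Notation mu := (@lebesgue_measure R).
Local Notation ci := (ci R).
Local Notation re := (@complex.Re R).
Local Notation im := (@complex.Im R).
Implicit Types (alpha e t x : R) (tau z : R[i]) (f : R[i] -> R[i]).

(** The growth allowed by H[w], in the real part alone: |x|^(-b) times the inverse square root of
    the exponential factor in [Psi]. *)
Definition envelope b x : R := expR (- b * ln `|x| + pi * (`|x| - x) / 2).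

Definition decays b y0 y1 f := exists2 C : R, 0 <= C & exists2 N : R, 1 <= N &
  forall tau, y0 <= im tau <= y1 -> N <= `|re tau| ->
    cabs (f tau) <= C * envelope b (re tau).

(** The powers of |z| add up to - (alpha - 1) / 2 - 3 / 2 - e = - (alpha / 2 + 1 + e). This is
    negative, so |z| may be replaced by |Re z|, which is uniform across the strip. *)
Lemma Hw_decays alpha f : 0 < alpha -> in_Hw alpha f ->
  exists2 e, 0 < e & decays (alpha / 2 + 1 + e) (- 1) 1 f.
Proof.
move=> alpha0 [_ [e e0 [C [M H]]]]; exists e => //.
exists `|C|; first exact: normr_ge0.
exists (Num.max 1 M); first by rewrite le_max lexx.
move=> z z1; rewrite ge_max => /andP[x1 Mx].
have zx : `|re z| <= cabs z by exact: cabs_ge_Re.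
have x0 : 0 < `|re z| := lt_le_trans ltr01 x1.
have z0 : 0 < cabs z := lt_le_trans x0 zx.
have pE (x y : R) : 0 < x -> x `^ y = expR (y * ln x) by move=> ?; rewrite /powR gt_eqF.
have PE : Psi alpha z = expR ((alpha - 1) * ln (cabs z) + (pi * re z - pi * `|re z|)).
  by rewrite /Psi pE// -expRD.
have := H z; rewrite ler_norml z1 PE !pE ?expR_gt0// expRK -expRD.
move=> /(_ isT (le_trans Mx zx)) {}H; apply: (le_trans H).
apply: (le_trans (ler_wpM2r (expR_ge0 _) (ler_norm C))).
rewrite ler_wpM2l ?normr_ge0// /envelope ler_expR.
have L0 : 0 <= ln `|re z| by rewrite ln_ge0.
have L : ln `|re z| <= ln (cabs z) by rewrite ler_ln ?posrE.
have k0 : 0 <= alpha / 2 + 1 + e by move: alpha0 e0; clear; lra.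
by move: (ler_wpM2l k0 L); clear; lra.
Qed.

(** By [weightE] the weight is built from values of [S], which is holomorphic in its last
    parameter. *)
Lemma weight_continuous alpha : 0 < alpha -> continuous (weight alpha).
Proof.
move=> alpha0 t.
have a0 : 0 < alpha / 2 by rewrite divr_gt0.
pose F (u : R) : R[i] := S 1 alpha%:C 0 ((alpha / 2) -i* u).
have cF : {for t, continuous (fun u => re (F u))}.
  have adm : admissible alpha%:C 0 ((alpha / 2) -i* t).
    by split; rewrite //= ?addr0; move: alpha0; clear; lra.
  have [d dS] := S_cderiv (@ltr01 R) adm.
  have cu : contraction (fun u : R => (alpha / 2) -i* u).
    move=> u v; rewrite (_ : _ - _ = - ci * (u - v)%:C); last first.
      by apply: complexP; rewrite /= ?mul0r ?mulr0; ring.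
    by rewrite cabsM cabsN cabs_ci cabs_real mul1r.
  exact: (cderiv_ccontinuous cu dS).1.
rewrite (_ : weight alpha = (fun u => (2 * pi)^-1
    * (\int[mu]_q gumbel alpha q * re (F u)) * expR (pi * u))); last first.
  by apply/funext => u; rewrite (weightE alpha0 u (@ltr01 R)).
apply: cvgM.
  by apply: cvgM; [exact: cvg_cst | apply: cvgM; [exact: cvg_cst | exact: cF]].
apply: continuous_comp; last exact: continuous_expR.
by apply: cvgM; [exact: cvg_cst | exact: cvg_id].
Qed.

(** The exponentials in |g|^2 and in the weight cancel, and the power |t|^(alpha - 1 - 2 b) is
    integrable at infinity as soon as b > alpha / 2. *)
Lemma decay_L2w alpha b (g : R -> R[i]) C N : 0 < alpha -> alpha / 2 < b ->
  0 <= C -> 1 <= N -> (forall t, ccontinuous g t) ->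
  (forall t, N <= `|t| -> cabs (g t) <= C * envelope b t) -> in_L2w alpha g.
Proof.
move=> alpha0 ab C0 N1 cg gC.
have cont (k : R -> R) : continuous k -> measurable_fun setT k.
  by move=> ck; apply: measurable_funTS; exact: continuous_measurable_fun.
split; [by apply: cont => t; exact: (cg t).1 | by apply: cont => t; exact: (cg t).2 |].
have [W W0 HW] := weight_bound alpha0.
pose e := 2 * (b - alpha / 2).
have e0 : 0 < e by rewrite /e; move: ab; clear; lra.
pose K := C ^+ 2 * W * expR ((1 + e) / 2 * ln 2).
have mT : measurable [set: R] by [].
have K0 : 0 <= K by rewrite !mulr_ge0 ?expR_ge0 ?sqr_ge0.
apply: (@integrable_continuous_tail _ _ (fun t => K * bracket ((1 + e) / 2) t) N).
- move=> t; apply: cvgM; last exact: weight_continuous.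
  have c1 := continuous_cabs (cg t).
  by rewrite (_ : (fun t => _) = (fun t => cabs (g t) * cabs (g t))); [exact: cvgM | apply/funext => u; exact: expr2].
- by move=> t; rewrite mulr_ge0// ltW// bracket_gt0.
- exact/(integrableZ_real _ mT)/bracket_integrable.
move=> t Nt; have t1 := le_trans N1 Nt.
have w0 : 0 <= weight alpha t.
  apply: mulr_ge0 (mulr_ge0 _ (sqr_ge0 _)) (expR_ge0 _).
  by rewrite invr_ge0 mulr_ge0// pi_ge0.
rewrite (ger0_norm (mulr_ge0 (sqr_ge0 _) w0)).
have B := power_le_bracket e0 t1.
have G2 : cabs (g t) ^+ 2 <= (C * envelope b t) ^+ 2.
  by rewrite ler_sqr ?nnegrE ?cabs_ge0 ?mulr_ge0 ?expR_ge0 ?gC.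
apply: le_trans (ler_pM (sqr_ge0 _) w0 G2 (HW _ t1)) _.
have -> : (C * envelope b t) ^+ 2
      * (W * expR (pi * (t - `|t|) + (alpha - 1) * ln `|t|))
    = C ^+ 2 * W * expR (- (1 + e) * ln `|t|).
  rewrite exprMn /envelope -expRM_natl mulrACA -expRD; congr (_ * expR _).
  by rewrite /e; move: (ln _) => l; set u := `|t|; field.
rewrite /K -[leRHS]mulrA; apply: ler_wpM2l B.
by rewrite mulr_ge0 ?sqr_ge0.
Qed.

End Decay.

(** * Moving the contour by i *)

Section Shift.
Variable R : realType.
Local Notation ci := (ci R).
Local Notation re := (@complex.Re R).
Local Notation im := (@complex.Im R).
Variables (a c phi : R) (p r : R[i]).
Hypotheses (a0 : 0 < a) (c0 : 0 < c) (phi0 : 0 < phi) (pa : re p = a) (ra : re r = a).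
Implicit Types (tau w : R[i]) (t : R).

Local Notation Y := (Slift a c p r).

(** Joins e^(pi t) from the weight with e^(i phi t) from the transform; a shift by i multiplies it
    by - e^(-phi). *)
Definition expo tau : R[i] := cexp ((pi +i* phi) * tau).

Lemma expo_ci tau : expo (tau + ci) = - (expR (- phi))%:C * expo tau.
Proof.
rewrite /expo mulrDr cexpD [LHS]mulrC; congr (_ * _).
apply: complexP; rewrite ?Re_cexp ?Im_cexp (ReM (pi +i* phi)) (ImM (pi +i* phi)) /=.
  by rewrite !(mulr0, mulr1, add0r, sub0r, addr0) cospi mulrN1.
by rewrite !(mulr0, mulr1, add0r, sub0r, addr0) sinpi mulr0 oppr0.
Qed.

(** For Re tau > 0 the decay of Y cancels e^(pi tau); for Re tau < 0 Y is merely bounded and e^(pi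
    tau) remains. The stated exponential covers both cases and is inverse to the one in
    [envelope]. *)
Lemma expo_lift_bound : exists2 C : R, 0 <= C & forall tau w,
  re w = 0 -> 0 <= im w <= 1 -> 0 <= im tau <= 1 -> 1 <= `|re tau| ->
  cabs (expo tau * Y (tau + w))
    <= C * expR (a * ln `|re tau| - pi * (`|re tau| - re tau) / 2).
Proof.
have [C1 C10 H1] := Slift_bounded a0 c0 pa ra.
have [C2 C20 H2] := Slift_decay a0 c0 pa ra.
exists (C1 + C2); first by rewrite addr_ge0.
move=> tau w w0 /andP[w1 w2] /andP[t1 t2] x1.
have rw : re (tau + w) = re tau by rewrite ReD w0 addr0.
have iw : 0 <= im (tau + w) <= 2 by rewrite ImD; apply/andP; split; lra.
have L0 : 0 <= ln `|re tau| by rewrite ln_ge0.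
have aL := mulr_ge0 (ltW a0) L0.
have py := mulr_ge0 (ltW phi0) t1.
have E0 x : 0 <= expR x :> R by exact: expR_ge0.
rewrite cabsM cabs_cexp (ReM (pi +i* phi)) /= -/re -/im.
have [x0|x0] := leP 0 (re tau).
  rewrite ger0_norm // in x1 L0 aL *.
  have := H2 _ iw; rewrite rw => /(_ x1) B.
  apply: (le_trans (ler_wpM2l (E0 _) B)); rewrite mulrCA -expRD.
  apply: ler_pM => //; first by rewrite lerDr.
  rewrite ler_expR; lra.
rewrite ltr0_norm // in x1 L0 aL *.
have B := H1 _ iw.
apply: (le_trans (ler_wpM2l (E0 _) B)); rewrite mulrC.
apply: ler_pM => //; first by rewrite lerDl.
rewrite ler_expR; lra.
Qed.

Lemma expo_holo lo hi : holo_strip expo lo hi.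
Proof.
move=> z _; exists (cexp ((pi +i* phi) * z) * ((pi +i* phi) * 1)).
apply: (@cderiv_comp R (@cexp R) (fun z => (pi +i* phi) * z)); last exact: cderiv_cexp.
exact/cderivZ/cderiv_id.
Qed.

(** Cauchy's theorem for expo(tau) Y(tau + w) F(tau) between Im tau = 0 and Im tau = 1, the constant
    being the multiplier of [expo]. It is applied with [w] equal to 0 or to i. The functions [u] and
    [v] are given pointwise, so that each application may write its integrands in its own form. *)
Lemma shift_integral w d e (F : R[i] -> R[i]) (u v : R -> R[i]) :
  re w = 0 -> 0 <= im w <= 1 ->
  0 < d -> 0 < e -> holo_strip F (- d) (1 + d) -> decays (a + 1 + e) 0 1 F ->
  (forall t, u t = expo t%:C * Y (t%:C + w) * F t%:C) ->
  (forall t, v t = expo t%:C * Y (t%:C + ci + w) * F (t%:C + ci)) ->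
  [/\ cintegrable setT u, cintegrable setT v &
      cintegral setT u = - (expR (- phi))%:C * cintegral setT v].
Proof.
move=> w0 /andP[w1 w2] d0 e0 hF [CF CF0 [N N1 HF]] uE vE.
have [CY CY0 HY] := expo_lift_bound.
(* Keeps the strip inside the domain of [F] and, after translation by [w], inside - a < Im < a + 2,
   the domain of Y. *)
pose m := Num.min d a.
have m0 : 0 < m by rewrite lt_min d0.
have [md ma] : m <= d /\ m <= a by rewrite /m !ge_min !lexx orbT.
pose G tau := expo tau * Y (tau + w) * F tau.
have hG : holo_strip G (- m) (1 + m).
  move=> tau /andP[t1 t2].
  have [d1 D1] : exists d, cderiv expo tau d.
    by apply: (@expo_holo (im tau - 1) (im tau + 1)); apply/andP; split; lra.
  have [d2 D2] : exists d, cderiv Y (tau + w) d.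
    by apply: (Slift_holo a0 c0 pa ra); rewrite ImD; apply/andP; split; lra.
  have [d3 D3] : exists d, cderiv F tau d by apply: hF; apply/andP; split; lra.
  eexists; apply: cderivM D3; apply: cderivM D1 _.
  apply: (@cderiv_comp R Y (fun z => z + w)) D2.
  by apply: cderivD; [exact: cderiv_id | exact: cderiv_cst].
pose K := CY * CF * expR ((1 + e) / 2 * ln 2).
have K0 : 0 <= K by rewrite !mulr_ge0 ?expR_ge0.
have k0 : 0 < (1 + e) / 2 by lra.
have mT : measurable [set: R] by [].
have [|||||||i0 i1 E] := @strip_shift R G (- m) (1 + m) 0 1
  (fun x => K * bracket ((1 + e) / 2) x) N hG.
- by lra.
- by [].
- by lra.
- by move=> x; rewrite mulr_ge0// ltW// bracket_gt0.
- exact/(integrableZ_real _ mT)/bracket_integrable.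
- exact: bracket_lim.
- move=> x y Nx y01; have x1 := le_trans N1 Nx.
  set tau := x%:C + ci * y%:C.
  have tr : re tau = x by exact: Re_point.
  have ti : im tau = y by exact: Im_point.
  have B1 : cabs (expo tau * Y (tau + w)) <= CY * expR (a * ln `|x| - pi * (`|x| - x) / 2).
    by rewrite -tr; apply: HY => //; rewrite ?ti ?tr ?w1.
  have B2 : cabs (F tau) <= CF * envelope (a + 1 + e) x.
    by rewrite -tr; apply: HF; rewrite ?ti ?tr.
  rewrite /G cabsM; apply: (le_trans (ler_pM (cabs_ge0 _) (cabs_ge0 _) B1 B2)).
  rewrite mulrACA -expRD /K -[leRHS]mulrA; apply: ler_wpM2l; first by rewrite mulr_ge0.
  (* The exponentials cancel, and the powers leave a - (a + 1 + e) = - (1 + e). *)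
  apply: le_trans (power_le_bracket e0 x1).
  by rewrite ler_expR; lra.
have G0 : (fun x : R => G (x%:C + ci * 0%:C)) = u.
  by apply/funext => x; rewrite /G mulr0 addr0 uE.
have G1 : (fun x : R => G (x%:C + ci * 1%:C)) = (fun t => - (expR (- phi))%:C * v t).
  by apply/funext => x; rewrite /G mulr1 expo_ci vE !mulrA.
rewrite G0 in i0 E; rewrite G1 in i1 E.
have n0 : - (expR (- phi))%:C != 0 :> R[i].
  by rewrite oppr_eq0 -cabs_eq0 cabs_real normr_eq0 gt_eqF// expR_gt0.
have iv : cintegrable setT v.
  have := cintegrableZ (- (expR (- phi))%:C)^-1 mT i1.
  by under eq_fun do rewrite mulKf//.
by split=> //; rewrite E cintegralZ.
Qed.

End Shift.

(** * The integrand of the inverse transform in terms of S *)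

Section Intertwining.
Variable R : realType.
Local Notation mu := (@lebesgue_measure R).
Local Notation ci := (ci R).
Local Notation re := (@complex.Re R).
Implicit Types (u v : R -> R[i]) (k x y : R[i]).

(** Value and integrability travel together, so that linear combinations need no separate
    integrability proofs. *)
Definition has_integral u x := cintegrable setT u /\ cintegral setT u = x.

Lemma has_integralD u v x y : has_integral u x -> has_integral v y ->
  has_integral (fun t => u t + v t) (x + y).
Proof.
have mT : measurable [set: R] by [].
by move=> [iu <-] [iv <-]; split; [exact: cintegrableD | exact: cintegralD].
Qed.

Lemma has_integralZ k u x : has_integral u x -> has_integral (fun t => k * u t) (k * x).
Proof.
have mT : measurable [set: R] by [].
by move=> [iu <-]; split; [exact: cintegrableZ | exact: cintegralZ].
Qed.

Variables (alpha phi : R).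
Hypotheses (alpha0 : 0 < alpha) (phi0 : 0 < phi).
Local Notation a := (alpha / 2).
Local Notation c := (2 * phi).
Implicit Types (s t : R).

(** Gamma(alpha) / (2 pi). *)
Definition mass : R[i] := ((2 * pi)^-1 * \int[mu]_y gumbel alpha y)%:C.

(** The beta integral in |Gamma(a + i t)|^2 = Gamma(alpha) S alpha 0 z is the very factor that
    [gauss2F1_S] attaches to the hypergeometric function; their product is a single [S]. *)
Lemma inv_vilenkin_integrandE (g : R -> R[i]) s t :
  inv_vilenkin_integrand alpha phi g s t
  = mass * (expo phi t%:C * S c (a -i* s) (a +i* s) (a%:C - ci * t%:C) * g t).
Proof.
have h0 : 0 < a by rewrite divr_gt0.
have c0 : 0 < c by rewrite mulr_gt0.
have zE : a%:C - ci * t%:C = a -i* t.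
  by apply: complexP; rewrite ?ReD ?ReN ?(ReM ci) ?ImD ?ImN ?(ImM ci) /=; ring.
have a2 : 2 * a = alpha by field.
have adm : admissible alpha%:C 0 (a -i* t).
  by split; rewrite /= ?addr0; lra.
have rp : 0 <= re (a +i* s) <= re alpha%:C by apply/andP; split; rewrite /=; lra.
have H := gauss2F1_S c0 adm rp.
have pE : alpha%:C - (a +i* s) = a -i* s.
  by apply: complexP; rewrite ?ReD ?ReN ?ImD ?ImN /=; field.
rewrite pE in H.
have G := sqr_cabs_cGamma h0 t c0; rewrite a2 in G.
have eE : expo phi t%:C = (expR (pi * t))%:C * cexp (0 +i* (phi * t)).
  rewrite /expo -cexp_real -cexpD; congr cexp.
  by apply: complexP; rewrite ?ReD ?ImD ?(ReM (pi +i* phi)) ?(ImM (pi +i* phi)) /=; ring.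
rewrite /inv_vilenkin_integrand /weight zE -H mulNr.
have rM (x y : R) : (x * y)%:C = x%:C * y%:C := rmorphM _ x y.
have -> : ((2 * pi)^-1 * cabs (cGamma (a +i* t)) ^+ 2 * expR (pi * t))%:C
   = mass * S c alpha%:C 0 (a -i* t) * (expR (pi * t))%:C.
  by rewrite (rM (_ * _)) (rM _ (_ ^+ 2)) G /mass (rM _ (Rintegral _ _ _)) !mulrA.
rewrite eE; set v1 := S _ _ _ _; set v2 := gauss2F1 _ _ _ _; set v3 := cexp _; set v4 := _%:C.
ring.
Qed.

End Intertwining.

(** * The operator L under the integral sign *)

Section ShiftedIntegrals.
Variable R : realType.
Local Notation ci := (ci R).
Local Notation re := (@complex.Re R).
Local Notation im := (@complex.Im R).
Variables (alpha phi : R).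
Hypotheses (alpha0 : 0 < alpha) (phi0 : 0 < phi).
Local Notation a := (alpha / 2).
Local Notation c := (2 * phi).
Implicit Types (s t : R) (f : R[i] -> R[i]).

Lemma half_plusE t : a +i* t = a%:C + ci * t%:C.
Proof. by apply: complexP; rewrite ?ReD ?(ReM ci) ?ImD ?(ImM ci) /=; ring. Qed.

Lemma half_minusE t : a -i* t = a%:C - ci * t%:C.
Proof. by rewrite half_plusE rmorphN mulrN. Qed.

Lemma eq_has_integral (u : R -> R[i]) x y : has_integral u x -> x = y -> has_integral u y.
Proof. by move=> H <-. Qed.

Lemma Hw_holo f : in_Hw alpha f ->
  exists2 d, 0 < d & holo_strip f (- (1 + d)) (1 + d).
Proof.
move=> [[d d0 H] _]; exists d => // z /andP[z1 z2].
by apply: derivable_cderiv; apply: H; rewrite ltr_norml z1 z2.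
Qed.

(** Y(t) does not occur in (a - i t) S, and Y(t + 2 i) cancels in (a + i t) S. So f(t + i) meets
    only Y(t + i) and Y(t + 2 i), while f(t - i) meets only Y(t) and Y(t + i). These are exactly the
    products that a single shift by i relates to products with f(t), without leaving the strip of
    Y. *)
Lemma has_integral_opL f s : in_Hw alpha f ->
  exists A, has_integral (fun t => expo phi t%:C
      * S c (a -i* s) (a +i* s) (a%:C - ci * t%:C) * on_line f t) A /\
    has_integral (fun t => expo phi t%:C
      * S c (a -i* s) (a +i* s) (a%:C - ci * t%:C) * opL alpha phi f t)
      ((2 * s * sinhR phi)%:C * A).
Proof.
move=> Hf; have [d d0 hf] := Hw_holo Hf; have [e e0 [CF CF0 [N N1 df]]] := Hw_decays alpha0 Hf.
have h0 : 0 < a by rewrite divr_gt0.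
have c0 : 0 < c by rewrite mulr_gt0.
set p := a -i* s; set r := a +i* s.
have pa : re p = a by [].
have ra : re r = a by [].
(* On the lines Im z = 0 and Im z = 1 this restricts to f(t - i) and f(t), so the same upward shift
   serves both difference terms. *)
pose g z := f (z - ci).
have hg : holo_strip g (- d) (1 + d).
  move=> z /andP[z1 z2]; have [u Hu] : exists u, cderiv f (z - ci) u.
    by apply: hf; rewrite ImD ImN /=; apply/andP; split; lra.
  exists (u * (1 - 0)); apply: (@cderiv_comp R f (fun z => z - ci)) Hu.
  by apply: cderivB; [exact: cderiv_id | exact: cderiv_cst].
have dg : decays (a + 1 + e) 0 1 g.
  exists CF => //; exists N => // z /andP[z1 z2] Nz.
  have rz : re (z - ci) = re z by rewrite ReD ReN /= oppr0 addr0.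
  by rewrite -rz; apply: df; rewrite ?rz// ImD ImN /=; apply/andP; split; lra.
have hf' : holo_strip f (- d) (1 + d).
  by move=> z /andP[z1 z2]; apply: hf; apply/andP; split; lra.
have df' : decays (a + 1 + e) 0 1 f.
  exists CF => //; exists N => // z /andP[z1 z2] Nz.
  by apply: df => //; apply/andP; split; lra.
have i0 : 0 <= im (0 : R[i]) <= 1 by rewrite /= lexx ler01.
have i1 : 0 <= im ci <= 1 by rewrite /= lexx ler01.
pose E t := expo phi t%:C.
pose Y0 t := Slift a c p r t%:C.
pose Y1 t := Slift a c p r (t%:C + ci).
pose Y2 t := Slift a c p r (t%:C + ci + ci).
pose fm t := f (t%:C - ci); pose f0 t := f t%:C; pose fp t := f (t%:C + ci).
pose eps : R[i] := - (expR (- phi))%:C.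
have [j1 j2 J] : [/\ cintegrable setT (fun t => E t * Y0 t * f0 t),
    cintegrable setT (fun t => E t * Y1 t * fp t) &
    cintegral setT (fun t => E t * Y0 t * f0 t)
    = eps * cintegral setT (fun t => E t * Y1 t * fp t)].
  by apply: (@shift_integral R a c phi p r h0 c0 phi0 pa ra 0 d e f _ _ erefl i0 d0 e0
    hf' df') => t; rewrite addr0.
have [k1 k2 K] : [/\ cintegrable setT (fun t => E t * Y1 t * f0 t),
    cintegrable setT (fun t => E t * Y2 t * fp t) &
    cintegral setT (fun t => E t * Y1 t * f0 t)
    = eps * cintegral setT (fun t => E t * Y2 t * fp t)].
  exact: (@shift_integral R a c phi p r h0 c0 phi0 pa ra ci d e f).
have [l1 l2 L] : [/\ cintegrable setT (fun t => E t * Y0 t * fm t),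
    cintegrable setT (fun t => E t * Y1 t * f0 t) &
    cintegral setT (fun t => E t * Y0 t * fm t)
    = eps * cintegral setT (fun t => E t * Y1 t * f0 t)].
  apply: (@shift_integral R a c phi p r h0 c0 phi0 pa ra 0 d e g _ _ erefl i0 d0 e0
    hg dg) => t; first by rewrite addr0.
  by rewrite addr0 /g addrK.
have [m1 m2 M] : [/\ cintegrable setT (fun t => E t * Y1 t * fm t),
    cintegrable setT (fun t => E t * Y2 t * f0 t) &
    cintegral setT (fun t => E t * Y1 t * fm t)
    = eps * cintegral setT (fun t => E t * Y2 t * f0 t)].
  apply: (@shift_integral R a c phi p r h0 c0 phi0 pa ra ci d e g _ _ erefl i1 d0 e0
    hg dg) => t; first by [].
  by rewrite /g addrK.
(* By the four shifts the seven integrals below are expressed by [B1], [B2] and [A2]. *)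
pose A1 := cintegral setT (fun t => E t * Y1 t * f0 t).
pose A2 := cintegral setT (fun t => E t * Y2 t * f0 t).
pose B1 := cintegral setT (fun t => E t * Y1 t * fp t).
pose B2 := cintegral setT (fun t => E t * Y2 t * fp t).
have I0 : has_integral (fun t => E t * Y0 t * f0 t) (eps * B1) := conj j1 J.
have I1 : has_integral (fun t => E t * Y1 t * f0 t) A1 := conj k1 erefl.
have I1' : A1 = eps * B2 := K.
have I2 : has_integral (fun t => E t * Y2 t * f0 t) A2 := conj m2 erefl.
have P1 : has_integral (fun t => E t * Y1 t * fp t) B1 := conj j2 erefl.
have P2 : has_integral (fun t => E t * Y2 t * fp t) B2 := conj k2 erefl.
have M0 : has_integral (fun t => E t * Y0 t * fm t) (eps * A1) := conj l1 L.
have M1 : has_integral (fun t => E t * Y1 t * fm t) (eps * A2) := conj m1 M.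
clear j1 j2 J k1 k2 K l1 l2 L m1 m2 M hg dg hf' df'.
pose q : R[i] := (expR (- c))%:C.
have W t : S c p r (a%:C - ci * t%:C) = Y0 t + (1 + q) * Y1 t + q * Y2 t.
  exact: S_lift.
have W' t : (a%:C - ci * t%:C) * S c p r (a%:C - ci * t%:C)
    = (p + r * q) * Y1 t + (p + r) * q * Y2 t.
  exact: S_lift_parts.
exists (eps * B1 + (1 + q) * A1 + q * A2); split.
  have := has_integralD (has_integralD I0 (has_integralZ (1 + q) I1)) (has_integralZ q I2).
  congr has_integral; apply/funext => t; rewrite W -/(E t) /on_line -/(f0 t).
  by move: (E t) (Y0 t) (Y1 t) (Y2 t) (f0 t) => v0 v1 v2 v3 v4; ring.
have prE : p + r = a%:C + a%:C.
  by rewrite /p /r half_minusE half_plusE; ring.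
pose C : R[i] := (2 * coshR phi)%:C.
(* The coefficients arise from p + r = 2 a, hence (a + i t) S = (p + r) S - (a - i t) S, and from t
   S = i (a - i t) S - i a S. *)
have := has_integralD
  (has_integralD (has_integralZ (ci * (p + r)) M0)
    (has_integralZ (ci * ((p + r) * (1 + q) - (p + r * q))) M1))
  (has_integralD (has_integralD (has_integralZ (- (C * ci * a%:C)) I0)
      (has_integralD (has_integralZ (C * ci * ((p + r * q) - a%:C * (1 + q))) I1)
        (has_integralZ (C * ci * ((p + r) * q - a%:C * q)) I2)))
    (has_integralD (has_integralZ (- (ci * (p + r * q))) P1)
      (has_integralZ (- (ci * ((p + r) * q))) P2))).
set U := (U in has_integral U _) => H.
have -> : (fun t => expo phi t%:C * S c p r (a%:C - ci * t%:C) * opL alpha phi f t) = U.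
  apply/funext => t; rewrite /U /opL -/(fm t) -/(f0 t) -/(fp t) -/(E t).
  rewrite half_minusE half_plusE.
  have -> : (2 * coshR phi * t)%:C = C * t%:C by rewrite rmorphM.
  have Wt := W t; have Wt' := W' t.
  have W1 : (a%:C + ci * t%:C) * S c p r (a%:C - ci * t%:C)
      = (p + r) * (Y0 t + (1 + q) * Y1 t + q * Y2 t)
        - ((p + r * q) * Y1 t + (p + r) * q * Y2 t).
    by rewrite -Wt' -Wt prE; move: (S _ _ _ _) => v; ring.
  have W2 : t%:C * S c p r (a%:C - ci * t%:C)
      = ci * ((p + r * q) * Y1 t + (p + r) * q * Y2 t)
        - ci * a%:C * (Y0 t + (1 + q) * Y1 t + q * Y2 t).
    rewrite -Wt' -Wt; move: (S _ _ _ _) => v.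
    transitivity (- (ci * ci) * (t%:C * v)); last by ring.
    by rewrite ci2 opprK mul1r.
  have dist (V k e1 e3 x1 x2 x3 : R[i]) :
    e1 * V * (ci * k * x1 + C * t%:C * x2 - ci * e3 * x3)
    = e1 * (ci * (k * V) * x1 + C * (t%:C * V) * x2 - ci * (e3 * V) * x3) by ring.
  rewrite (dist (S c p r _)) W1 W2 Wt'.
  by move: (E t) (Y0 t) (Y1 t) (Y2 t) (f0 t) (fm t) (fp t) (a%:C) => v0 v1 v2 v3 v4 v5 v6 v7; ring.
clearbody U; apply: eq_has_integral H _; rewrite I1'.
have u0 : (expR phi)%:C != 0 :> R[i].
  by rewrite -cabs_eq0 cabs_real normr_eq0 gt_eqF// expR_gt0.
have epsE : eps = - (expR phi)%:C^-1 by rewrite /eps expRN fmorphV.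
have qE : q = (expR phi)%:C^-1 * (expR phi)%:C^-1.
  by rewrite /q expRN fmorphV -invfM -rmorphM -expRD; congr ((expR _)%:C^-1); ring.
have CE : C = (expR phi)%:C + (expR phi)%:C^-1.
  rewrite /C /coshR mulrC divfK ?pnatr_eq0// rmorphD expRN.
  by rewrite /= -fmorphV.
(* The factor 1 is written as - (ci * ci): the closing [field] treats [ci] as a free variable, and
   in this form the identity holds as one of rational functions. *)
have SE : (2 * s * sinhR phi)%:C = - (ci * ci) * s%:C * ((expR phi)%:C - (expR phi)%:C^-1).
  rewrite ci2 opprK mul1r -fmorphV -rmorphB -rmorphM; congr (_%:C).
  by rewrite /sinhR expRN; field; rewrite gt_eqF// expR_gt0.
rewrite SE CE qE epsE /p /r half_minusE half_plusE.
by move: u0; move: (expR phi)%:C (s%:C) (a%:C) (B1) (B2) (A2) => u v w x1 x2 x3 u0; field.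
Qed.

End ShiftedIntegrals.

(** * Square integrability and conclusion *)

Section SquareIntegrable.
Variable R : realType.
Local Notation ci := (ci R).
Local Notation re := (@complex.Re R).
Local Notation im := (@complex.Im R).
Variables (alpha phi : R) (f : R[i] -> R[i]).
Hypotheses (alpha0 : 0 < alpha) (phi0 : 0 < phi) (Hf : in_Hw alpha f).
Implicit Types (t : R).

Lemma Hw_ccontinuous (w : R[i]) t : `|im w| <= 1 -> ccontinuous (fun u => f (u%:C + w)) t.
Proof.
have [d d0 hf] := Hw_holo Hf.
rewrite ler_norml => /andP[w1 w2].
have [u Hu] : exists u, cderiv f (t%:C + w) u.
  by apply: hf; rewrite ImD /=; apply/andP; split; lra.
exact: (cderiv_ccontinuous (contraction_horizontal w) Hu).
Qed.

Lemma envelope_shift b t : 1 <= `|t| -> `|t| * envelope (b + 1) t = envelope b t.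
Proof.
move=> t1; have t0 : 0 < `|t| := lt_le_trans ltr01 t1.
by rewrite /envelope -{1}(lnK t0) -expRD; congr expR; ring.
Qed.

Lemma on_line_L2w : in_L2w alpha (on_line f).
Proof.
have [e e0 [C C0 [N N1 df]]] := Hw_decays alpha0 Hf.
apply: (@decay_L2w R alpha (alpha / 2 + 1 + e) _ C N) => //.
- by move: e0; lra.
- move=> t; have := @Hw_ccontinuous 0 t; rewrite normr0 ler01 => /(_ isT).
  by under eq_fun do rewrite addr0.
- by move=> t Nt; apply: (df t%:C) => //=; apply/andP; split; lra.
Qed.

(** The coefficients of L grow linearly and cost one power of |t|. Of the exponent alpha / 2 + 1 + e
    given by H[w] there remains alpha / 2 + e, still above the threshold of [decay_L2w]. *)
Lemma opL_L2w : in_L2w alpha (opL alpha phi f).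
Proof.
have [e e0 [C C0 [N N1 df]]] := Hw_decays alpha0 Hf.
have ci1 : `|im ci| <= 1 by rewrite /= normr1.
have ci1' : `|im (- ci)| <= 1 by rewrite ImN normrN.
have lin (x y : R) t : ccontinuous (fun u => x +i* (y * u)) t.
  by split; [exact: cvg_cst | apply: cvgM; [exact: cvg_cst | exact: cvg_id]].
have lin1 t : ccontinuous (fun u => (alpha / 2) +i* u) t.
  by under eq_fun do rewrite -[X in _ +i* X]mul1r; exact: lin.
have lin2 t : ccontinuous (fun u => (alpha / 2) -i* u) t.
  by under eq_fun do rewrite -[X in _ +i* X]mulN1r; exact: lin.
have ch : 0 <= 2 * coshR phi.
  by rewrite /coshR mulr_ge0// divr_ge0// addr_ge0 ?expR_ge0.
pose K := 2 * (alpha / 2 + 1) + 2 * coshR phi.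
have K0 : 0 <= K by rewrite /K addr_ge0//; move: alpha0; lra.
apply: (@decay_L2w R alpha (alpha / 2 + e) _ (K * C) N alpha0 _ (mulr_ge0 K0 C0) N1).
- by move: e0; lra.
- move=> t; rewrite /opL; apply: ccontinuousB; first apply: ccontinuousD.
  + by apply: ccontinuousM; [exact: ccontinuousZ | exact: Hw_ccontinuous].
  + apply: ccontinuousM.
      by apply: ccontinuous_real; apply: cvgM; [exact: cvg_cst | exact: cvg_id].
    have := @Hw_ccontinuous 0 t; rewrite normr0 ler01 => /(_ isT).
    by under eq_fun do rewrite addr0.
  + by apply: ccontinuousM; [exact: ccontinuousZ | exact: Hw_ccontinuous].
move=> t Nt; have t1 := le_trans N1 Nt.
set B := C * envelope (alpha / 2 + 1 + e) t.
have bound w : re w = 0 -> `|im w| <= 1 -> cabs (f (t%:C + w)) <= B.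
  move=> w0 w1; have rw : re (t%:C + w) = t by rewrite ReD w0 addr0.
  by rewrite /B -[in leRHS]rw; apply: df; rewrite ?rw// ImD add0r -ler_norml.
have bm : cabs (f (t%:C - ci)) <= B by apply: bound => //=; rewrite oppr0.
have bp : cabs (f (t%:C + ci)) <= B by apply: bound.
have b0 : cabs (f t%:C) <= B by rewrite -[t%:C]addr0; apply: bound; rewrite //= normr0.
have B0 : 0 <= B by rewrite mulr_ge0 ?expR_ge0.
have half (y : R) : `|y| = `|t| -> cabs ((alpha / 2) +i* y) <= (alpha / 2 + 1) * `|t|.
  move=> yt; apply: (le_trans (cabs_le_ReIm _)); rewrite /= yt ger0_norm; last by move: alpha0; lra.
  rewrite mulrDl mul1r lerD2r ler_peMr//; move: alpha0; lra.
have t0 := normr_ge0 t.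
have Ee : envelope (alpha / 2 + e) t = `|t| * envelope (alpha / 2 + 1 + e) t.
  by rewrite (_ : alpha / 2 + 1 + e = alpha / 2 + e + 1) ?(envelope_shift _ t1)//; ring.
rewrite Ee (_ : K * C * (`|t| * _) = (alpha / 2 + 1) * `|t| * B + 2 * coshR phi * `|t| * B
  + (alpha / 2 + 1) * `|t| * B); last by rewrite /K /B; ring.
rewrite /opL; apply: (le_trans (cabsB _ _)); apply: lerD; first apply: (le_trans (cabsD _ _)); first apply: lerD.
- by rewrite !cabsM cabs_ci mul1r; apply: ler_pM; rewrite ?cabs_ge0// half.
- by rewrite cabsM cabs_real normrM (ger0_norm ch); apply: ler_pM; rewrite ?cabs_ge0// mulr_ge0.
- by rewrite !cabsM cabs_ci mul1r; apply: ler_pM; rewrite ?cabs_ge0// half// normrN.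
Qed.

End SquareIntegrable.

(** Square integrability and convergence of both integrals are asserted together with the identity,
    so that neither side rests on a default value of the integral. *)
Theorem theorem5p3 (R : realType) (alpha phi : R)
    (alpha_gt0 : 0 < alpha) (phi_gt0 : 0 < phi)
    (f : complex R -> complex R) (f_Hw : in_Hw alpha f) :
  [/\ in_L2w alpha (on_line f),
      in_L2w alpha (opL alpha phi f) &
      forall s : R,
        [/\ cintegrable setT (inv_vilenkin_integrand alpha phi (on_line f) s),
            cintegrable setT (inv_vilenkin_integrand alpha phi (opL alpha phi f) s) &
            inv_vilenkin alpha phi (opL alpha phi f) s
              = opN phi (inv_vilenkin alpha phi (on_line f)) s]].
Proof.
split; [exact: on_line_L2w | exact: opL_L2w |] => s.
have [A [HA HL]] := has_integral_opL alpha_gt0 phi_gt0 s f_Hw.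
have E g : inv_vilenkin_integrand alpha phi g s = _ :=
  funext (inv_vilenkin_integrandE alpha_gt0 phi_gt0 g s).
have := has_integralZ (mass alpha) HA; rewrite -(E (on_line f)) => -[i1 e1].
have := has_integralZ (mass alpha) HL; rewrite -(E (opL alpha phi f)) => -[i2 e2].
by split=> //; rewrite /opN /inv_vilenkin e1 e2 !(mulrCA _ (2 * s * sinhR phi)%:C).
Qed.
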